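(* Let $q$ be a prime number and let $\mathcal{C}$ be a modular category of Frobenius-Perron dimension $q^3$. Then one of the following holds: (1) $\mathcal{C}$ is pointed; or (2) $\mathcal{C}$ is equivalent, as a braided fusion category, to a Deligne tensor product $\mathcal{B}\boxtimes\mathcal{I}$, where $\mathcal{B}$ is a pointed modular category of Frobenius-Perron dimension $2$ and $\mathcal{I}$ is an Ising category.
   Context: All fusion categories are over an algebraically closed field $k$ of characteristic $0$: a fusion category is a $k$-linear semisimple rigid tensor category with finitely many isomorphism classes of simple objects, finite-dimensional morphism spaces, and simple unit object. A fusion category is pointed if all its simple objects are invertible. A braided fusion category $\mathcal{C}$ with braiding $c$ is non-degenerate if its Müger center $\{X\in\mathcal{C} : c_{Y,X}c_{X,Y}=\mathrm{id}_{X\otimes Y}\ \text{for all } Y\in\mathcal{C}\}$ is trivial (consists of direct sums of the unit object). A modular category is a non-degenerate braided fusion category with a spherical structure. A braided fusion category of integer Frobenius-Perron dimension always has a spherical structure, so it is modular if and only if it is non-degenerate. An Ising category is a non-pointed fusion category $\mathcal{I}$ whose group of isomorphism classes of invertible objects has order $2$ and which has, up to isomorphism, exactly one non-invertible simple object $X$, with $X\otimes X$ the direct sum of the two invertible objects (so $\operatorname{FPdim}(X)=\sqrt2$ and $\operatorname{FPdim}(\mathcal{I})=4$). In the claim it is equipped with a braiding. *)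

(* Defs.v *)
From mathcomp Require Import all_boot all_order all_algebra all_field.

Set Implicit Arguments.
Unset Strict Implicit.
Unset Printing Implicit Defensive.
Import Order.TTheory GRing.Theory Num.Theory.
Local Open Scope ring_scope.

Declare Scope cat_scope.
Delimit Scope cat_scope with cat.
Open Scope cat_scope.

Record lin_cat (k : fieldType) := LinCat {
  obj :> Type;
  hom : obj -> obj -> lmodType k;
  idm : forall X, hom X X;
  comp : forall X Y Z, hom Y Z -> hom X Y -> hom X Z;
  compA : forall W X Y Z (h : hom Y Z) (g : hom X Y) (f : hom W X),
    comp h (comp g f) = comp (comp h g) f;
  comp1m : forall X Y (f : hom X Y), comp (idm Y) f = f;
  compm1 : forall X Y (f : hom X Y), comp f (idm X) = f;
  comp_linearr : forall X Y Z (g : hom Y Z), linear (fun f : hom X Y => comp g f);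
  comp_linearl : forall X Y Z (f : hom X Y), linear (fun g : hom Y Z => comp g f) }.

Arguments hom {k C} X Y : rename.
Arguments idm {k C} X : rename.
Arguments comp {k C X Y Z} g f : rename.
Notation "g ∘ f" := (comp g f) (at level 40, left associativity) : cat_scope.

Record iso (k : fieldType) (C : lin_cat k) (X Y : C) := Iso {
  fwd :> hom X Y;
  inv : hom Y X;
  fwdK : inv ∘ fwd = idm X;
  invK : fwd ∘ inv = idm Y }.

Definition isomorphic (k : fieldType) (C : lin_cat k) (X Y : C) : Prop :=
  inhabited (iso X Y).

Section Abelian.
Variables (k : fieldType) (C : lin_cat k).
Implicit Types X Y Z : C.

Definition is_iso X Y (f : hom X Y) : Prop := exists i : iso X Y, f = i.

Definition is_zero X : Prop := idm X = 0.

(* For an empty index type this says that S is a zero object. *)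
Definition direct_sum (I : finType) (s : I -> C) (S : C) : Prop :=
  exists (inj : forall i, hom (s i) S) (prj : forall i, hom S (s i)),
    [/\ forall i, prj i ∘ inj i = idm (s i),
        forall i j, i != j -> prj i ∘ inj j = 0
      & \sum_i (inj i ∘ prj i) = idm S].

Definition mono X Y (f : hom X Y) : Prop :=
  forall Z (g h : hom Z X), f ∘ g = f ∘ h -> g = h.

Definition epi X Y (f : hom X Y) : Prop :=
  forall Z (g h : hom Y Z), g ∘ f = h ∘ f -> g = h.

Definition is_kernel K X Y (f : hom X Y) (i : hom K X) : Prop :=
  f ∘ i = 0 /\
  forall Z (g : hom Z X), f ∘ g = 0 -> exists! u : hom Z K, i ∘ u = g.

Definition is_cokernel X Y Q (f : hom X Y) (p : hom Y Q) : Prop :=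
  p ∘ f = 0 /\
  forall Z (g : hom Y Z), g ∘ f = 0 -> exists! u : hom Q Z, u ∘ p = g.

Definition abelian_cat : Prop :=
  [/\ forall (n : nat) (s : 'I_n -> C), exists S, direct_sum s S,
      forall X Y (f : hom X Y), exists K (i : hom K X), is_kernel f i,
      forall X Y (f : hom X Y), exists Q (p : hom Y Q), is_cokernel f p,
      forall X Y (f : hom X Y), mono f -> exists Z (g : hom Y Z), is_kernel g f
    & forall X Y (f : hom X Y), epi f -> exists Z (g : hom Z X), is_cokernel g f].

Definition simple X : Prop :=
  ~ is_zero X /\ forall Y (f : hom Y X), mono f -> is_zero Y \/ is_iso f.

Definition semisimple : Prop :=
  forall X, exists (n : nat) (s : 'I_n -> C),
    (forall i, simple (s i)) /\ direct_sum s X.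

End Abelian.

Record functor (k : fieldType) (C D : lin_cat k) := Functor {
  fobj :> C -> D;
  fmap : forall X Y, hom X Y -> hom (fobj X) (fobj Y);
  fmap1 : forall X, fmap (idm X) = idm (fobj X);
  fmap_comp : forall X Y Z (g : hom Y Z) (f : hom X Y),
    fmap (g ∘ f) = fmap g ∘ fmap f;
  fmap_linear : forall X Y, linear (@fmap X Y) }.

Arguments fmap {k C D} F {X Y} f : rename.

Record bifunctor (k : fieldType) (B C D : lin_cat k) := Bifunctor {
  bobj :> B -> C -> D;
  bmap : forall X X' Y Y', hom X X' -> hom Y Y' -> hom (bobj X Y) (bobj X' Y');
  bmap1 : forall X Y, bmap (idm X) (idm Y) = idm (bobj X Y);
  bmap_comp : forall X X' X'' Y Y' Y'' (f' : hom X' X'') (f : hom X X')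
      (g' : hom Y' Y'') (g : hom Y Y'),
    bmap (f' ∘ f) (g' ∘ g) = bmap f' g' ∘ bmap f g;
  bmap_linearr : forall X X' Y Y' (f : hom X X'),
    linear (fun g : hom Y Y' => bmap f g);
  bmap_linearl : forall X X' Y Y' (g : hom Y Y'),
    linear (fun f : hom X X' => bmap f g) }.

Arguments bmap {k B C D} T {X X' Y Y'} f g : rename.

Section Functors.
Variable k : fieldType.

Definition natural (C D : lin_cat k) (F G : functor C D)
    (eta : forall X, hom (F X) (G X)) : Prop :=
  forall X Y (f : hom X Y), eta Y ∘ fmap F f = fmap G f ∘ eta X.

Definition right_exact (C D : lin_cat k) (F : functor C D) : Prop :=
  forall X Y Z (f : hom X Y) (p : hom Y Z),
    is_cokernel f p -> is_cokernel (fmap F f) (fmap F p).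

Definition right_exact2 (B C D : lin_cat k) (T : bifunctor B C D) : Prop :=
  (forall X Y Y' Q (f : hom Y Y') (p : hom Y' Q), is_cokernel f p ->
     is_cokernel (bmap T (idm X) f) (bmap T (idm X) p)) /\
  (forall Y X X' Q (f : hom X X') (p : hom X' Q), is_cokernel f p ->
     is_cokernel (bmap T f (idm Y)) (bmap T p (idm Y))).

Definition is_equivalence (C D : lin_cat k) (F : functor C D) : Prop :=
  exists (G : functor D C)
         (eta : forall X, iso (G (F X)) X) (eps : forall Y, iso (F (G Y)) Y),
    (forall X X' (f : hom X X'), eta X' ∘ fmap G (fmap F f) = f ∘ eta X) /\
    (forall Y Y' (g : hom Y Y'), eps Y' ∘ fmap F (fmap G g) = g ∘ eps Y).

(* The universal property of the Deligne tensor product: for every abelian A,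
   precomposition with T is an equivalence from right exact functors D -> A
   to bilinear bifunctors B x C -> A that are right exact in each variable;
   the first clause is essential surjectivity, the second full faithfulness. *)
Definition is_deligne (B C D : lin_cat k) (T : bifunctor B C D) : Prop :=
  [/\ abelian_cat D, right_exact2 T
    & forall A : lin_cat k, abelian_cat A ->
      (forall G : bifunctor B C A, right_exact2 G ->
         exists (F : functor D A) (u : forall X Y, iso (F (T X Y)) (G X Y)),
           right_exact F /\
           forall X X' Y Y' (f : hom X X') (g : hom Y Y'),
             u X' Y' ∘ fmap F (bmap T f g) = bmap G f g ∘ u X Y) /\
      (forall F F' : functor D A, right_exact F -> right_exact F' ->
       forall theta : (forall X Y, hom (F (T X Y)) (F' (T X Y))),
         (forall X X' Y Y' (f : hom X X') (g : hom Y Y'),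
            theta X' Y' ∘ fmap F (bmap T f g)
            = fmap F' (bmap T f g) ∘ theta X Y) ->
         exists eta : forall Z, hom (F Z) (F' Z),
           [/\ natural eta, forall X Y, eta (T X Y) = theta X Y
             & forall eta' : (forall Z, hom (F Z) (F' Z)), natural eta' ->
                 (forall X Y, eta' (T X Y) = theta X Y) ->
                 forall Z, eta' Z = eta Z])].

End Functors.

Record mon_cat (k : fieldType) := MonCat {
  mon_lin :> lin_cat k;
  tens : bifunctor mon_lin mon_lin mon_lin;
  one : mon_lin;
  assoc : forall X Y Z, iso (tens (tens X Y) Z) (tens X (tens Y Z));
  lunit : forall X, iso (tens one X) X;
  runit : forall X, iso (tens X one) X;
  assoc_nat : forall X X' Y Y' Z Z'
      (f : hom X X') (g : hom Y Y') (h : hom Z Z'),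
    assoc X' Y' Z' ∘ bmap tens (bmap tens f g) h
    = bmap tens f (bmap tens g h) ∘ assoc X Y Z;
  lunit_nat : forall X Y (f : hom X Y),
    lunit Y ∘ bmap tens (idm one) f = f ∘ lunit X;
  runit_nat : forall X Y (f : hom X Y),
    runit Y ∘ bmap tens f (idm one) = f ∘ runit X;
  pentagon : forall W X Y Z,
    assoc W X (tens Y Z) ∘ assoc (tens W X) Y Z
    = bmap tens (idm W) (assoc X Y Z) ∘ assoc W (tens X Y) Z
      ∘ bmap tens (assoc W X Y) (idm Z);
  triangle : forall X Y,
    bmap tens (idm X) (lunit Y) ∘ assoc X one Y
    = bmap tens (runit X) (idm Y) }.

Arguments one {k C} : rename.
Arguments assoc {k C} X Y Z : rename.
Arguments lunit {k C} X : rename.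
Arguments runit {k C} X : rename.
Notation "X ⊗ Y" := (bobj (tens _) X Y)
  (at level 35, right associativity) : cat_scope.
Notation "f ⊗m g" := (bmap (tens _) f g)
  (at level 35, right associativity) : cat_scope.

Definition left_dual (k : fieldType) (C : mon_cat k) (X X' : C)
    (e : hom (X' ⊗ X) one) (c : hom one (X ⊗ X')) : Prop :=
  runit X ∘ (idm X ⊗m e) ∘ assoc X X' X ∘ (c ⊗m idm X) = lunit X /\
  lunit X' ∘ (e ⊗m idm X') ∘ inv (assoc X' X X') ∘ (idm X' ⊗m c) = runit X'.

(* Left duals, representatives irr i of the isomorphism classes of simple
   objects and the dimensions of the morphism spaces are recorded as data. *)
Record fusion_cat (k : fieldType) := FusionCat {
  fus_mon :> mon_cat k;
  fus_abelian : abelian_cat fus_mon;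
  fus_semisimple : semisimple fus_mon;
  dual : fus_mon -> fus_mon;
  ev : forall X, hom (dual X ⊗ X) one;
  coev : forall X, hom one (X ⊗ dual X);
  dualP : forall X, left_dual (ev X) (coev X);
  right_dual_ex : forall X, exists (Y : fus_mon) (e : hom (X ⊗ Y) one) (c : hom one (Y ⊗ X)),
    left_dual e c;
  one_simple : simple (one : fus_mon);
  rank : nat;
  irr : 'I_rank -> fus_mon;
  irr_simple : forall i, simple (irr i);
  irr_inj : forall i j, isomorphic (irr i) (irr j) -> i = j;
  irr_full : forall X, simple X -> exists i, isomorphic X (irr i);
  hdim : fus_mon -> fus_mon -> nat;
  hdimP : forall X Y, Vector.axiom (hdim X Y) (@hom k fus_mon X Y) }.

Arguments dual {k C} X : rename.
Arguments ev {k C} X : rename.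
Arguments coev {k C} X : rename.
Arguments irr {k} C i : rename.
Arguments hdim {k C} X Y : rename.

Section Fusion.
Variables (k : fieldType) (C : fusion_cat k).
Implicit Types X Y Z : C.

Definition invertible X : Prop := is_iso (ev X) /\ is_iso (coev X).

Definition pointed : Prop := forall X, simple X -> invertible X.

Definition is_ising : Prop :=
  ~ pointed /\
  exists g X : C,
    [/\ invertible g /\ ~ isomorphic g one,
        forall Y, invertible Y -> isomorphic Y one \/ isomorphic Y g,
        simple X /\ ~ invertible X,
        forall Y, simple Y -> ~ invertible Y -> isomorphic Y X
      & direct_sum (fun b : bool => if b then g else one) (X ⊗ X)].

(* The largest nonnegative (real) eigenvalue of a matrix, as a root of its
   characteristic polynomial. For algC, 0 <= a means that a is real and
   nonnegative. *)
Definition max_eigenvalue n (M : 'M[algC]_n) : algC :=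
  \big[Num.max/0]_(a <- sval (closed_field_poly_normal (char_poly M)) | 0 <= a) a.

(* The fusion coefficient N_ij^l, i.e. the multiplicity of irr l in the
   semisimple object irr i ⊗ irr j, is dim Hom(irr l, irr i ⊗ irr j). *)
Definition left_mul_mx (i : 'I_(rank C)) : 'M[algC]_(rank C) :=
  \matrix_(j, l) (hdim (irr C l) (irr C i ⊗ irr C j))%:R.

Definition FPdim_irr (i : 'I_(rank C)) : algC := max_eigenvalue (left_mul_mx i).

Definition FPdim : algC := \sum_i FPdim_irr i ^+ 2.

(* The morphism W -> dual Z corresponding to a pairing W ⊗ Z -> 1. *)
Definition mate (W Z : C) (e : hom (W ⊗ Z) one) : hom W (dual Z) :=
  lunit (dual Z) ∘ (e ⊗m idm (dual Z)) ∘ inv (assoc W Z (dual Z))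
    ∘ (idm W ⊗m coev Z) ∘ inv (runit W).

Definition dual_map X Y (f : hom X Y) : hom (dual Y) (dual X) :=
  mate (ev Y ∘ (idm (dual Y) ⊗m f)).

(* The canonical isomorphism dual Y ⊗ dual X -> dual (X ⊗ Y). *)
Definition dual_tens X Y : hom (dual Y ⊗ dual X) (dual (X ⊗ Y)) :=
  mate (ev Y ∘ (idm (dual Y) ⊗m
                 (lunit Y ∘ (ev X ⊗m idm Y) ∘ inv (assoc (dual X) X Y)))
        ∘ assoc (dual Y) (dual X) (X ⊗ Y)).

(* Monoidality is the compatibility of j with the canonical isomorphisms
   dual (dual X) ⊗ dual (dual Y) -> dual (dual Y ⊗ dual X)
                                 <- dual (dual (X ⊗ Y)). *)
Definition pivotal (j : forall X, iso X (dual (dual X))) : Prop :=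
  (forall X Y (f : hom X Y), j Y ∘ f = dual_map (dual_map f) ∘ j X) /\
  (forall X Y, dual_map (dual_tens X Y) ∘ j (X ⊗ Y)
               = dual_tens (dual Y) (dual X) ∘ (j X ⊗m j Y)).

Definition pivotal_dim (j : forall X, iso X (dual (dual X))) X :
    hom (one : C) one :=
  ev (dual X) ∘ (j X ⊗m idm (dual X)) ∘ coev X.

Definition spherical (j : forall X, iso X (dual (dual X))) : Prop :=
  pivotal j /\ forall X, pivotal_dim j X = pivotal_dim j (dual X).

End Fusion.

Record braided_fusion_cat (k : fieldType) := BraidedFusionCat {
  br_fus :> fusion_cat k;
  braid : forall X Y : br_fus, iso (X ⊗ Y) (Y ⊗ X);
  braid_nat : forall X X' Y Y' (f : hom X X') (g : hom Y Y'),
    braid X' Y' ∘ (f ⊗m g) = (g ⊗m f) ∘ braid X Y;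
  hexagon1 : forall X Y Z,
    assoc Y Z X ∘ braid X (Y ⊗ Z) ∘ assoc X Y Z
    = (idm Y ⊗m braid X Z) ∘ assoc Y X Z ∘ (braid X Y ⊗m idm Z);
  hexagon2 : forall X Y Z,
    inv (assoc Z X Y) ∘ braid (X ⊗ Y) Z ∘ inv (assoc X Y Z)
    = (braid X Z ⊗m idm Y) ∘ inv (assoc X Z Y) ∘ (idm X ⊗m braid Y Z) }.

Arguments braid {k C} X Y : rename.

Section Braided.
Variable k : fieldType.
Implicit Types B C D : braided_fusion_cat k.

Definition in_mueger_center C (X : C) : Prop :=
  forall Y : C, braid Y X ∘ braid X Y = idm (X ⊗ Y).

Definition non_degenerate C : Prop :=
  forall X : C, in_mueger_center X ->
    exists n : nat, direct_sum (fun _ : 'I_n => one) X.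

Definition modular C : Prop :=
  non_degenerate C /\
  exists j : forall X : C, iso X (dual (dual X)), spherical j.

Definition braided_monoidal C D (F : functor C D) : Prop :=
  exists (J : forall X Y : C, iso (F X ⊗ F Y) (F (X ⊗ Y)))
         (e : iso (one : D) (F one)),
    [/\ forall X X' Y Y' (f : hom X X') (g : hom Y Y'),
          J X' Y' ∘ (fmap F f ⊗m fmap F g) = fmap F (f ⊗m g) ∘ J X Y,
        forall X Y Z,
          fmap F (assoc X Y Z) ∘ J (X ⊗ Y) Z ∘ (J X Y ⊗m idm (F Z))
          = J X (Y ⊗ Z) ∘ (idm (F X) ⊗m J Y Z) ∘ assoc (F X) (F Y) (F Z),
        forall X, fmap F (lunit X) ∘ J one X ∘ (e ⊗m idm (F X)) = lunit (F X),
        forall X, fmap F (runit X) ∘ J X one ∘ (idm (F X) ⊗m e) = runit (F X)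
      & forall X Y, fmap F (braid X Y) ∘ J X Y = J Y X ∘ braid (F X) (F Y)].

Definition braided_equivalent C D : Prop :=
  exists F : functor C D, is_equivalence F /\ braided_monoidal F.

(* The same conditions for T : B x C -> D, where B x C carries the
   componentwise tensor product and braiding. *)
Definition braided_monoidal2 B C D (T : bifunctor B C D) : Prop :=
  exists (J : forall (X X' : B) (Y Y' : C),
                iso (T X Y ⊗ T X' Y') (T (X ⊗ X') (Y ⊗ Y')))
         (e : iso (one : D) (T one one)),
    [/\ forall (X1 X1' X2 X2' : B) (Y1 Y1' Y2 Y2' : C)
          (f1 : hom X1 X1') (f2 : hom X2 X2')
          (g1 : hom Y1 Y1') (g2 : hom Y2 Y2'),
          J X1' X2' Y1' Y2' ∘ (bmap T f1 g1 ⊗m bmap T f2 g2)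
          = bmap T (f1 ⊗m f2) (g1 ⊗m g2) ∘ J X1 X2 Y1 Y2,
        forall (X1 X2 X3 : B) (Y1 Y2 Y3 : C),
          bmap T (assoc X1 X2 X3) (assoc Y1 Y2 Y3)
            ∘ J (X1 ⊗ X2) X3 (Y1 ⊗ Y2) Y3 ∘ (J X1 X2 Y1 Y2 ⊗m idm (T X3 Y3))
          = J X1 (X2 ⊗ X3) Y1 (Y2 ⊗ Y3) ∘ (idm (T X1 Y1) ⊗m J X2 X3 Y2 Y3)
            ∘ assoc (T X1 Y1) (T X2 Y2) (T X3 Y3),
        forall X Y,
          bmap T (lunit X) (lunit Y) ∘ J one X one Y ∘ (e ⊗m idm (T X Y))
          = lunit (T X Y),
        forall X Y,
          bmap T (runit X) (runit Y) ∘ J X one Y one ∘ (idm (T X Y) ⊗m e)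
          = runit (T X Y)
      & forall X X' Y Y',
          bmap T (braid X X') (braid Y Y') ∘ J X X' Y Y'
          = J X' X Y' Y ∘ braid (T X Y) (T X' Y')].

(* D is the Deligne tensor product of B and C as a braided fusion category:
   the last condition fixes its tensor product and braiding, e.g.
   (X ⊠ Y) ⊗ (X' ⊠ Y') = (X ⊗ X') ⊠ (Y ⊗ Y'). *)
Definition braided_deligne_product B C D : Prop :=
  exists T : bifunctor B C D, is_deligne T /\ braided_monoidal2 T.

End Braided.

(* Main.v *)
(** Let v_i be the Frobenius-Perron dimensions and d_i the dimensions of the simple
    objects for a spherical structure. The S-matrix diagonalizes the fusion ring, in
    particular its Casimir element sum_a X_a X_a^*, whose eigenvalues are the formal
    codegrees dim(C) / d_i^2. Its largest complex eigenvalue is FPdim(C), and comparing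
    the integer polynomials satisfied over k and over the algebraic numbers gives
    dim(C) = FPdim(C), d_i^2 = v_i^2 = n_i with n_i a natural number dividing q^3.

    Double braidings with invertible objects grade C, with components of equal
    dimension. If n_X = q^2, then the object X X^* lies in the trivial component and
    contains at least q invertible objects, which makes some component too large. So
    n_i is 1 or q, a product of two noninvertible simple objects is a sum of invertible
    ones, and counting gives q = 2 with 4 invertible and 2 noninvertible simple objects.
    Let g <> 1 be the invertible object in X X^* and b an invertible object other than
    1 and g. If b^2 = g, then g would braid trivially with itself and fix X, which forces
    g = 1. Hence b^2 = 1, and after replacing X by bX if necessary, b centralizes X. Then
    B = {1, b} is the centralizer of X, I = {1, g, X} is the centralizer of b, and the
    tensor product of C exhibits C as the Deligne product of B and I. *)

From HB Require Import structures.
From mathcomp Require Import all_boot all_order all_algebra all_field boolp.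
From mathcomp Require Import spectral sesquilinear ring zify.
Require Import Defs.

Set Implicit Arguments.
Unset Strict Implicit.
Unset Printing Implicit Defensive.
Import Order.TTheory GRing.Theory Num.Theory.
Local Open Scope ring_scope.

(** * Linear categories *)

(** Two fields are in play: dimensions of objects lie in [k], which comes with no order and no
    embedding into the complex numbers, while Frobenius-Perron dimensions lie in [algC]. Statements
    cross over only through integer data: characteristic polynomials and rational kernels of fusion
    matrices. Nondegeneracy is given as the absence of transparent objects, not as invertibility of
    the S-matrix. The bridge is the handle slide: a simple object on which every loop evaluates to
    its dimension is transparent, provided that the global dimension is nonzero. In [k] the latter
    cannot come from positivity of squares; it holds because every complex eigenvalue of the Casimir
    element is at least 1. Associators are avoided by evaluating diagrams on nested words ending in
    a variable object [T]. The Deligne product is a universal property against all abelian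
    categories. Semisimplicity splits all exact sequences, so every linear functor is right exact,
    and the property reduces to one fact: the products of simple objects of the two factors form a
    complete list of simple objects. *)

Section Additive.
Variables (k : fieldType) (U V : lmodType k) (f : U -> V).
Hypothesis lf : linear f.

Lemma linD u v : f (u + v) = f u + f v.
Proof. by have := lf 1 u v; rewrite !scale1r. Qed.

Lemma lin0 : f 0 = 0.
Proof. by apply: (addrI (f 0)); rewrite -linD !addr0. Qed.

Lemma linZ a u : f (a *: u) = a *: f u.
Proof. by have := lf a u 0; rewrite !addr0 lin0 addr0. Qed.

Lemma linN u : f (- u) = - f u.
Proof. by rewrite -scaleN1r linZ scaleN1r. Qed.

Lemma linB u v : f (u - v) = f u - f v.
Proof. by rewrite linD linN. Qed.

Lemma lin_sum I (r : seq I) P F : f (\sum_(i <- r | P i) F i) = \sum_(i <- r | P i) f (F i).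
Proof. exact: (big_morph f linD lin0). Qed.
End Additive.

Section LinCat.
Variables (k : fieldType) (C : lin_cat k).
Implicit Types X Y Z W : C.

Lemma compDr X Y Z (g : hom Y Z) (f f' : hom X Y) : g ∘ (f + f') = g ∘ f + g ∘ f'.
Proof. exact: (linD (comp_linearr g)). Qed.
Lemma compDl X Y Z (g g' : hom Y Z) (f : hom X Y) : (g + g') ∘ f = g ∘ f + g' ∘ f.
Proof. exact: (linD (comp_linearl f)). Qed.
Lemma compBr X Y Z (g : hom Y Z) (f f' : hom X Y) : g ∘ (f - f') = g ∘ f - g ∘ f'.
Proof. exact: (linB (comp_linearr g)). Qed.
Lemma compBl X Y Z (g g' : hom Y Z) (f : hom X Y) : (g - g') ∘ f = g ∘ f - g' ∘ f.
Proof. exact: (linB (comp_linearl f)). Qed.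
Lemma compZr X Y Z (g : hom Y Z) (f : hom X Y) a : g ∘ (a *: f) = a *: (g ∘ f).
Proof. exact: (linZ (comp_linearr g)). Qed.
Lemma compZl X Y Z (g : hom Y Z) (f : hom X Y) a : (a *: g) ∘ f = a *: (g ∘ f).
Proof. exact: (linZ (comp_linearl f)). Qed.
Lemma comp0r X Y Z (g : hom Y Z) : g ∘ (0 : hom X Y) = 0.
Proof. exact: (lin0 (comp_linearr g)). Qed.
Lemma comp0l X Y Z (f : hom X Y) : (0 : hom Y Z) ∘ f = 0.
Proof. exact: (lin0 (comp_linearl f)). Qed.
Lemma comp_sumr X Y Z (g : hom Y Z) I (r : seq I) P (F : I -> hom X Y) :
  g ∘ (\sum_(i <- r | P i) F i) = \sum_(i <- r | P i) g ∘ F i.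
Proof. exact: (lin_sum (comp_linearr g)). Qed.
Lemma comp_suml X Y Z (f : hom X Y) I (r : seq I) P (F : I -> hom Y Z) :
  (\sum_(i <- r | P i) F i) ∘ f = \sum_(i <- r | P i) F i ∘ f.
Proof. exact: (lin_sum (comp_linearl f)). Qed.

(** Composites are kept associated to the left, so two adjacent factors are in general not a
    subterm. [rw0] to [rw3] apply an equation between adjacent factors behind a prefix [e]. *)
Lemma rw2 X Y Y' Z (g : hom Y Z) (f : hom X Y) (g' : hom Y' Z) (f' : hom X Y') :
  g ∘ f = g' ∘ f' -> forall W (e : hom Z W), e ∘ g ∘ f = e ∘ g' ∘ f'.
Proof. by move=> E W e; rewrite -!compA E. Qed.

Lemma rw1 X Y Z (g : hom Y Z) (f : hom X Y) h :
  g ∘ f = h -> forall W (e : hom Z W), e ∘ g ∘ f = e ∘ h.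
Proof. by move=> E W e; rewrite -!compA E. Qed.

Lemma rw3 X Y Y' Z (h : hom Y' Z) (g : hom Y Y') (f : hom X Y) d :
  h ∘ g ∘ f = d -> forall W (e : hom Z W), e ∘ h ∘ g ∘ f = e ∘ d.
Proof. by move=> E W e; rewrite -!compA -E -!compA. Qed.

Lemma rw0 X Y (g : hom Y X) (f : hom X Y) :
  g ∘ f = idm X -> forall W (e : hom X W), e ∘ g ∘ f = e.
Proof. by move=> E W e; rewrite -!compA E compm1. Qed.

Definition iso_refl X : iso X X := Iso (comp1m (idm X)) (comp1m (idm X)).
Definition iso_sym X Y (f : iso X Y) : iso Y X := Iso (invK f) (fwdK f).
Lemma iso_trans_K X Y Z (g : iso Y Z) (f : iso X Y) :
  (inv f ∘ inv g) ∘ (g ∘ f) = idm X.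
Proof. by rewrite !compA (rw0 (fwdK g)) fwdK. Qed.
Lemma iso_trans_invK X Y Z (g : iso Y Z) (f : iso X Y) :
  (g ∘ f) ∘ (inv f ∘ inv g) = idm Z.
Proof. by rewrite !compA (rw0 (invK f)) invK. Qed.
Definition iso_trans X Y Z (g : iso Y Z) (f : iso X Y) : iso X Z :=
  Iso (iso_trans_K g f) (iso_trans_invK g f).

Lemma isomorphic_sym X Y : isomorphic X Y -> isomorphic Y X.
Proof. by case=> f; split; exact: iso_sym. Qed.
Lemma isomorphic_trans Y X Z : isomorphic X Y -> isomorphic Y Z -> isomorphic X Z.
Proof. by case=> f [g]; split; exact: iso_trans g f. Qed.
Lemma isomorphic_refl X : isomorphic X X.
Proof. by split; exact: iso_refl. Qed.

Lemma is_isoP X Y (f : hom X Y) :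
  is_iso f <-> exists g : hom Y X, g ∘ f = idm X /\ f ∘ g = idm Y.
Proof.
split=> [[i ->]|[g [gf fg]]]; first by exists (inv i); rewrite fwdK invK.
by exists (Iso gf fg).
Qed.

Lemma iso_can_l X Y Z (f : iso X Y) (g h : hom Z X) : f ∘ g = f ∘ h -> g = h.
Proof. by move=> E; rewrite -[g]comp1m -[h]comp1m -(fwdK f) -!compA E. Qed.
Lemma iso_can_r X Y Z (f : iso X Y) (g h : hom Y Z) : g ∘ f = h ∘ f -> g = h.
Proof. by move=> E; rewrite -[g]compm1 -[h]compm1 -(invK f) !compA E. Qed.

Lemma zero_hom_l X Y (f : hom X Y) : is_zero X -> f = 0.
Proof. by move=> zX; rewrite -[f]compm1 zX comp0r. Qed.
Lemma zero_hom_r X Y (f : hom X Y) : is_zero Y -> f = 0.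
Proof. by move=> zX; rewrite -[f]comp1m zX comp0l. Qed.

Lemma retract_simple X Y (i : hom X Y) (p : hom Y X) :
  p ∘ i = idm X -> ~ is_zero X -> simple Y -> is_iso i.
Proof.
move=> pi nzX [_ /(_ X i)]; case=> // Z g h E.
by rewrite -[g]comp1m -[h]comp1m -pi -!compA E.
Qed.

Lemma mono_kernel0 X Y (f : hom X Y) :
  (forall Z (g : hom Z X), f ∘ g = 0 -> g = 0) -> mono f.
Proof.
move=> H Z g h E; apply/eqP; rewrite -subr_eq0; apply/eqP; apply: H.
by rewrite compBr E subrr.
Qed.

Lemma simple_iso X Y : isomorphic X Y -> simple X -> simple Y.
Proof.
move=> [f] [nzX sX]; split=> [zY|Z g mg].
  by apply: nzX; rewrite /is_zero -(fwdK f) (zero_hom_l (inv f) zY) comp0l.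
have mg' : mono (inv f ∘ g).
  move=> W u v; rewrite -!compA => E; apply: mg.
  exact: (iso_can_l (f := iso_sym f)) E.
case: (sX _ _ mg') => [|/is_isoP [h [h1 h2]]]; [by left|right].
apply/is_isoP; exists (h ∘ inv f); split; first by rewrite -compA.
by apply: (iso_can_l (f := iso_sym f)); rewrite /= compm1 !compA h2 comp1m.
Qed.
End LinCat.

Section Bif.
Variables (k : fieldType) (B C D : lin_cat k) (T : bifunctor B C D).
Lemma bmapDr X X' Y Y' (f : hom X X') (g g' : hom Y Y') :
  bmap T f (g + g') = bmap T f g + bmap T f g'.
Proof. exact: (linD (bmap_linearr T f)). Qed.
Lemma bmapZr X X' Y Y' (f : hom X X') (g : hom Y Y') a :
  bmap T f (a *: g) = a *: bmap T f g.
Proof. exact: (linZ (bmap_linearr T f)). Qed.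
Lemma bmap0r X X' Y Y' (f : hom X X') : bmap T f (0 : hom Y Y') = 0.
Proof. exact: (lin0 (bmap_linearr T f)). Qed.
Lemma bmap_sumr X X' Y Y' (f : hom X X') I (r : seq I) P (F : I -> hom Y Y') :
  bmap T f (\sum_(i <- r | P i) F i) = \sum_(i <- r | P i) bmap T f (F i).
Proof. exact: (lin_sum (bmap_linearr T f)). Qed.
Lemma bmapDl X X' Y Y' (f f' : hom X X') (g : hom Y Y') :
  bmap T (f + f') g = bmap T f g + bmap T f' g.
Proof. exact: (linD (bmap_linearl T g)). Qed.
Lemma bmapZl X X' Y Y' (f : hom X X') (g : hom Y Y') a :
  bmap T (a *: f) g = a *: bmap T f g.
Proof. exact: (linZ (bmap_linearl T g)). Qed.
Lemma bmap0l X X' Y Y' (g : hom Y Y') : bmap T (0 : hom X X') g = 0.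
Proof. exact: (lin0 (bmap_linearl T g)). Qed.
Lemma bmap_suml X X' Y Y' (g : hom Y Y') I (r : seq I) P (F : I -> hom X X') :
  bmap T (\sum_(i <- r | P i) F i) g = \sum_(i <- r | P i) bmap T (F i) g.
Proof. exact: (lin_sum (bmap_linearl T g)). Qed.
Lemma bmap_compr X Y Y' Y'' (g' : hom Y' Y'') (g : hom Y Y') :
  bmap T (idm X) (g' ∘ g) = bmap T (idm X) g' ∘ bmap T (idm X) g.
Proof. by rewrite -bmap_comp compm1. Qed.
Lemma bmap_compl X X' X'' Y (f' : hom X' X'') (f : hom X X') :
  bmap T (f' ∘ f) (idm Y) = bmap T f' (idm Y) ∘ bmap T f (idm Y).
Proof. by rewrite -bmap_comp compm1. Qed.
Lemma bmap_lr X X' Y Y' (f : hom X X') (g : hom Y Y') :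
  bmap T (idm X') g ∘ bmap T f (idm Y) = bmap T f (idm Y') ∘ bmap T (idm X) g.
Proof. by rewrite -!bmap_comp !compm1 !comp1m. Qed.
Lemma bmapE X X' Y Y' (f : hom X X') (g : hom Y Y') :
  bmap T f g = bmap T (idm X') g ∘ bmap T f (idm Y).
Proof. by rewrite -!bmap_comp !compm1 !comp1m. Qed.

Lemma bmap_iso_K X X' Y Y' (f : iso X X') (g : iso Y Y') :
  bmap T (inv f) (inv g) ∘ bmap T f g = idm _.
Proof. by rewrite -bmap_comp !fwdK bmap1. Qed.
Lemma bmap_iso_invK X X' Y Y' (f : iso X X') (g : iso Y Y') :
  bmap T f g ∘ bmap T (inv f) (inv g) = idm _.
Proof. by rewrite -bmap_comp !invK bmap1. Qed.
Definition biso X X' Y Y' (f : iso X X') (g : iso Y Y') : iso (T X Y) (T X' Y') :=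
  Iso (bmap_iso_K f g) (bmap_iso_invK f g).
End Bif.

Lemma vaxiom_le (k : fieldType) m n (V : lmodType k) (W : lmodType k) (f : V -> W) :
  Vector.axiom m V -> Vector.axiom n W -> linear f -> injective f -> (m <= n)%N.
Proof.
move=> [r lr [r' rK r'K]] [s ls [s' sK s'K]] lf fI.
pose g (u : 'rV[k]_m) := s (f (r' u)).
have lr' : linear r' by move=> a u v; apply: (can_inj rK); rewrite r'K (lr a) !r'K.
have lg : linear g by move=> a u v; rewrite /g lr' lf ls.
pose M := \matrix_i g (delta_mx 0 i).
have gM u : g u = u *m M.
  rewrite mulmx_sum_row [in LHS](row_sum_delta u) (lin_sum lg).
  by apply: eq_bigr => i _; rewrite (linZ lg) rowK.
have : row_free M.
  apply/row_freeP; apply/row_freeP; rewrite -kermx_eq0; apply/eqP/row_matrixP => i.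
  rewrite row0; apply: (can_inj r'K); apply: fI; apply: (can_inj sK).
  change (g (row i (kermx M)) = g 0).
  by rewrite !gM mul0mx -row_mul mulmx_ker row0.
by rewrite /row_free => /eqP <-; rewrite rank_leq_col.
Qed.

Lemma vaxiom_eq (k : fieldType) m n (V W : lmodType k) (f : V -> W) (g : W -> V) :
  Vector.axiom m V -> Vector.axiom n W -> linear f -> linear g ->
  cancel f g -> cancel g f -> m = n.
Proof.
move=> hV hW lf lg fK gK; apply/eqP; rewrite eqn_leq.
by rewrite (vaxiom_le hV hW lf (can_inj fK)) (vaxiom_le hW hV lg (can_inj gK)).
Qed.

(** [Vector.axiom] supplies only some coordinate isomorphism. The number [n] is computed by
    exhibiting a spanning family [e] together with its dual functionals [c]. *)
Lemma vaxiom_basis (k : fieldType) n (V : lmodType k) (A : finType) (e : A -> V)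
    (c : A -> V -> k) :
  Vector.axiom n V -> (forall a, linear (c a : V -> k^o)) ->
  (forall a b, c a (e b) = (a == b)%:R) ->
  (forall v, v = \sum_a c a v *: e a) -> n = #|A|.
Proof.
move=> hV lc ce ev.
have ha : Vector.axiom #|A| 'rV[k]_#|A| by exists id => //; exists id.
apply: (@vaxiom_eq k n #|A| V 'rV[k]_#|A| (fun v => \row_i c (enum_val i) v)
  (fun u => \sum_a u 0 (enum_rank a) *: e a) hV ha) => //.
- by move=> x u v; apply/rowP=> i; rewrite !mxE; exact: lc.
- move=> x u v; rewrite scaler_sumr -big_split; apply: eq_bigr => a _ /=.
  by rewrite !mxE scalerDl scalerA.
- by move=> v; rewrite [RHS]ev; apply: eq_bigr => a _; rewrite mxE enum_rankK.
- move=> u; apply/rowP=> i; rewrite mxE (lin_sum (lc _)) (bigD1 (enum_val i)) //=.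
  rewrite (linZ (lc _)) ce eqxx enum_valK big1 ?addr0; last first.
    by move=> a /negPf ne; rewrite (linZ (lc _)) ce eq_sym ne scaler0.
  by rewrite /GRing.scale /= mulr1.
Qed.

(** * Semisimplicity *)

Section Semisimple.
Variables (k : closedFieldType) (C : fusion_cat k).
Implicit Types X Y Z W : C.

Lemma schur X Y (f : hom X Y) : simple X -> simple Y -> f = 0 \/ is_iso f.
Proof.
move=> [nzX sX] [nzY sY]; have [_ /(_ _ _ f) [K [i [fi0 iP]]] _ _ _] := fus_abelian C.
have mi : mono i.
  move=> Z g h E.
  have /iP [u [_ uu]] : f ∘ (i ∘ g) = 0 by rewrite compA fi0 comp0l.
  by rewrite -(uu g) // -(uu h).
case: (sX _ _ mi) => [zK|/is_isoP [j [_ ij]]]; last first.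
  by left; rewrite -[f]compm1 -ij compA fi0 comp0l.
right; case: (sY _ f) => //; apply: mono_kernel0 => Z g /iP [u [<- _]].
by rewrite (zero_hom_r u zK) comp0r.
Qed.

Lemma schur0 X Y (f : hom X Y) : simple X -> simple Y -> ~ isomorphic X Y -> f = 0.
Proof. by move=> sX sY nXY; case: (schur f sX sY) => // -[i _]; case: nXY; split. Qed.

(** Composition with [f] acts on the nonzero finite-dimensional space of endomorphisms, so it has an
    eigenvector [v] over the closed field [k]. Then [f - a *: idm X] kills a nonzero morphism,
    cannot be invertible, and vanishes by [schur]. *)
Lemma schur_end X (f : hom X X) : simple X -> exists a, f = a *: idm X.
Proof.
move=> sX; have [r lr [r' rK r'K]] := hdimP X X.
have lr' : linear r' by move=> a u v; apply: (can_inj rK); rewrite r'K lr !r'K.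
set n := hdim X X in r lr r' rK r'K lr'.
pose g (u : 'rV[k]_n) := r (f ∘ r' u).
have lg : linear g by move=> a u v; rewrite /g lr' (comp_linearr f) lr.
pose M := \matrix_i g (delta_mx 0 i).
have gM u : g u = u *m M.
  rewrite mulmx_sum_row [in LHS](row_sum_delta u) (lin_sum lg).
  by apply: eq_bigr => i _; rewrite (linZ lg) rowK.
have n0 : (0 < n)%N.
  rewrite lt0n; apply/eqP => n0; case: sX => + _; apply; apply: (can_inj rK).
  apply/rowP => i; suff: False by []; by have := leq_ltn_trans (leq0n i) (ltn_ord i); rewrite n0.
have /closed_rootP [a] : size (char_poly M) != 1%N by rewrite size_char_poly -lt0n.
rewrite -eigenvalue_root_char => /eigenvalueP [v vM v0].
exists a; apply/eqP; rewrite -subr_eq0.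
case: (schur (f - a *: idm X) sX sX) => [->|/is_isoP [h [hf _]]]; first by rewrite eqxx.
case/eqP: v0; rewrite -(r'K v) -[r' v]comp1m -hf -compA compBl compZl comp1m.
have -> : f ∘ r' v = r' (v *m M) by rewrite -gM /g rK.
by rewrite vM (linZ lr') subrr comp0r (lin0 lr).
Qed.

(** Total, so that no proof of simplicity occurs in terms; the default 0 is taken only when [f] is
    not a scalar. *)
Definition sc X (f : hom X X) : k :=
  if pselect (exists a, f = a *: idm X) is left h then projT1 (cid h) else 0.

Lemma scE X (f : hom X X) : simple X -> f = sc f *: idm X.
Proof.
move=> sX; rewrite /sc; case: pselect => [h|[]]; last exact: schur_end.
by case: cid.
Qed.

Lemma sc_uniq X a b : simple X -> a *: idm X = b *: idm X -> a = b.
Proof.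
move=> [nz _] E; apply/eqP; rewrite -subr_eq0; apply: contrapT => /negP ab.
by apply: nz; apply: (scalerI ab); rewrite scaler0 scalerBl E subrr.
Qed.

Lemma scZ1 X a : simple X -> sc (a *: idm X) = a.
Proof. by move=> sX; apply: (sc_uniq sX); rewrite -scE. Qed.
Lemma sc1 X : simple X -> sc (idm X) = 1.
Proof. by move=> sX; rewrite -[idm X]scale1r scZ1. Qed.
Lemma sc0 X : simple X -> sc (0 : hom X X) = 0.
Proof. by move=> sX; rewrite -(scale0r (idm X)) scZ1. Qed.
Lemma sc_linear X : simple X -> linear (@sc X : hom X X -> k^o).
Proof.
move=> sX a f g; apply: (sc_uniq sX); rewrite -scE //.
by rewrite (_ : a *: (sc f : k^o) + sc g = a * sc f + sc g) // scalerDl -scalerA -!scE.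
Qed.
Lemma sc_comp X (f g : hom X X) : simple X -> sc (f ∘ g) = sc f * sc g.
Proof.
move=> sX; apply: (sc_uniq sX); rewrite -scE // [in LHS](scE f sX) [in LHS](scE g sX).
by rewrite compZl compZr comp1m scalerA.
Qed.

(** Stated for an arbitrary family because, besides [irr], it is applied to the duals of simple
    objects and to products of simple objects of two factors. *)
Definition complete (J : finType) (e : J -> C) : Prop :=
  [/\ forall i, simple (e i), forall i j, isomorphic (e i) (e j) -> i = j
    & forall X, simple X -> exists i, isomorphic X (e i)].

Lemma irr_complete : complete (@irr k C).
Proof. by split; [exact: irr_simple|exact: irr_inj|exact: irr_full]. Qed.

Definition is_isotypic (J : finType) (e : J -> C) X (m : J -> nat)
    (inj : forall i, 'I_(m i) -> hom (e i) X) (prj : forall i, 'I_(m i) -> hom X (e i)) :=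
  [/\ forall i a b, prj i a ∘ inj i b = (a == b)%:R *: idm (e i),
      forall i j a b, i != j -> prj i a ∘ inj j b = 0
    & \sum_i \sum_a inj i a ∘ prj i a = idm X].

Section Isotypic.
Variables (J : finType) (e : J -> C) (X : C) (m : J -> nat).
Variables (inj : forall i, 'I_(m i) -> hom (e i) X) (prj : forall i, 'I_(m i) -> hom X (e i)).
Hypotheses (ce : complete e) (H : is_isotypic inj prj).

Lemma isotypic_dim_in i : hdim (e i) X = m i.
Proof.
have [se ei _] := ce; have [H1 H2 H3] := H.
rewrite -[RHS]card_ord.
apply: (@vaxiom_basis k _ _ _ (@inj i) (fun a v => sc (prj a ∘ v)) (hdimP _ _)).
- by move=> a x u v; rewrite (comp_linearr (prj a)) (sc_linear (se i)).
- by move=> a b; rewrite H1 scZ1.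
move=> v; rewrite -[LHS]comp1m -H3 comp_suml (bigD1 i) //= [X in _ + X]big1 ?addr0.
  rewrite comp_suml; apply: eq_bigr => a _.
  by rewrite -compA [in LHS](scE (_ ∘ v) (se i)) compZr compm1.
move=> j ji; rewrite comp_suml big1 // => a _; rewrite -compA (schur0 (_ ∘ v)) ?comp0r //.
by move=> /ei E; rewrite E eqxx in ji.
Qed.

Lemma isotypic_dim_out i : hdim X (e i) = m i.
Proof.
have [se ei _] := ce; have [H1 H2 H3] := H.
rewrite -[RHS]card_ord.
apply: (@vaxiom_basis k _ _ _ (@prj i) (fun a v => sc (v ∘ inj a)) (hdimP _ _)).
- by move=> a x u v; rewrite (comp_linearl (inj a)) (sc_linear (se i)).
- by move=> a b; rewrite H1 scZ1 // eq_sym.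
move=> v; rewrite -[LHS]compm1 -H3 comp_sumr (bigD1 i) //= [X in _ + X]big1 ?addr0.
  rewrite comp_sumr; apply: eq_bigr => a _.
  by rewrite compA [in LHS](scE (v ∘ _) (se i)) compZl comp1m.
move=> j ji; rewrite comp_sumr big1 // => a _; rewrite compA (schur0 (v ∘ _)) ?comp0l //.
by move=> /ei E; rewrite E eqxx in ji.
Qed.
End Isotypic.

Lemma isotypic0 (J : finType) (e : J -> C) X : complete e ->
  exists (m : J -> nat) (inj : forall i, 'I_(m i) -> hom (e i) X)
    (prj : forall i, 'I_(m i) -> hom X (e i)), is_isotypic inj prj.
Proof.
move=> [se ei ef]; have [n [s [ss [inj [prj [pi1 pi0 ip]]]]]] := fus_semisimple X.
pose t x := projT1 (cid (ef _ (ss x))).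
have tP x : isomorphic (s x) (e (t x)) by rewrite /t; case: cid.
pose A i := [pred x | t x == i].
have Ai i (a : 'I_#|A i|) : isomorphic (s (enum_val a)) (e i).
  have /eqP ta : enum_val a \in A i by exact: enum_valP. rewrite -[X in e X]ta; exact: tP.
have sAi i (a : 'I_#|A i|) : {f : iso (s (enum_val a)) (e i) | True}.
  by apply: cid; case: (Ai i a) => f; exists f.
pose u i a := projT1 (sAi i a).
exists (fun i => #|A i|), (fun i a => inj _ ∘ inv (u i a)), (fun i a => u i a ∘ prj _).
split=> [i a b|i j a b ij|].
- rewrite !compA -(compA (u i a)); case: eqVneq => [->|ab].
    by rewrite pi1 compm1 invK scale1r.
  by rewrite pi0 ?comp0r ?comp0l ?scale0r // (inj_eq enum_val_inj).
- rewrite !compA -(compA (u i a)) pi0 ?comp0r ?comp0l //.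
  have /eqP ta : enum_val a \in A i by exact: enum_valP.
  have /eqP tb : enum_val b \in A j by exact: enum_valP.
  by apply: contra_neq ij => ab; rewrite -ta -tb ab.
rewrite -ip (partition_big t xpredT) //=; apply: eq_bigr => i _.
rewrite [RHS](big_enum_val (fun x => inj x ∘ prj x) : \sum_(x in A i) _ = _).
by apply: eq_bigr => a _; rewrite !compA (rw0 (fwdK _)).
Qed.

Lemma isotypic (J : finType) (e : J -> C) X : complete e ->
  exists (inj : forall i, 'I_(hdim (e i) X) -> hom (e i) X)
    (prj : forall i, 'I_(hdim (e i) X) -> hom X (e i)), is_isotypic inj prj.
Proof.
move=> ce; have [m [inj [prj H]]] := isotypic0 X ce.
have Em : m = (fun i => hdim (e i) X).
  by apply: functional_extensionality_dep => i; rewrite (isotypic_dim_in ce H).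
by move: inj prj H; rewrite Em => inj prj H; exists inj, prj.
Qed.

Lemma hdim_sym (J : finType) (e : J -> C) X i : complete e -> hdim X (e i) = hdim (e i) X.
Proof.
by move=> ce; have [m [inj [prj H]]] := isotypic0 X ce;
   rewrite (isotypic_dim_in ce H) (isotypic_dim_out ce H).
Qed.

Lemma hdim_lin X Y X' Y' (f : hom X Y -> hom X' Y') (g : hom X' Y' -> hom X Y) :
  linear f -> linear g -> cancel f g -> cancel g f -> hdim X Y = hdim X' Y'.
Proof. exact: vaxiom_eq (hdimP _ _) (hdimP _ _). Qed.

Lemma hdim_iso X Y X' Y' : isomorphic X X' -> isomorphic Y Y' -> hdim X Y = hdim X' Y'.
Proof.
move=> [f] [g]; apply: (@hdim_lin _ _ _ _ (fun h => g ∘ h ∘ inv f) (fun h => inv g ∘ h ∘ f)).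
- by move=> a u v; rewrite (comp_linearr g) (comp_linearl (inv f)).
- by move=> a u v; rewrite (comp_linearr (inv g)) (comp_linearl f).
- by move=> h; rewrite !compA (rw0 (fwdK f)) fwdK comp1m.
- by move=> h; rewrite !compA (rw0 (invK f)) invK comp1m.
Qed.

Lemma hdim_simple i j : hdim (irr C i) (irr C j) = (i == j).
Proof.
case: eqVneq => [<-|ij]; last first.
  rewrite /= -(card_ord 0); apply: (@vaxiom_basis k _ _ 'I_0 (fun=> 0) (fun _ _ => 0) (hdimP _ _)).
  - by case. - by case.
  move=> v; rewrite big_ord0; apply: schur0 => //; try exact: irr_simple.
  by move/irr_inj/eqP; rewrite (negPf ij).
rewrite /= -(card_ord 1); apply: (@vaxiom_basis k _ _ 'I_1 (fun=> idm _) (fun _ => @sc _) (hdimP _ _)).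
- by move=> _; apply: sc_linear; exact: irr_simple.
- by move=> a b; rewrite !ord1 sc1 //; exact: irr_simple.
by move=> v; rewrite big_ord1 -scE //; exact: irr_simple.
Qed.

Definition iinj0 X := cid (isotypic X irr_complete).
Definition iinj X : forall i, 'I_(hdim (irr C i) X) -> hom (irr C i) X := projT1 (iinj0 X).
Definition iprj0 X := cid (projT2 (iinj0 X)).
Definition iprj X : forall i, 'I_(hdim (irr C i) X) -> hom X (irr C i) := projT1 (iprj0 X).
Lemma iinjP X : is_isotypic (@iinj X) (@iprj X).
Proof. exact: projT2 (iprj0 X). Qed.

Lemma iprj_inj X i a b : @iprj X i a ∘ iinj b = (a == b)%:R *: idm (irr C i).
Proof. by case: (iinjP X). Qed.
Lemma iprj_inj0 X i j (a : 'I__) (b : 'I__) : i != j -> @iprj X i a ∘ @iinj X j b = 0.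
Proof. by case: (iinjP X) => _ H _; exact: H. Qed.
Lemma isum X : \sum_i \sum_a @iinj X i a ∘ iprj a = idm X.
Proof. by case: (iinjP X). Qed.

(** The blocks act on row vectors, so composition becomes the matrix product in the opposite order.
    With its inverse [mxh], this identifies morphisms with tuples of matrices. *)
Definition hmx X Y (f : hom X Y) i : 'M[k]_(hdim (irr C i) X, hdim (irr C i) Y) :=
  \matrix_(a, b) sc (iprj b ∘ f ∘ iinj a).

Definition mxh X Y (M : forall i, 'M[k]_(hdim (irr C i) X, hdim (irr C i) Y)) : hom X Y :=
  \sum_i \sum_a \sum_b M i a b *: (@iinj Y i b ∘ @iprj X i a).

Lemma mxhK X Y (M : forall i, 'M[k]_(hdim (irr C i) X, hdim (irr C i) Y)) i :
  hmx (mxh M) i = M i.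
Proof.
apply/matrixP=> a b; rewrite mxE /mxh comp_sumr comp_suml.
rewrite (bigD1 i) //= [X in _ + X]big1 ?addr0 => [|j ji]; last first.
  rewrite comp_sumr comp_suml big1 // => c _; rewrite comp_sumr comp_suml big1 // => d _.
  by rewrite compZr compZl compA iprj_inj0 1?eq_sym // !comp0l scaler0.
rewrite comp_sumr comp_suml (bigD1 a) //= [X in _ + X]big1 ?addr0 => [|c ca]; last first.
  rewrite comp_sumr comp_suml big1 // => d _.
  by rewrite compZr compZl -!compA iprj_inj (negPf ca) scale0r !comp0r scaler0.
rewrite comp_sumr comp_suml (bigD1 b) //= [X in _ + X]big1 ?addr0 => [|c ca]; last first.
  by rewrite compZr compZl !compA iprj_inj eq_sym (negPf ca) scale0r !comp0l scaler0.
rewrite compZr compZl !compA iprj_inj eqxx scale1r comp1m iprj_inj eqxx scale1r.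
by rewrite scZ1 //; exact: irr_simple.
Qed.

Lemma hmxK X Y (f : hom X Y) : mxh (hmx f) = f.
Proof.
rewrite -[RHS]compm1 -[in RHS](isum X) comp_sumr; apply: eq_bigr => i _.
rewrite comp_sumr; apply: eq_bigr => a _.
rewrite -[in RHS](comp1m f) -[in RHS](isum Y) !comp_suml (bigD1 i) //= [X in _ = _ + X]big1 ?addr0.
  rewrite !comp_suml; apply: eq_bigr => b _; rewrite mxE.
  rewrite -!compA [X in _ = _ ∘ X]compA [X in _ = _ ∘ X]compA.
  transitivity (iinj b ∘ (iprj b ∘ f ∘ iinj a) ∘ iprj a); last by rewrite !compA.
  by rewrite [in RHS](scE (iprj b ∘ f ∘ iinj a) (irr_simple i)) compZr compm1 compZl compA.
move=> j ji; rewrite !comp_suml big1 // => b _.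
transitivity (iinj b ∘ (iprj b ∘ f ∘ iinj a) ∘ iprj a); first by rewrite !compA.
rewrite (schur0 (_ ∘ iinj a)) ?comp0r ?comp0l //; try exact: irr_simple.
by move/irr_inj/eqP; rewrite eq_sym (negPf ji).
Qed.

Lemma hmx_comp X Y Z (g : hom Y Z) (f : hom X Y) i : hmx (g ∘ f) i = hmx f i *m hmx g i.
Proof.
apply/matrixP=> a b; rewrite !mxE -[in LHS](comp1m f) -[in LHS](isum Y).
rewrite !(comp_suml, comp_sumr) (lin_sum (sc_linear (irr_simple i))) (bigD1 i) //= [X in _ + X]big1 ?addr0.
  rewrite !(comp_suml, comp_sumr) (lin_sum (sc_linear (irr_simple i))); apply: eq_bigr => c _.
  rewrite !mxE mulrC -sc_comp ?compA //; exact: irr_simple.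
move=> j ji; rewrite !(comp_suml, comp_sumr) (lin_sum (sc_linear (irr_simple i))) big1 // => b' _.
transitivity (sc (iprj b ∘ g ∘ iinj b' ∘ (iprj b' ∘ f ∘ iinj a))); first by rewrite !compA.
rewrite (schur0 (_ ∘ f ∘ iinj a)) ?comp0r ?sc0 //; try exact: irr_simple.
by move/irr_inj/eqP; rewrite eq_sym (negPf ji).
Qed.

(* This splits monomorphisms, epimorphisms, kernels and cokernels. *)
Lemma regular X Y (f : hom X Y) : exists r : hom Y X, f ∘ r ∘ f = f.
Proof.
exists (mxh (fun i => pinvmx (hmx f i))).
rewrite -[LHS]hmxK -[RHS]hmxK; congr mxh; apply: functional_extensionality_dep => i.
by rewrite !hmx_comp mxhK mulmxA mulmxKpV.
Qed.
End Semisimple.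

(** * Associator-free calculus *)

Notation "X ◁ f" := (idm X ⊗m f) (at level 34, right associativity) : cat_scope.
Notation "f ▷ X" := (f ⊗m idm X) (at level 33, left associativity) : cat_scope.

Section Mon.
Variables (k : fieldType) (C : mon_cat k).
Implicit Types X Y Z W T S R : C.

Lemma wl1 X Y : X ◁ idm Y = idm (X ⊗ Y). Proof. exact: bmap1. Qed.
Lemma wlc X Y Z W (g : hom Z W) (f : hom Y Z) : X ◁ (g ∘ f) = (X ◁ g) ∘ (X ◁ f).
Proof. exact: bmap_compr. Qed.
Lemma wrc X Y Z W (g : hom Z W) (f : hom Y Z) : (g ∘ f) ▷ X = (g ▷ X) ∘ (f ▷ X).
Proof. exact: bmap_compl. Qed.
Lemma wex X X' Y Y' (f : hom X X') (g : hom Y Y') : (X' ◁ g) ∘ (f ▷ Y) = (f ▷ Y') ∘ (X ◁ g).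
Proof. exact: bmap_lr. Qed.

Definition wli X Y Z (f : iso Y Z) : iso (X ⊗ Y) (X ⊗ Z) := biso (tens C) (iso_refl X) f.
Definition wri X Y Z (f : iso Y Z) : iso (Y ⊗ X) (Z ⊗ X) := biso (tens C) f (iso_refl X).

Lemma iso_sq X Y X' Y' (a : iso X Y) (b : iso X' Y') (f : hom X X') (g : hom Y Y') :
  b ∘ f = g ∘ a -> inv b ∘ g = f ∘ inv a.
Proof.
by move=> E; apply: (iso_can_r (f := a)); rewrite -compA -E compA fwdK comp1m -compA fwdK compm1.
Qed.

Lemma an1 X X' Y Z (f : hom X X') :
  assoc X' Y Z ∘ (f ▷ Y ▷ Z) = (f ▷ (Y ⊗ Z)) ∘ assoc X Y Z.
Proof. by rewrite assoc_nat bmap1. Qed.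
Lemma an2 X Y Y' Z (f : hom Y Y') :
  assoc X Y' Z ∘ ((X ◁ f) ▷ Z) = (X ◁ (f ▷ Z)) ∘ assoc X Y Z.
Proof. exact: assoc_nat. Qed.
Lemma an3 X Y Z Z' (f : hom Z Z') :
  assoc X Y Z' ∘ ((X ⊗ Y) ◁ f) = (X ◁ (Y ◁ f)) ∘ assoc X Y Z.
Proof. by rewrite -bmap1 assoc_nat. Qed.
Lemma ian1 X X' Y Z (f : hom X X') :
  inv (assoc X' Y Z) ∘ (f ▷ (Y ⊗ Z)) = (f ▷ Y ▷ Z) ∘ inv (assoc X Y Z).
Proof. exact: iso_sq (an1 _ _ _). Qed.
Lemma ian2 X Y Y' Z (f : hom Y Y') :
  inv (assoc X Y' Z) ∘ (X ◁ (f ▷ Z)) = ((X ◁ f) ▷ Z) ∘ inv (assoc X Y Z).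
Proof. exact: iso_sq (an2 _ _ _). Qed.
Lemma ian3 X Y Z Z' (f : hom Z Z') :
  inv (assoc X Y Z') ∘ (X ◁ (Y ◁ f)) = ((X ⊗ Y) ◁ f) ∘ inv (assoc X Y Z).
Proof. exact: iso_sq (an3 _ _ _). Qed.
Lemma wl_inj X Y (f g : hom X Y) : one ◁ f = one ◁ g -> f = g.
Proof. by move=> E; apply: (iso_can_r (f := lunit X)); rewrite -!lunit_nat E. Qed.
Lemma wr_inj X Y (f g : hom X Y) : f ▷ one = g ▷ one -> f = g.
Proof. by move=> E; apply: (iso_can_r (f := runit X)); rewrite -!runit_nat E. Qed.

(** Kelly's argument: tensoring with [one] is faithful by [wl_inj], and after it the equation
    follows from the pentagon and the triangle. *)
Lemma lunit_tens X Y : lunit (X ⊗ Y) ∘ assoc one X Y = lunit X ▷ Y.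
Proof.
apply: wl_inj; rewrite wlc.
apply: (iso_can_r (f := assoc one (one ⊗ X) Y)).
apply: (iso_can_r (f := wri Y (assoc one one X))).
transitivity ((one ◁ lunit (X ⊗ Y)) ∘ (assoc one one (X ⊗ Y) ∘ assoc (one ⊗ one) X Y)).
  by rewrite pentagon !compA.
by rewrite compA triangle -an1 -triangle wrc compA an2.
Qed.

Lemma runit_tens X Y : (X ◁ runit Y) ∘ assoc X Y one = runit (X ⊗ Y).
Proof.
apply: wr_inj; apply: (iso_can_l (f := assoc X Y one)).
rewrite wrc compA an2 -triangle wlc -triangle !compA an3.
by rewrite -[RHS]compA pentagon !compA.
Qed.

Fixpoint act (w : seq C) T : C := if w is X :: w' then X ⊗ act w' T else T.
Fixpoint actm w T S (f : hom T S) : hom (act w T) (act w S) :=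
  if w is X :: w' then X ◁ actm w' f else f.
Fixpoint aw w T S : hom (act w T ⊗ S) (act w (T ⊗ S)) :=
  if w is X :: w' then (X ◁ aw w' T S) ∘ assoc X (act w' T) S else idm (T ⊗ S).

(* Families of morphisms between nested words X1 ⊗ (X2 ⊗ ... (Xn ⊗ T)), natural in T
   and compatible with the right action of C. They are the 2-morphisms of a strict
   model of C, which makes diagrams associator-free. *)
Record mor (w v : seq C) := Mor {
  mf :> forall T, hom (act w T) (act v T);
  mor_nat : forall T S (f : hom T S), mf S ∘ actm w f = actm v f ∘ mf T;
  mor_mod : forall T S, mf (T ⊗ S) ∘ aw w T S = aw v T S ∘ (mf T ▷ S) }.

Program Definition mcomp u v w (G : mor v w) (F : mor u v) : mor u w :=
  @Mor u w (fun T => G T ∘ F T) _ _.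
Next Obligation. by rewrite -compA mor_nat !compA mor_nat. Qed.
Next Obligation. by rewrite -compA mor_mod wrc !compA mor_mod. Qed.

Program Definition mlw X w v (F : mor w v) : mor (X :: w) (X :: v) :=
  @Mor (X :: w) (X :: v) (fun T => X ◁ F T) _ _.
Next Obligation. by rewrite -!wlc mor_nat. Qed.
Next Obligation. by rewrite -!compA an2 !compA -!wlc mor_mod. Qed.

Program Definition mrw X Y u (f : hom X Y) : mor (X :: u) (Y :: u) :=
  @Mor (X :: u) (Y :: u) (fun T => f ▷ act u T) _ _.
Next Obligation. by rewrite -wex. Qed.
Next Obligation. by rewrite compA -wex -!compA -an1. Qed.

Program Definition msp X Y u : mor ((X ⊗ Y) :: u) [:: X, Y & u] :=
  @Mor ((X ⊗ Y) :: u) [:: X, Y & u] (fun T => assoc X Y (act u T)) _ _.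
Next Obligation. exact: an3. Qed.
Next Obligation. by rewrite compA an3 -compA pentagon wlc !compA. Qed.

Program Definition mun u : mor (one :: u) u :=
  @Mor (one :: u) u (fun T => lunit (act u T)) _ _.
Next Obligation. exact: lunit_nat. Qed.
Next Obligation. by rewrite compA lunit_nat -compA lunit_tens. Qed.

Section Minv.
Variables (w v : seq C) (F : mor w v) (G : forall T, hom (act v T) (act w T)).
Hypotheses (FK : forall T, G T ∘ F T = idm _) (GK : forall T, F T ∘ G T = idm _).
Let Fi T : iso (act w T) (act v T) := Iso (FK T) (GK T).
Program Definition minv : mor v w := @Mor v w G _ _.
Next Obligation.
apply: (iso_can_l (f := Fi S)); rewrite /= !compA mor_nat GK comp1m.
by rewrite -compA GK compm1.
Qed.
Next Obligation.
apply: (iso_can_l (f := Fi (T ⊗ S))); rewrite /= !compA mor_mod GK comp1m.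
by rewrite -compA -wrc GK wl1 compm1.
Qed.
End Minv.

Definition mspi X Y u : mor [:: X, Y & u] ((X ⊗ Y) :: u) :=
  minv (F := msp X Y u) (G := fun T => inv (assoc X Y (act u T)))
    (fun T => fwdK _) (fun T => invK _).
Definition muni u : mor u (one :: u) :=
  minv (F := mun u) (G := fun T => inv (lunit (act u T))) (fun T => fwdK _) (fun T => invK _).

(** Compatibility with the right action, applied to [one ⊗ T], expresses [F T] by [F one] up to unit
    isomorphisms. Hence diagrams on nested words still describe morphisms of [C], and Schur's lemma
    becomes available for them. *)
Lemma mor_obj X Y (F : mor [:: X] [:: Y]) : exists h : hom X Y, forall T, F T = h ▷ T.
Proof.
exists (runit Y ∘ F one ∘ inv (runit X)) => T.
have := mor_mod F one T; rewrite /= !wl1 !comp1m => E.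
apply: (iso_can_r (f := wri T (runit X))); rewrite /= -wrc -compA fwdK compm1 wrc.
by rewrite -!triangle -[RHS]compA -E [LHS]compA (mor_nat F (lunit T)) -!compA.
Qed.

Lemma mor_scal (F : mor [::] [::]) :
  (forall f : hom (one : C) one, exists a, f = a *: idm one) ->
  exists a, forall T, F T = a *: idm T.
Proof.
move=> H; have [a Fa] := H (F one); exists a => T.
have := mor_mod F one T; rewrite /= compm1 comp1m => E.
apply: (iso_can_r (f := lunit T)); rewrite (mor_nat F (lunit T)) /= E.
have -> : mf F one = a *: idm one by exact: Fa.
by rewrite bmapZl wl1 compZr compZl compm1 comp1m.
Qed.
End Mon.

(** * Duals and braidings *)

Section Duals.
Variables (k : fieldType) (C : fusion_cat k).
Implicit Types X Y Z W T S R : C.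

Definition pairT W Z (e : hom (W ⊗ Z) one) T : hom (W ⊗ (Z ⊗ T)) T :=
  lunit T ∘ (e ▷ T) ∘ inv (assoc W Z T).
(* The nested structure maps are locked so that rewriting with associativity of
   composition does not look inside them. *)
Fact nested_key : unit. Proof. exact: tt. Qed.
Definition evT X T : hom (dual X ⊗ (X ⊗ T)) T := locked_with nested_key (pairT (ev X) T).
Definition coT X T : hom T (X ⊗ (dual X ⊗ T)) :=
  locked_with nested_key (assoc X (dual X) T ∘ (coev X ▷ T) ∘ inv (lunit T)).
Lemma evTE X T : evT X T = pairT (ev X) T. Proof. by rewrite /evT unlock. Qed.
Lemma coTE X T : coT X T = assoc X (dual X) T ∘ (coev X ▷ T) ∘ inv (lunit T).
Proof. by rewrite /coT unlock. Qed.

Definition mpair W Z (e : hom (W ⊗ Z) one) u : mor [:: W, Z & u] u :=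
  mcomp (mcomp (mun u) (mrw u e)) (mspi W Z u).
Definition mev0 X u : mor [:: dual X, X & u] u := mpair (ev X) u.
Definition mco0 X u : mor u [:: X, dual X & u] :=
  mcomp (mcomp (msp X (dual X) u) (mrw u (coev X))) (muni u).

Lemma pairT_nat W Z (e : hom (W ⊗ Z) one) T S (f : hom T S) :
  pairT e S ∘ (W ◁ Z ◁ f) = f ∘ pairT e T.
Proof. exact: (mor_nat (mpair e [::]) f). Qed.
Lemma evT_nat X T S (f : hom T S) : evT X S ∘ (dual X ◁ X ◁ f) = f ∘ evT X T.
Proof. by rewrite !evTE; exact: pairT_nat. Qed.
Lemma coT_nat X T S (f : hom T S) : coT X S ∘ f = (X ◁ dual X ◁ f) ∘ coT X T.
Proof. by rewrite !coTE; exact: (mor_nat (mco0 X [::]) f). Qed.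

Lemma zig1 X T : (X ◁ evT X T) ∘ coT X (X ⊗ T) = idm (X ⊗ T).
Proof.
apply: (iso_can_r (f := lunit (X ⊗ T))); rewrite comp1m coTE !compA (rw0 (fwdK _)).
apply: (iso_can_r (f := assoc one X T)).
rewrite lunit_tens -(dualP X).1 !wrc -triangle -!compA -an1 evTE /pairT !wlc.
rewrite !compA (rw2 (an2 _ _ _)) (rw2 (pentagon _ _ _ _)) !compA (rw0 _) //.
by rewrite -wlc fwdK wl1.
Qed.

Lemma pentagon_inv (D : mon_cat k) (W X Y Z : D) :
  inv (assoc W X (Y ⊗ Z)) ∘ (W ◁ assoc X Y Z) ∘ assoc W (X ⊗ Y) Z
  = assoc (W ⊗ X) Y Z ∘ (inv (assoc W X Y) ▷ Z).
Proof.
apply: (iso_can_r (f := wri Z (assoc W X Y))); rewrite /= -[RHS]compA -wrc fwdK bmap1 compm1.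
apply: (iso_can_l (f := assoc W X (Y ⊗ Z))).
by rewrite pentagon !compA invK comp1m.
Qed.

Lemma zig2 X T : evT X (dual X ⊗ T) ∘ (dual X ◁ coT X T) = idm (dual X ⊗ T).
Proof.
set X' := dual X.
have E : evT X (X' ⊗ T) ∘ (X' ◁ (assoc X X' T ∘ (coev X ▷ T))) = X' ◁ lunit T.
  apply: (iso_can_r (f := assoc X' one T)).
  rewrite triangle -(dualP X).2 !wrc -lunit_tens evTE /pairT wlc -!compA -an2.
  rewrite !compA; congr (_ ∘ _).
  rewrite (rw2 (an1 _ _ _)) -(rw2 (pentagon_inv _ _ _ _)) !compA.
  by [].
by rewrite coTE wlc compA E -wlc invK wl1.
Qed.

Lemma mateT W Z (e : hom (W ⊗ Z) one) T :
  mate e ▷ T = pairT e (dual Z ⊗ T) ∘ (W ◁ coT Z T).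
Proof.
rewrite /mate /pairT coTE !wrc -lunit_tens !wlc !compA.
rewrite (rw2 (an1 _ _ _)) -(rw2 (pentagon_inv _ _ _ _)) !compA (rw2 (an2 _ _ _)).
rewrite -!compA; do 5!congr (_ ∘ _).
apply: (iso_can_l (f := wli W (lunit T))).
by rewrite /= !compA triangle -wlc invK wl1 -wrc invK bmap1.
Qed.

Lemma mate_ev W Z (e : hom (W ⊗ Z) one) T :
  evT Z T ∘ (mate e ▷ (Z ⊗ T)) = pairT e T.
Proof. by rewrite mateT compA -pairT_nat -compA -wlc zig1 wl1 compm1. Qed.

(** By the zigzag [zig2], a morphism into [dual Z] is recovered from the pairing with [Z] that it
    induces. Identities between dual morphisms are checked on pairings. *)
Lemma ev_inj W Z (f g : hom W (dual Z)) :
  (forall T, evT Z T ∘ (f ▷ (Z ⊗ T)) = evT Z T ∘ (g ▷ (Z ⊗ T))) -> f = g.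
Proof.
move=> E; apply: wr_inj.
rewrite -[LHS]comp1m -[RHS]comp1m -zig2 -!compA !wex !compA.
by rewrite E.
Qed.

Lemma evT_dual_map X Y (f : hom X Y) T :
  evT X T ∘ (dual_map f ▷ (X ⊗ T)) = evT Y T ∘ (dual Y ◁ (f ▷ T)).
Proof. by rewrite mate_ev evTE /pairT wrc -!compA -ian2. Qed.

Lemma dual_map_id X : dual_map (idm X) = idm (dual X).
Proof. by apply: ev_inj => T; rewrite evT_dual_map !bmap1. Qed.

Lemma dual_map_comp X Y Z (g : hom Y Z) (f : hom X Y) :
  dual_map (g ∘ f) = dual_map f ∘ dual_map g.
Proof.
apply: ev_inj => T; rewrite evT_dual_map wrc wlc compA -evT_dual_map -compA -wex.
by rewrite compA -evT_dual_map wrc compA.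
Qed.

Lemma coT_dual_map X Y (f : hom X Y) T :
  (f ▷ (dual X ⊗ T)) ∘ coT X T = (Y ◁ (dual_map f ▷ T)) ∘ coT Y T.
Proof.
have E : dual_map f ▷ T = evT Y (dual X ⊗ T) ∘ (dual Y ◁ ((f ▷ (dual X ⊗ T)) ∘ coT X T)).
  by rewrite wlc compA -evT_dual_map -[LHS]comp1m -zig2 -!compA wex.
by rewrite E wlc -compA -coT_nat compA zig1 comp1m.
Qed.

Lemma mev_nat X u T S (f : hom T S) :
  evT X (act u S) ∘ actm [:: dual X, X & u] f = actm u f ∘ evT X (act u T).
Proof. by rewrite !evTE; exact: (mor_nat (mev0 X u) f). Qed.
Lemma mev_mod X u T S :
  evT X (act u (T ⊗ S)) ∘ aw [:: dual X, X & u] T S = aw u T S ∘ (evT X (act u T) ▷ S).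
Proof. by rewrite !evTE; exact: (mor_mod (mev0 X u)). Qed.
Lemma mco_nat X u T S (f : hom T S) :
  coT X (act u S) ∘ actm u f = actm [:: X, dual X & u] f ∘ coT X (act u T).
Proof. by rewrite !coTE; exact: (mor_nat (mco0 X u) f). Qed.
Lemma mco_mod X u T S :
  coT X (act u (T ⊗ S)) ∘ aw u T S = aw [:: X, dual X & u] T S ∘ (coT X (act u T) ▷ S).
Proof. by rewrite !coTE; exact: (mor_mod (mco0 X u)). Qed.
Definition mev X u : mor [:: dual X, X & u] u :=
  @Mor _ C [:: dual X, X & u] u (fun T => evT X (act u T)) (@mev_nat X u) (@mev_mod X u).
Definition mco X u : mor u [:: X, dual X & u] :=
  @Mor _ C u [:: X, dual X & u] (fun T => coT X (act u T)) (@mco_nat X u) (@mco_mod X u).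

Definition dtT X Y T : hom (dual Y ⊗ (dual X ⊗ T)) (dual (X ⊗ Y) ⊗ T) :=
  locked_with nested_key ((dual_tens X Y ▷ T) ∘ inv (assoc (dual Y) (dual X) T)).
Lemma dtTE X Y T : dtT X Y T = (dual_tens X Y ▷ T) ∘ inv (assoc (dual Y) (dual X) T).
Proof. by rewrite /dtT unlock. Qed.

Lemma evT_mod X Y T :
  evT X (Y ⊗ T) ∘ (dual X ◁ assoc X Y T) = (evT X Y ▷ T) ∘ inv (assoc (dual X) (X ⊗ Y) T).
Proof.
apply: (iso_can_r (f := assoc (dual X) (X ⊗ Y) T)); rewrite -[RHS]compA fwdK compm1.
by have := mor_mod (mev X [::]) Y T; rewrite /= wl1 !comp1m compA.
Qed.

Lemma pentagon_inv2 (D : mon_cat k) (W X Y Z : D) :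
  (assoc W X Y ▷ Z) ∘ inv (assoc (W ⊗ X) Y Z) ∘ inv (assoc W X (Y ⊗ Z))
  = inv (assoc W (X ⊗ Y) Z) ∘ (W ◁ inv (assoc X Y Z)).
Proof.
apply: (iso_can_r (f := assoc W X (Y ⊗ Z))); rewrite (rw0 (fwdK _)).
apply: (iso_can_r (f := assoc (W ⊗ X) Y Z)); rewrite (rw0 (fwdK _)).
have E : (W ◁ inv (assoc X Y Z)) ∘ (W ◁ assoc X Y Z) = idm _ by rewrite -wlc fwdK wl1.
by rewrite -[RHS]compA pentagon !compA (rw0 E) fwdK comp1m.
Qed.

Lemma evT_tens X Y T :
  evT (X ⊗ Y) T ∘ dtT X Y ((X ⊗ Y) ⊗ T)
  = evT Y T ∘ (dual Y ◁ (evT X (Y ⊗ T) ∘ (dual X ◁ assoc X Y T))).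
Proof.
have dtE : dual_tens X Y = mate (ev Y ∘ (dual Y ◁ evT X Y) ∘ assoc (dual Y) (dual X) (X ⊗ Y)).
  by rewrite evTE.
rewrite dtTE compA dtE mate_ev evT_mod wlc; move: (evT X Y) => v.
rewrite evTE /pairT !wrc !compA (rw2 (ian2 _ _ _)).
by rewrite -4![LHS]compA -[RHS]compA -pentagon_inv2 !compA.
Qed.

Lemma dtT_nat X Y S R (f : hom S R) :
  dtT X Y R ∘ (dual Y ◁ dual X ◁ f) = (dual (X ⊗ Y) ◁ f) ∘ dtT X Y S.
Proof. by rewrite !dtTE -compA ian3 !compA wex. Qed.

(** [evT_tens] expresses [dtT] through the coevaluation of [X ⊗ Y], called [f] in the proof.
    Inserting this and straightening the strands of [Y] and [X] by [zig1] leaves [f]. *)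
Lemma coT_tens X Y T :
  assoc X Y _ ∘ coT (X ⊗ Y) T
  = (X ◁ Y ◁ dtT X Y T) ∘ (X ◁ coT Y (dual X ⊗ T)) ∘ coT X T.
Proof.
set V := X ⊗ Y; set Q := coT V T.
move Ef : (assoc X Y (dual V ⊗ T) ∘ Q) => f.
have -> : dtT X Y T =
    evT Y (dual V ⊗ T) ∘ (dual Y ◁ (evT X (Y ⊗ (dual V ⊗ T)) ∘ (dual X ◁ f))).
  rewrite -[LHS]comp1m -zig2 -/Q -compA -dtT_nat compA evT_tens -Ef !wlc !compA.
  by [].
have E1 : (X ◁ Y ◁ dual Y ◁ dual X ◁ f) ∘ (X ◁ coT Y (dual X ⊗ T)) ∘ coT X T
   = (X ◁ coT Y (dual X ⊗ (X ⊗ (Y ⊗ (dual V ⊗ T))))) ∘ coT X (X ⊗ (Y ⊗ (dual V ⊗ T))) ∘ f.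
  by rewrite -wlc -coT_nat wlc -!compA -coT_nat.
rewrite !(wlc Y) !(wlc X) !(wlc (dual Y)) !(wlc Y) !(wlc X) -!compA.
move: E1; rewrite -!compA => ->.
rewrite !compA.
have E2 S R (g : hom S R) : (X ◁ Y ◁ dual Y ◁ g) ∘ (X ◁ coT Y _) = (X ◁ coT Y _) ∘ (X ◁ g).
  by rewrite -!wlc coT_nat.
have E3 S : (X ◁ Y ◁ evT Y S) ∘ (X ◁ coT Y _) = idm _ by rewrite -wlc zig1 wl1.
by rewrite (rw2 (E2 _ _ _)) E3 comp1m zig1 comp1m.
Qed.

Lemma coT_tensE X Y T :
  coT (X ⊗ Y) T
  = inv (assoc X Y _) ∘ (X ◁ Y ◁ dtT X Y T) ∘ (X ◁ coT Y (dual X ⊗ T)) ∘ coT X T.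
Proof. by rewrite -!(compA (inv _)) -coT_tens compA fwdK comp1m. Qed.

Section Pivotal.
Variable j : forall X : C, iso X (dual (dual X)).
Hypothesis pj : pivotal j.

Definition evrT X T : hom (X ⊗ (dual X ⊗ T)) T :=
  locked_with nested_key (evT (dual X) T ∘ (j X ▷ (dual X ⊗ T))).
Lemma evrTE X T : evrT X T = evT (dual X) T ∘ (j X ▷ (dual X ⊗ T)).
Proof. by rewrite /evrT unlock. Qed.

Definition mevr0 X u : mor [:: X, dual X & u] u :=
  mcomp (mev (dual X) u) (mrw (dual X :: u) (j X)).
Lemma mevr_nat X u T S (f : hom T S) :
  evrT X (act u S) ∘ actm [:: X, dual X & u] f = actm u f ∘ evrT X (act u T).
Proof. by rewrite !evrTE; exact: (mor_nat (mevr0 X u) f). Qed.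
Lemma mevr_mod X u T S :
  evrT X (act u (T ⊗ S)) ∘ aw [:: X, dual X & u] T S = aw u T S ∘ (evrT X (act u T) ▷ S).
Proof. by rewrite !evrTE; exact: (mor_mod (mevr0 X u)). Qed.
Definition mevr X u : mor [:: X, dual X & u] u :=
  @Mor _ C [:: X, dual X & u] u (fun T => evrT X (act u T)) (@mevr_nat X u) (@mevr_mod X u).

Lemma evrT_nat X T S (f : hom T S) : evrT X S ∘ (X ◁ dual X ◁ f) = f ∘ evrT X T.
Proof. exact: (mor_nat (mevr X [::]) f). Qed.

Lemma evrT_dual_map X Y (f : hom X Y) T :
  evrT Y T ∘ (f ▷ (dual Y ⊗ T)) = evrT X T ∘ (X ◁ (dual_map f ▷ T)).
Proof.
rewrite !evrTE -compA -wrc pj.1 wrc compA evT_dual_map.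
by rewrite -!compA wex.
Qed.

(** Monoidality of the pivotal structure enters here: across [dual_tens] it turns [j (X ⊗ Y)] into
    [j X ⊗m j Y], so that evaluations on the right nest as those on the left do. *)
Lemma evrT_tens X Y T :
  evrT (X ⊗ Y) T ∘ inv (assoc X Y _) ∘ (X ◁ Y ◁ dtT X Y T)
  = evrT X T ∘ (X ◁ evrT Y (dual X ⊗ T)).
Proof.
set V := X ⊗ Y; set W := dual Y ⊗ dual X; set a := assoc (dual Y) (dual X) T.
have E1 : evT (dual V) T ∘ (j V ▷ (dual V ⊗ T)) ∘ (V ◁ dtT X Y T)
   = evT W T ∘ (dual_tens (dual Y) (dual X) ▷ (W ⊗ T)) ∘ ((j X ⊗m j Y) ▷ (W ⊗ T)) ∘ (V ◁ inv a).
  rewrite -[_ ∘ _ ∘ (_ ▷ _)]compA -wrc -pj.2 wrc compA evT_dual_map.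
  by rewrite dtTE wlc !compA -!(rw2 (wex _ _)).
have E2 : evT W T ∘ (dual_tens (dual Y) (dual X) ▷ (W ⊗ T))
    = evT (dual X) T ∘ (dual (dual X) ◁ (evT (dual Y) (dual X ⊗ T) ∘ (dual (dual Y) ◁ a)))
      ∘ assoc _ _ (W ⊗ T).
  by rewrite -evT_tens dtTE !compA (rw0 (fwdK _)).
rewrite -compA ian3 compA evrTE E1 E2 -/a -!compA -ian3.
rewrite [X in _ ∘ (_ ∘ X)]compA assoc_nat !compA (rw0 (invK _)) wlc.
have E3 : (dual (dual X) ◁ dual (dual Y) ◁ a) ∘ (j X ⊗m (j Y ▷ (W ⊗ T))) ∘ (X ◁ Y ◁ inv a)
  = (dual (dual X) ◁ (j Y ▷ _)) ∘ (j X ▷ _).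
  by rewrite -!bmap_comp !comp1m !compm1 invK.
by rewrite -!compA (compA _ _ (_ ◁ _)) E3 !evrTE wlc !compA !(rw2 (wex _ _)).
Qed.
End Pivotal.
End Duals.

Section Nested.
Variables (k : fieldType) (C : mon_cat k).
Implicit Types X Y Z W T S R : C.

Definition opT X Y X' Y' (f : hom (X ⊗ Y) (X' ⊗ Y')) T : hom (X ⊗ (Y ⊗ T)) (X' ⊗ (Y' ⊗ T)) :=
  locked_with nested_key (assoc X' Y' T ∘ (f ▷ T) ∘ inv (assoc X Y T)).
Lemma opTE X Y X' Y' (f : hom (X ⊗ Y) (X' ⊗ Y')) T :
  opT f T = assoc X' Y' T ∘ (f ▷ T) ∘ inv (assoc X Y T).
Proof. by rewrite /opT unlock. Qed.

Definition mop0 X Y X' Y' (f : hom (X ⊗ Y) (X' ⊗ Y')) u : mor [:: X, Y & u] [:: X', Y' & u] :=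
  mcomp (mcomp (msp X' Y' u) (mrw u f)) (mspi X Y u).
Lemma mop_nat X Y X' Y' (f : hom (X ⊗ Y) (X' ⊗ Y')) u T S (g : hom T S) :
  opT f (act u S) ∘ actm [:: X, Y & u] g = actm [:: X', Y' & u] g ∘ opT f (act u T).
Proof. by rewrite !opTE; exact: (mor_nat (mop0 f u) g). Qed.
Lemma mop_mod X Y X' Y' (f : hom (X ⊗ Y) (X' ⊗ Y')) u T S :
  opT f (act u (T ⊗ S)) ∘ aw [:: X, Y & u] T S = aw [:: X', Y' & u] T S ∘ (opT f (act u T) ▷ S).
Proof. by rewrite !opTE; exact: (mor_mod (mop0 f u)). Qed.
Definition mop X Y X' Y' (f : hom (X ⊗ Y) (X' ⊗ Y')) u : mor [:: X, Y & u] [:: X', Y' & u] :=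
  @Mor _ C [:: X, Y & u] [:: X', Y' & u] (fun T => opT f (act u T)) (@mop_nat _ _ _ _ f u)
     (@mop_mod _ _ _ _ f u).

Lemma opT_nat X Y X' Y' (f : hom (X ⊗ Y) (X' ⊗ Y')) T S (g : hom T S) :
  opT f S ∘ (X ◁ Y ◁ g) = (X' ◁ Y' ◁ g) ∘ opT f T.
Proof. exact: (mor_nat (mop f [::]) g). Qed.

Lemma opT_comp X Y X' Y' X'' Y'' (g : hom (X' ⊗ Y') (X'' ⊗ Y'')) (f : hom (X ⊗ Y) (X' ⊗ Y')) T :
  opT (g ∘ f) T = opT g T ∘ opT f T.
Proof. by rewrite !opTE wrc !compA (rw0 (fwdK _)). Qed.

Lemma opT1 X Y T : opT (idm (X ⊗ Y)) T = idm _.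
Proof. by rewrite opTE bmap1 compm1 invK. Qed.

Lemma opT_r X Y Y' (f : hom Y Y') T : opT (X ◁ f) T = X ◁ (f ▷ T).
Proof. by rewrite opTE an2 -compA invK compm1. Qed.

Lemma opT_l X X' Y (f : hom X X') T : opT (f ▷ Y) T = f ▷ (Y ⊗ T).
Proof. by rewrite opTE an1 -compA invK compm1. Qed.

Lemma opT_iso_K X Y X' Y' (f : iso (X ⊗ Y) (X' ⊗ Y')) T : opT (inv f) T ∘ opT f T = idm _.
Proof. by rewrite -opT_comp fwdK opT1. Qed.
Lemma opT_iso_invK X Y X' Y' (f : iso (X ⊗ Y) (X' ⊗ Y')) T : opT f T ∘ opT (inv f) T = idm _.
Proof. by rewrite -opT_comp invK opT1. Qed.

Lemma opT_one_inj X Y X' Y' (f g : hom (X ⊗ Y) (X' ⊗ Y')) :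
  opT f one = opT g one -> f = g.
Proof.
rewrite !opTE => E; apply: wr_inj; apply: (iso_can_l (f := assoc X' Y' one)).
exact: (iso_can_r (f := iso_sym (assoc X Y one))).
Qed.
End Nested.

Section Braided.
Variables (k : fieldType) (C : braided_fusion_cat k).
Implicit Types X Y Z W T S R : C.

Definition brT X Y T : hom (X ⊗ (Y ⊗ T)) (Y ⊗ (X ⊗ T)) := locked_with nested_key (opT (braid X Y) T).
Lemma brTE X Y T : brT X Y T = opT (braid X Y) T.
Proof. by rewrite /brT unlock. Qed.
Definition brTi X Y T : iso (X ⊗ (Y ⊗ T)) (Y ⊗ (X ⊗ T)).
Proof.
by exists (brT X Y T) (opT (inv (braid X Y)) T); rewrite brTE ?opT_iso_K ?opT_iso_invK.
Defined.

Lemma brT_nat X Y T S (g : hom T S) : brT X Y S ∘ (X ◁ Y ◁ g) = (Y ◁ X ◁ g) ∘ brT X Y T.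
Proof. by rewrite !brTE opT_nat. Qed.
Lemma brT_l X X' Y (f : hom X X') T :
  brT X' Y T ∘ (f ▷ (Y ⊗ T)) = (Y ◁ (f ▷ T)) ∘ brT X Y T.
Proof. by rewrite !brTE -opT_l -opT_r -!opT_comp braid_nat. Qed.
Lemma brT_r X Y Y' (f : hom Y Y') T :
  brT X Y' T ∘ (X ◁ (f ▷ T)) = (f ▷ (X ⊗ T)) ∘ brT X Y T.
Proof. by rewrite !brTE -opT_l -opT_r -!opT_comp braid_nat. Qed.

Lemma hexr X Y Z T :
  assoc Y Z (X ⊗ T) ∘ brT X (Y ⊗ Z) T = (Y ◁ brT X Z T) ∘ brT X Y (Z ⊗ T) ∘ (X ◁ assoc Y Z T).
Proof.
apply: (iso_can_r (f := assoc X (Y ⊗ Z) T)); apply: (iso_can_r (f := wri T (assoc X Y Z))).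
rewrite !brTE !opTE !wlc /= !compA (rw0 (fwdK _)) pentagon.
rewrite !(rw1 (esym (wrc _ _ _))) compA hexagon1 !wrc.
rewrite (rw3 (esym (pentagon _ _ _ _))) !compA (rw0 (fwdK _)) -(rw2 (an1 _ _ _)).
rewrite (rw2 (pentagon _ _ _ _)) !compA.
have E : (Y ◁ inv (assoc X Z T)) ∘ (Y ◁ assoc X Z T) = idm _ by rewrite -wlc fwdK wl1.
by rewrite (rw0 E) -(rw2 (an2 _ _ _)).
Qed.

Lemma hexl X Y Z T :
  (Z ◁ assoc X Y T) ∘ brT (X ⊗ Y) Z T = brT X Z (Y ⊗ T) ∘ (X ◁ brT Y Z T) ∘ assoc X Y (Z ⊗ T).
Proof.
have H : fwd (braid (X ⊗ Y) Z) = assoc Z X Y ∘ (braid X Z ▷ Y) ∘ inv (assoc X Z Y)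
     ∘ (X ◁ braid Y Z) ∘ assoc X Y Z.
  have := hexagon2 X Y Z => E; apply: (iso_can_r (f := iso_sym (assoc X Y Z))).
  apply: (iso_can_l (f := iso_sym (assoc Z X Y))); rewrite /= compA E.
  by rewrite -(compA _ (assoc X Y Z)) invK compm1 !compA fwdK comp1m.
apply: (iso_can_r (f := assoc (X ⊗ Y) Z T)).
have E : (X ◁ inv (assoc Y Z T)) ∘ (X ◁ assoc Y Z T) = idm _ by rewrite -wlc fwdK wl1.
rewrite !brTE !opTE !wlc H !wrc !compA !(rw0 (fwdK _)) -pentagon.
rewrite (rw2 (an1 _ _ _)) (rw2 (pentagon _ _ _ _)) !compA (rw0 E) -(rw2 (an2 _ _ _)).
by rewrite (rw3 (pentagon_inv _ _ _ _)) !compA.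
Qed.

Definition b2T X Y T : hom (X ⊗ (Y ⊗ T)) (X ⊗ (Y ⊗ T)) :=
  locked_with nested_key (brT Y X T ∘ brT X Y T).
Lemma b2TE X Y T : b2T X Y T = brT Y X T ∘ brT X Y T.
Proof. by rewrite /b2T unlock. Qed.
Lemma b2T_opT X Y T : b2T X Y T = opT (braid Y X ∘ braid X Y) T.
Proof. by rewrite b2TE !brTE opT_comp. Qed.

Lemma b2T_nat X Y T S (g : hom T S) : b2T X Y S ∘ (X ◁ Y ◁ g) = (X ◁ Y ◁ g) ∘ b2T X Y T.
Proof. by rewrite !b2T_opT opT_nat. Qed.
Lemma b2T_r X Y Y' (f : hom Y Y') T :
  b2T X Y' T ∘ (X ◁ (f ▷ T)) = (X ◁ (f ▷ T)) ∘ b2T X Y T.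
Proof. by rewrite !b2TE -compA brT_r !compA brT_l. Qed.

Lemma b2T_tens X Y Z T :
  (X ◁ assoc Y Z T) ∘ b2T X (Y ⊗ Z) T
  = brT Y X (Z ⊗ T) ∘ (Y ◁ b2T X Z T) ∘ brT X Y (Z ⊗ T) ∘ (X ◁ assoc Y Z T).
Proof. by rewrite !b2TE compA hexl -compA hexr wlc !compA. Qed.

(** The hexagon in which [X] passes two unit strands says that braiding past the unit is idempotent
    up to unit isomorphisms; being invertible, it is trivial. *)
Lemma lunit_br X T : lunit (X ⊗ T) ∘ brT X one T = X ◁ lunit T.
Proof.
apply: (iso_can_r (f := wli X (wli one (lunit T)))); rewrite /= -compA brT_nat compA lunit_nat.
suff E : lunit (X ⊗ (one ⊗ T)) ∘ brT X one (one ⊗ T) = X ◁ lunit (one ⊗ T).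
  by rewrite -compA E -!wlc lunit_nat.
apply: (iso_can_r (f := wli X (assoc one one T))); apply: (iso_can_l (f := brTi X one T)) => /=.
have := hexr X one one T => /(congr1 (fun f => lunit _ ∘ f)).
rewrite compA lunit_tens -brT_r !compA lunit_nat -lunit_tens wlc !compA.
by move=> <-.
Qed.

Lemma br_lunit X T : (X ◁ lunit T) ∘ brT one X T = lunit (X ⊗ T).
Proof.
suff E : (X ◁ lunit (one ⊗ T)) ∘ brT one X (one ⊗ T) = lunit (X ⊗ (one ⊗ T)).
  apply: (iso_can_r (f := wli one (wli X (lunit T)))); rewrite /= -compA brT_nat compA.
  by rewrite -wlc lunit_nat wlc -compA E lunit_nat.
apply: (iso_can_r (f := wli one (brTi one X T))).
apply: (iso_can_r (f := assoc one one (X ⊗ T))) => /=.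
have := hexl one one X T => /(congr1 (fun f => (X ◁ lunit _) ∘ f)).
rewrite compA -wlc lunit_tens -brT_l -lunit_tens !compA => <-.
by rewrite -lunit_nat.
Qed.

Lemma b2T_one Y T : b2T one Y T = idm _.
Proof.
apply: (iso_can_l (f := lunit (Y ⊗ T))).
by rewrite b2TE compA lunit_br br_lunit compm1.
Qed.
End Braided.

(** * Traces and the S-matrix *)

Section SMatrix.
Variables (k : closedFieldType) (C : braided_fusion_cat k).
Variable j : forall X : C, iso X (dual (dual X)).
Hypothesis sj : spherical j.
Implicit Types X Y Z W T S R V : C.
Let pj : pivotal j := sj.1.
Local Notation evr := (evrT j).

Lemma one_end (f : hom (one : C) one) : exists a, f = a *: idm one.
Proof. exact: schur_end (@one_simple k C). Qed.

Lemma tr_ex V (f : hom V V) : exists a, forall T,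
  evr V T ∘ (f ▷ (dual V ⊗ T)) ∘ coT V T = a *: idm T.
Proof.
exact: (mor_scal (mcomp (mcomp (mevr j V [::]) (mrw [:: dual V] f)) (mco V [::])) one_end).
Qed.
Definition tr V (f : hom V V) : k := projT1 (cid (tr_ex f)).
Lemma trP V (f : hom V V) T : evr V T ∘ (f ▷ (dual V ⊗ T)) ∘ coT V T = tr f *: idm T.
Proof. exact: projT2 (cid (tr_ex f)) T. Qed.

Lemma scal_inj (a b : k) : a *: idm (one : C) = b *: idm one -> a = b.
Proof. exact: sc_uniq (@one_simple k C). Qed.
Lemma tr_uniq V (f : hom V V) a :
  evr V one ∘ (f ▷ (dual V ⊗ one)) ∘ coT V one = a *: idm one -> tr f = a.
Proof. by rewrite trP; exact: scal_inj. Qed.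

Lemma trZ V a (f : hom V V) : tr (a *: f) = a * tr f.
Proof. by apply: tr_uniq; rewrite bmapZl compZr compZl !trP scalerA. Qed.
Lemma tr_cyc V W (f : hom V W) (g : hom W V) : tr (g ∘ f) = tr (f ∘ g).
Proof.
apply: tr_uniq; rewrite -trP !wrc !compA evrT_dual_map //.
by rewrite -!compA (coT_dual_map g) (compA (_ ◁ _)) wex !compA.
Qed.

Definition dm V := tr (idm V).
Lemma dmP V T : evr V T ∘ coT V T = dm V *: idm T.
Proof. by rewrite -trP bmap1 compm1. Qed.
Lemma dm_iso V W : isomorphic V W -> dm V = dm W.
Proof. by case=> f; rewrite /dm -(fwdK f) tr_cyc invK. Qed.
Lemma tr_scalar V a : tr (a *: idm V) = a * dm V.
Proof. exact: trZ. Qed.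
Lemma tr_sc V (f : hom V V) : simple V -> tr f = sc f * dm V.
Proof. by move=> sV; rewrite {1}(scE f sV) tr_scalar. Qed.

(** The comparison maps [dtT] in the right evaluation and in the coevaluation of [X ⊗ Y] absorb each
    other. So the trace is closed one strand at a time, with [Y] inside [X]. *)
Lemma tr_tens X Y (f : hom (X ⊗ Y) (X ⊗ Y)) T :
  evr X T ∘ (X ◁ evr Y (dual X ⊗ T)) ∘ opT f _ ∘ (X ◁ coT Y (dual X ⊗ T)) ∘ coT X T
  = tr f *: idm T.
Proof.
rewrite -trP -evrT_tens // -(rw2 (opT_nat _ _)) coT_tensE opTE !compA.
by rewrite !(rw0 (fwdK _)).
Qed.

Lemma dm_tens X Y : dm (X ⊗ Y) = dm X * dm Y.
Proof.
apply: tr_uniq; rewrite bmap1 compm1.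
have := tr_tens (idm (X ⊗ Y)) one; rewrite opT1 compm1 (rw1 (esym (wlc _ _ _))) dmP.
by rewrite bmapZr wl1 compZr compZl compm1 !dmP scalerA mulrC => <-.
Qed.

Lemma coev_neq0 V : ~ is_zero V -> coev V <> 0.
Proof.
move=> nz c0; apply: nz; apply: (wr_inj (X := V)); rewrite bmap1 -zig1 coTE c0.
by rewrite !(bmap0l, comp0r, comp0l).
Qed.

(** By [regular] the coevaluation has a left inverse [r]. Read as a pairing of [V] with [dual V],
    its mate goes from [V] to the double dual and is therefore a multiple [b] of [j V]; this gives
    [b * dm V = 1]. *)
Lemma dm_neq0 V : simple V -> dm V != 0.
Proof.
move=> sV; have [r rP] := regular (coev V).
have [a ra] := one_end (r ∘ coev V).
have a1 : r ∘ coev V = idm one.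
  rewrite ra; suff -> : a = 1 by rewrite scale1r.
  apply/eqP; rewrite -subr_eq0; apply: contrapT => /negP a1.
  case: (coev_neq0 sV.1); apply: (scalerI a1); rewrite scaler0 scalerBl scale1r.
  by rewrite -[in X in _ - X]rP -compA ra compZr compm1 subrr.
set h := inv (j V) ∘ mate r; pose b := sc h.
have mb : mate r = b *: fwd (j V).
  by rewrite -[mate r]comp1m -(invK (j V)) -compA -/h [h in LHS](scE h sV) compZr compm1.
have E : pairT r one ∘ coT V one = (b * dm V) *: idm one.
  by rewrite -mate_ev mb bmapZl compZr -evrTE compZl dmP scalerA.
have E1 : pairT r one ∘ coT V one = idm one.
  by rewrite /pairT coTE !compA (rw0 (fwdK _)) (rw1 (esym (wrc _ _ _))) a1 bmap1 compm1 invK.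
apply/eqP => d0; move: E; rewrite E1 d0 mulr0 -[LHS]scale1r => /scal_inj/eqP.
by rewrite oner_eq0.
Qed.

(* A Y-coloured loop around the strand Z; for Z simple it is the scalar lam, an entry
   of the S-matrix divided by the dimension of Z. *)
Definition ringT Z Y T : hom (Z ⊗ T) (Z ⊗ T) :=
  (Z ◁ evr Y T) ∘ b2T Z Y (dual Y ⊗ T) ∘ (Z ◁ coT Y T).
Definition ringfT Z Y (f : hom Y Y) T : hom (Z ⊗ T) (Z ⊗ T) :=
  (Z ◁ evr Y T) ∘ (Z ◁ (f ▷ (dual Y ⊗ T))) ∘ b2T Z Y (dual Y ⊗ T) ∘ (Z ◁ coT Y T).

Lemma ringf1 Z Y T : ringfT Z (idm Y) T = ringT Z Y T.
Proof. by rewrite /ringfT bmap1 wl1 compm1. Qed.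

(** A morphism placed on the loop slides once around it. This lets [lam_sum] cut the loop along an
    isotypic decomposition of its colour. *)
Lemma ringf_cyc Z V W (f : hom V W) (g : hom W V) T :
  ringfT Z (g ∘ f) T = ringfT Z (f ∘ g) T.
Proof.
have E1 : (Z ◁ evr V T) ∘ (Z ◁ (g ▷ _)) = (Z ◁ evr W T) ∘ (Z ◁ W ◁ (dual_map g ▷ T)).
  by rewrite -!wlc evrT_dual_map.
have E2 : (Z ◁ W ◁ (dual_map g ▷ T)) ∘ (Z ◁ (f ▷ _)) = (Z ◁ (f ▷ _)) ∘ (Z ◁ V ◁ (dual_map g ▷ T)).
  by rewrite -!wlc wex.
have E3 : (Z ◁ V ◁ (dual_map g ▷ T)) ∘ (Z ◁ coT V T) = (Z ◁ (g ▷ _)) ∘ (Z ◁ coT W T).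
  by rewrite -!wlc coT_dual_map.
rewrite /ringfT !wrc !wlc !compA E1 (rw2 E2) -(rw2 (b2T_nat _ _ _)) (rw2 E3).
by rewrite (rw2 (b2T_r _ _ _)).
Qed.

Lemma ring_ex Z Y : simple Z -> exists a, forall T, ringT Z Y T = a *: idm (Z ⊗ T).
Proof.
move=> sZ.
pose F := mcomp (mcomp (mlw Z (mevr j Y [::])) (mop (braid Y Z ∘ braid Z Y) [:: dual Y]))
  (mlw Z (mco Y [::])).
have [h hP] := mor_obj F; exists (sc h) => T.
rewrite -(wl1 Z T) -bmapZl -scE // -hP /F /= /ringT b2T_opT.
by [].
Qed.

Definition lam i Y : k := projT1 (cid (ring_ex Y (irr_simple i))).
Lemma lamP i Y T : ringT (irr C i) Y T = lam i Y *: idm (irr C i ⊗ T).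
Proof. exact: projT2 (cid (ring_ex Y (irr_simple i))) T. Qed.

Lemma lam_uniq i Y a : ringT (irr C i) Y one = a *: idm (irr C i ⊗ one) -> lam i Y = a.
Proof.
rewrite lamP -wl1 -!bmapZl => /wr_inj E; exact: sc_uniq (irr_simple i) E.
Qed.

Lemma lam_sum i Y : lam i Y = \sum_m (hdim (irr C m) Y)%:R * lam i (irr C m).
Proof.
apply: lam_uniq; set Z := irr C i; rewrite -ringf1 -isum.
have fsum I (r : seq I) P (F : I -> hom Y Y) T :
    ringfT Z (\sum_(i <- r | P i) F i) T = \sum_(i <- r | P i) ringfT Z (F i) T.
  by rewrite /ringfT bmap_suml bmap_sumr comp_sumr !comp_suml.
rewrite fsum scaler_suml; apply: eq_bigr => m _; rewrite fsum.
rewrite (eq_bigr (fun=> lam i (irr C m) *: idm _)) => [|a _].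
  by rewrite sumr_const card_ord -scalerA scaler_nat.
by rewrite ringf_cyc iprj_inj eqxx scale1r ringf1 lamP.
Qed.

Lemma ringT_trans Z Y T : (forall S, b2T Z Y S = idm _) -> ringT Z Y T = dm Y *: idm _.
Proof. by move=> H; rewrite /ringT H compm1 -wlc dmP bmapZr wl1. Qed.

Lemma lam_trans i Y : (forall S, b2T (irr C i) Y S = idm _) -> lam i Y = dm Y.
Proof. by move=> H; apply: lam_uniq; rewrite ringT_trans. Qed.

Lemma ringT_tens Z X Y a b T :
  (forall S, ringT Z X S = a *: idm _) -> (forall S, ringT Z Y S = b *: idm _) ->
  ringT Z (X ⊗ Y) T = (a * b) *: idm _.
Proof.
move=> Ha Hb.
(* [B] is the double braiding of [Z] with [X ⊗ Y] in unbracketed form. Its last clause closes the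
   inner [Y] loop, which becomes the scalar [b] and leaves the double braiding with [X]. *)
have [B [HB EB BE]] : exists B : forall S, hom (Z ⊗ (X ⊗ (Y ⊗ S))) (Z ⊗ (X ⊗ (Y ⊗ S))),
    [/\ forall S, b2T Z (X ⊗ Y) S = (Z ◁ inv (assoc X Y S)) ∘ B S ∘ (Z ◁ assoc X Y S),
       forall S R (g : hom S R), B R ∘ (Z ◁ X ◁ Y ◁ g) = (Z ◁ X ◁ Y ◁ g) ∘ B S
     & forall S, (Z ◁ X ◁ evr Y S) ∘ B (dual Y ⊗ S) ∘ (Z ◁ X ◁ coT Y S) = b *: b2T Z X S].
  exists (fun S => brT X Z (Y ⊗ S) ∘ (X ◁ b2T Z Y S) ∘ brT Z X (Y ⊗ S)); split.
  - by move=> S; rewrite -compA -b2T_tens compA -wlc fwdK wl1 comp1m.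
  - move=> S R g; rewrite -compA brT_nat !compA (rw1 (esym (wlc _ _ _))) b2T_nat wlc.
    by rewrite compA brT_nat.
  move=> S; rewrite !compA -brT_nat (rw2 (brT_nat _ _ _)).
  rewrite !(rw1 (esym (wlc _ _ _))) !compA.
  have -> : (Z ◁ evr Y S) ∘ b2T Z Y (dual Y ⊗ S) ∘ (Z ◁ coT Y S) = b *: idm _ by exact: Hb.
  by rewrite bmapZr wl1 compZr compZl compm1 -b2TE.
have E1 S : (Z ◁ assoc X Y S) ∘ (Z ◁ inv (assoc X Y S)) = idm _.
  by rewrite -wlc invK wl1.
rewrite /ringT coT_tensE HB !wlc !compA (rw0 (E1 _)) (rw2 (EB _ _ _)).
rewrite -(wlc Z (evr _ _)) -(wlc Z (_ ∘ _)) evrT_tens // wlc (rw3 (BE _)).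
by rewrite compZr compZl -[_ ∘ _ ∘ _]/(ringT Z X T) Ha scalerA mulrC.
Qed.

Lemma lam_mul i X Y : lam i (X ⊗ Y) = lam i X * lam i Y.
Proof. by apply: lam_uniq; apply: ringT_tens => S; exact: lamP. Qed.

(** Each side is the trace of a double braiding, that is, an unnormalised S-matrix entry; cyclicity
    of the trace exchanges the two objects. *)
Lemma lam_sym i l : dm (irr C i) * lam i (irr C l) = dm (irr C l) * lam l (irr C i).
Proof.
have H i' l' : tr (braid (irr C l') (irr C i') ∘ braid (irr C i') (irr C l'))
    = dm (irr C i') * lam i' (irr C l').
  apply: scal_inj; rewrite -tr_tens -b2T_opT.
  have := lamP i' (irr C l') (dual (irr C i') ⊗ one); rewrite /ringT => /rw3 ->.
  by rewrite compZr compZl compm1 dmP scalerA mulrC.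
by rewrite -!H tr_cyc.
Qed.

Lemma dm_dual V : dm (dual V) = dm V.
Proof.
have H W : pivotal_dim j W = dm W *: idm one.
  have [a pa] := one_end (pivotal_dim j W).
  rewrite pa; congr (_ *: _); apply: scal_inj.
  rewrite -dmP evrTE evTE coTE /pairT !compA -(compA _ (inv _) (j W ▷ _)) ian1 !compA (rw0 (fwdK _)).
  rewrite !(rw1 (esym (wrc _ _ _))).
  rewrite compA.
  have -> : ev (dual W) ∘ (j W ▷ dual W) ∘ coev W = a *: idm one by exact: pa.
  by rewrite bmapZl wl1 compZr compZl compm1 invK.
by apply: scal_inj; rewrite -!H -sj.2.
Qed.
End SMatrix.

(** * The handle slide *)

Section HandleSlide.
Variables (k : closedFieldType) (C : braided_fusion_cat k).
Variable j : forall X : C, iso X (dual (dual X)).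
Hypothesis sj : spherical j.
Implicit Types X Y Z W T S R V : C.
Let pj : pivotal j := sj.1.
Local Notation evr := (evrT j).
Local Notation tr := (tr j).
Local Notation dm := (dm j).
Local Notation lam := (lam j).

Definition corT W T : hom T (dual W ⊗ (W ⊗ T)) :=
  locked_with nested_key ((dual W ◁ (inv (j W) ▷ T)) ∘ coT (dual W) T).
Lemma corTE W T : corT W T = (dual W ◁ (inv (j W) ▷ T)) ∘ coT (dual W) T.
Proof. by rewrite /corT unlock. Qed.
Lemma corT_nat W T S (f : hom T S) : corT W S ∘ f = (dual W ◁ W ◁ f) ∘ corT W T.
Proof. by rewrite !corTE -compA coT_nat !compA -!wlc wex. Qed.
Lemma zig3 W T : evr W (W ⊗ T) ∘ (W ◁ corT W T) = idm (W ⊗ T).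
Proof.
rewrite evrTE -compA -wex corTE wlc !compA evT_nat -(compA _ (evT _ _)) zig2 compm1.
by rewrite -wrc fwdK bmap1.
Qed.

(** Four hom spaces are bent into families between [Y] and [w ⊗ dual m]: the unprimed versions bend
    the strand [m], the primed ones the strand [w]. Passing from one bending to the other is what
    moves a strand from one loop to another. *)
Definition bendA Y m w (P : hom (Y ⊗ m) w) T : hom (Y ⊗ T) (w ⊗ (dual m ⊗ T)) :=
  (P ▷ (dual m ⊗ T)) ∘ inv (assoc Y m (dual m ⊗ T)) ∘ (Y ◁ coT m T).
Definition bendB Y m w (Q : hom w (Y ⊗ m)) T : hom (w ⊗ (dual m ⊗ T)) (Y ⊗ T) :=
  (Y ◁ evr m T) ∘ assoc Y m (dual m ⊗ T) ∘ (Q ▷ (dual m ⊗ T)).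
Definition bendA' Y m w (P : hom (dual w ⊗ Y) (dual m)) T : hom (Y ⊗ T) (w ⊗ (dual m ⊗ T)) :=
  (w ◁ ((P ▷ T) ∘ inv (assoc (dual w) Y T))) ∘ coT w (Y ⊗ T).
Definition bendB' Y m w (Q : hom (dual m) (dual w ⊗ Y)) T : hom (w ⊗ (dual m ⊗ T)) (Y ⊗ T) :=
  evr w (Y ⊗ T) ∘ (w ◁ (assoc (dual w) Y T ∘ (Q ▷ T))).

Definition mbendA' Y m w (P : hom (dual w ⊗ Y) (dual m)) : mor [:: Y] [:: w; dual m] :=
  mcomp (mlw w (mcomp (mrw [::] P) (mspi (dual w) Y [::]))) (mco w [:: Y]).
Definition mbendB Y m w (Q : hom w (Y ⊗ m)) : mor [:: w; dual m] [:: Y] :=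
  mcomp (mcomp (mlw Y (mevr j m [::])) (msp Y m [:: dual m])) (mrw [:: dual m] Q).

(** Reading [T] as [m ⊗ T] adds a strand [m] at the right of both words, against which a dual strand
    can be contracted. *)
Program Definition mrs Y w o m (F : mor [:: Y] [:: w; o]) : mor [:: Y; m] [:: w; o; m] :=
  @Mor _ C [:: Y; m] [:: w; o; m] (fun T => F (m ⊗ T)) _ _.
Next Obligation. exact: (mor_nat F (m ◁ f)). Qed.
Next Obligation.
rewrite wl1 comp1m compA (mor_nat F (assoc m T S)).
have := mor_mod F (m ⊗ T) S; rewrite /= !wl1 !comp1m => /rw2 ->.
by rewrite wlc !compA.
Qed.

Lemma bendA_surj Y m w (F : mor [:: Y] [:: w; dual m]) :
  exists P : hom (Y ⊗ m) w, forall T, F T = bendA P T.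
Proof.
have [P HP] := mor_obj (mcomp (mcomp (mlw w (mev m [::])) (mrs m F)) (msp Y m [::])).
exists P => T; rewrite /bendA -HP /= -!compA (compA (assoc _ _ _)) invK comp1m.
have := mor_nat F (coT m T) => /= ->.
by rewrite compA -wlc zig2 wl1 comp1m.
Qed.

Lemma bendB'_surj Y m w (F : mor [:: w; dual m] [:: Y]) :
  exists Q : hom (dual m) (dual w ⊗ Y), forall T, F T = bendB' Q T.
Proof.
pose G0 : mor [:: w; dual m] [:: Y] := F.
have cn T S : corT w (dual m ⊗ (T ⊗ S)) ∘ aw [:: dual m] T S =
   aw [:: dual w; w; dual m] T S ∘ (corT w (dual m ⊗ T) ▷ S).
  rewrite !corTE wrc.
  have H1 := mco_mod (dual w) [:: dual m] T S.
  rewrite -compA H1 [LHS]compA [RHS]compA; congr (_ ∘ _).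
  have H2 := mor_mod (mlw (dual w) (mrw [:: dual m] (inv (j w)))) T S.
  exact: H2.
pose G := @Mor _ C [:: dual m] [:: dual w; w; dual m] (fun T => corT w (dual m ⊗ T))
  (fun T S f => corT_nat w (dual m ◁ f)) cn.
have [Q HQ] := mor_obj (mcomp (mcomp (mspi (dual w) Y [::]) (mlw (dual w) F)) G).
exists Q => T; rewrite /bendB' -HQ /= !compA invK comp1m wlc compA.
have -> : evr w (Y ⊗ T) ∘ (w ◁ dual w ◁ F T) = F T ∘ evr w (w ⊗ (dual m ⊗ T)).
  exact: evrT_nat.
by rewrite -compA zig3 compm1.
Qed.

Lemma scal_ex Y w m (B : mor [:: w; dual m] [:: Y]) (A : mor [:: Y] [:: w; dual m]) :
  simple Y -> exists a, forall T, B T ∘ A T = a *: idm (Y ⊗ T).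
Proof.
move=> sY; have [h hP] := mor_obj (mcomp B A); exists (sc h) => T.
by rewrite -(wl1 Y T) -bmapZl -scE // -hP.
Qed.

(* Closing the Y strand computes both pairings as traces. *)
Lemma tr_bendBA Y m w (Q : hom w (Y ⊗ m)) (P : hom (Y ⊗ m) w) y :
  simple Y -> (forall T, bendB Q T ∘ bendA P T = y *: idm (Y ⊗ T)) -> tr (P ∘ Q) = y * dm Y.
Proof.
move=> sY H; apply: scal_inj; rewrite (tr_cyc sj).
apply: (etrans (esym (tr_tens sj (Q ∘ P) one))).
have E : (Y ◁ evr m (dual Y ⊗ one)) ∘ opT (Q ∘ P) _ ∘ (Y ◁ coT m (dual Y ⊗ one)) = y *: idm _.
  by rewrite -H /bendA /bendB opTE wrc !compA.
by rewrite (rw3 E) compZr compm1 compZl dmP scalerA.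
Qed.

(** Some rank one piece of the isotypic decomposition of [idm X] is nonzero, hence a nonzero scalar
    [c]. It is idempotent, so [c = 1] and [X] is isomorphic to that simple summand. *)
Lemma simple_end X : ~ is_zero X -> (forall f : hom X X, exists a, f = a *: idm X) -> simple X.
Proof.
move=> nz H.
have [i [a ne]] : exists i a, @iinj k C X i a ∘ iprj a <> 0.
  apply: contrapT => N; apply: nz; rewrite /is_zero -isum big1 // => i _; rewrite big1 // => a _.
  by apply: contrapT => M; apply: N; exists i, a.
have [c ce] := H (iinj a ∘ iprj a).
have c0 : c != 0 by apply/eqP => c0; apply: ne; rewrite ce c0 scale0r.
have E : iprj a ∘ iinj a = idm (irr C i) by rewrite iprj_inj eqxx scale1r.
have E' : iinj a ∘ iprj a = idm X.
  rewrite ce; suff -> : c = 1 by rewrite scale1r.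
  apply: (mulIf c0); rewrite mul1r.
  have : (iinj a ∘ iprj a) ∘ (iinj a ∘ iprj a) = iinj a ∘ iprj a.
    by rewrite !compA (rw0 E).
  rewrite ce compZl compZr comp1m scalerA => /eqP; rewrite -subr_eq0 -scalerBl => /eqP S.
  apply/eqP; rewrite -subr_eq0; apply: contrapT => /negP M; apply: nz.
  by apply: (scalerI M); rewrite scaler0.
by apply: (simple_iso _ (irr_simple i)); split; exact: Iso E E'.
Qed.

Lemma simple_dual X : simple X -> simple (dual X).
Proof.
move=> sX; apply: simple_end => [z|f].
  case: sX => + _; apply; apply: (wr_inj (X := X)); rewrite bmap1 -zig1.
  rewrite bmap0l (zero_hom_r (coT _ _)) ?comp0r //.
  by rewrite /is_zero -[idm _]bmap1 -[idm (dual X ⊗ _)]bmap1 z bmap0l bmap0r.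
have [h hP] := mor_obj (mcomp (mlw X (mcomp (mev X [::]) (mrw [:: X] f))) (mco X [:: X])).
exists (sc h); apply: ev_inj => T; rewrite bmapZl bmap1 compZr compm1.
have -> : evT X T ∘ (f ▷ (X ⊗ T)) = evT X T ∘ (dual X ◁ (h ▷ T)).
  rewrite -hP /= !wlc !compA evT_nat -(compA _ (evT X _)) evT_nat.
  by rewrite -!compA zig2 compm1.
by rewrite {1}(scE h sX) bmapZl bmapZr !bmap1 compZr compm1.
Qed.

Lemma dual_isom X Y : isomorphic X Y -> isomorphic (dual X) (dual Y).
Proof.
case=> f; split; exists (dual_map (inv f)) (dual_map f).
  by rewrite -dual_map_comp fwdK dual_map_id.
by rewrite -dual_map_comp invK dual_map_id.
Qed.

Lemma ddual_isom X : isomorphic X (dual (dual X)).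
Proof. by split; exact: j. Qed.

Lemma dual_complete : complete (fun i => dual (irr C i)).
Proof.
split=> [i|i i' H|X sX]; first exact/simple_dual/irr_simple.
  apply: irr_inj; apply: (isomorphic_trans (ddual_isom _)).
  apply: (isomorphic_trans (dual_isom H)); exact/isomorphic_sym/ddual_isom.
have [i Hi] := irr_full (simple_dual sX); exists i.
exact: isomorphic_trans (ddual_isom X) (dual_isom Hi).
Qed.

(** The hypothesis closes the strand [w] of [Q ∘ P], whereas [tr_tens] closes [Y] first. The latter
    partial trace is a scalar because [dual w] is simple, and nesting the two closures in either
    order gives the same number. *)
Lemma tr_bendBA' Y m w (Q : hom (dual m) (dual w ⊗ Y)) (P : hom (dual w ⊗ Y) (dual m)) y :
  simple w -> (forall T, bendB' Q T ∘ bendA' P T = y *: idm (Y ⊗ T)) -> tr (P ∘ Q) = y * dm Y.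
Proof.
move=> sw H; apply: scal_inj; rewrite (tr_cyc sj).
apply: (etrans (esym (tr_tens sj (Q ∘ P) one))).
have [h hP] := mor_obj (mcomp (mcomp (mlw (dual w) (mevr j Y [::])) (mop (Q ∘ P) [:: dual Y]))
   (mlw (dual w) (mco Y [::]))).
have hE T : (dual w ◁ evr Y T) ∘ opT (Q ∘ P) (dual Y ⊗ T) ∘ (dual w ◁ coT Y T) = sc h *: idm _.
  rewrite -(wl1 (dual w) T) -bmapZl -scE; [by rewrite -hP|exact: simple_dual].
rewrite (rw3 (hE _)) compZr compm1 compZl dmP dm_dual // scalerA.
transitivity (evr Y one ∘ (y *: idm _) ∘ coT Y one); last first.
  by rewrite compZr compm1 compZl dmP scalerA.
have E T : bendB' Q T ∘ bendA' P T = evr w (Y ⊗ T) ∘ (w ◁ opT (Q ∘ P) T) ∘ coT w (Y ⊗ T).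
  by rewrite /bendB' /bendA' opTE wrc !wlc !compA.
rewrite -H E !compA -evrT_nat // -(compA _ (coT w _)) coT_nat !compA.
rewrite !(rw1 (esym (wlc _ _ _))) !compA hE bmapZr wl1 compZr compm1 compZl dmP scalerA.
by [].
Qed.

Section Canonical.
Variables (Z Y w m : C).
Hypotheses (sY : simple Y) (sw : simple w) (sm : simple m).
Variables (n n' : nat) (ij : 'I_n -> hom w (Y ⊗ m)) (pj' : 'I_n -> hom (Y ⊗ m) w).
Variables (ka : 'I_n' -> hom (dual m) (dual w ⊗ Y)) (rh : 'I_n' -> hom (dual w ⊗ Y) (dual m)).
Hypothesis spanP : forall P : hom (Y ⊗ m) w, P = \sum_a (P ∘ ij a) ∘ pj' a.
Hypothesis spanQ : forall Q : hom (dual m) (dual w ⊗ Y), Q = \sum_c ka c ∘ (rh c ∘ Q).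

(* The two families of bent basis vectors are dual bases of the same pairs of
   hom spaces up to the ratio dm m / dm w, which gives the fusing identity. *)
Lemma canonical T :
  dm m *: (\sum_a (Z ◁ bendB (ij a) T) ∘ b2T Z w (dual m ⊗ T) ∘ (Z ◁ bendA (pj' a) T))
  = dm w *: (\sum_c (Z ◁ bendB' (ka c) T) ∘ b2T Z w (dual m ⊗ T) ∘ (Z ◁ bendA' (rh c) T)).
Proof.
(* [y a c] is the scalar by which the bent [ij a] pairs with the bent [rh c]. It provides the
   coefficients of each family in the other, normalised by [dm w] in [HA] and by [dm m] in [HB]. *)
have [y yP] : exists y : 'I_n -> 'I_n' -> k, forall a c S,
    bendB (ij a) S ∘ bendA' (rh c) S = y a c *: idm (Y ⊗ S).
  have H a c := scal_ex (mbendB (ij a)) (mbendA' (rh c)) sY.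
  by exists (fun a c => projT1 (cid (H a c))) => a c S; case: cid => y /= <-.
have nw := dm_neq0 j sw; have nm := dm_neq0 j sm.
have HA c : bendA' (rh c) T = \sum_a (y a c * dm Y / dm w) *: bendA (pj' a) T.
  have [P PE] := bendA_surj (mbendA' (rh c)).
  rewrite [LHS](PE T) [in LHS](spanP P) /bendA bmap_suml !comp_suml; apply: eq_bigr => a _.
  rewrite [P ∘ ij a](scE _ sw) compZl comp1m bmapZl !compZl; congr (_ *: _).
  apply: (mulIf nw); rewrite mulfVK // -tr_sc //; apply: tr_bendBA => // S.
  by rewrite -yP -PE.
have HB a : bendB (ij a) T = \sum_c (y a c * dm Y / dm m) *: bendB' (ka c) T.
  have [Q QE] := bendB'_surj (mbendB (ij a)).
  rewrite [LHS](QE T) [in LHS](spanQ Q) /bendB' bmap_suml comp_sumr bmap_sumr comp_sumr.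
  apply: eq_bigr => c _.
  rewrite [rh c ∘ Q](scE _ (simple_dual sm)) compZr compm1 bmapZl compZr bmapZr compZr; congr (_ *: _).
  apply: (mulIf nm); rewrite mulfVK // -[X in _ * X](dm_dual sj) -tr_sc //; last exact: simple_dual.
  by apply: tr_bendBA' => // S; rewrite -yP -QE.
rewrite !scaler_sumr.
transitivity (\sum_a \sum_c (y a c * dm Y) *:
   ((Z ◁ bendB' (ka c) T) ∘ b2T Z w (dual m ⊗ T) ∘ (Z ◁ bendA (pj' a) T))).
  apply: eq_bigr => a _; rewrite HB bmap_sumr !comp_suml scaler_sumr; apply: eq_bigr => c _.
  by rewrite bmapZr !compZl scalerA mulrC mulfVK.
rewrite exchange_big; apply: eq_bigr => c _.
rewrite HA bmap_sumr comp_sumr scaler_sumr; apply: eq_bigr => a _.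
by rewrite bmapZr compZr scalerA [dm w * _]mulrC mulfVK.
Qed.
End Canonical.

Lemma span_out V (e : 'I_(rank C) -> C) (inj : forall i, 'I_(hdim (e i) V) -> hom (e i) V)
    (prj : forall i, 'I_(hdim (e i) V) -> hom V (e i)) i (P : hom V (e i)) :
  complete e -> is_isotypic inj prj -> P = \sum_a (P ∘ inj i a) ∘ prj i a.
Proof.
move=> [se ei _] [_ _ H]; rewrite -[LHS]compm1 -H comp_sumr (bigD1 i) //= [X in _ + X]big1 ?addr0.
  by rewrite comp_sumr; apply: eq_bigr => a _; rewrite compA.
move=> l li; rewrite comp_sumr big1 // => a _; rewrite compA (schur0 (P ∘ _)) ?comp0l //.
by move/ei/eqP; rewrite (negPf li).
Qed.

Lemma span_in V (e : 'I_(rank C) -> C) (inj : forall i, 'I_(hdim (e i) V) -> hom (e i) V)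
    (prj : forall i, 'I_(hdim (e i) V) -> hom V (e i)) i (Q : hom (e i) V) :
  complete e -> is_isotypic inj prj -> Q = \sum_a inj i a ∘ (prj i a ∘ Q).
Proof.
move=> [se ei _] [_ _ H]; rewrite -[LHS]comp1m -H comp_suml (bigD1 i) //= [X in _ + X]big1 ?addr0.
  by rewrite comp_suml; apply: eq_bigr => a _; rewrite compA.
move=> l li; rewrite comp_suml big1 // => a _; rewrite -compA (schur0 (_ ∘ Q)) ?comp0r //.
by move/ei/eqP; rewrite eq_sym (negPf li).
Qed.

(** By hypothesis a loop [m] around [Z] may be traded for [dm m], so the global dimension times the
    double braiding of [Z] and [Y] is a sum of double braidings of [Z] with [Y ⊗ m], with [m] closed
    up. Resolve [Y ⊗ m] into simple objects [w]. By [canonical] the sum over [m] then assembles to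
    the identity of [dual w ⊗ Y]: now [Z] is linked with a loop [w] only, [Y] has slid off, and the
    total is the global dimension times the identity. *)
Lemma handle_slide i y : 
  (forall m, lam i (irr C m) = dm (irr C m)) -> \sum_m dm (irr C m) ^+ 2 != 0 ->
  forall T, b2T (irr C i) (irr C y) T = idm _.
Proof.
move=> Hi Hd T; set Z := irr C i; set Y := irr C y.
have R m : dm (irr C m) ^+ 2 *: b2T Z Y T = dm (irr C m) *:
    (\sum_w \sum_a (Z ◁ bendB (@iinj k C (Y ⊗ irr C m) w a) T) ∘ b2T Z (irr C w) (dual (irr C m) ⊗ T)
       ∘ (Z ◁ bendA (@iprj k C (Y ⊗ irr C m) w a) T)).
  rewrite expr2 -scalerA; congr (_ *: _); rewrite -[X in X *: _](Hi m).
  pose S := dual (irr C m) ⊗ T.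
  have E1 : (Z ◁ assoc Y (irr C m) S) ∘ (Z ◁ inv (assoc Y (irr C m) S)) = idm _.
    by rewrite -wlc invK wl1.
  have E2 : lam i (irr C m) *: b2T Z Y T = (Z ◁ Y ◁ evr (irr C m) T) ∘
      ((Z ◁ assoc Y (irr C m) S) ∘ b2T Z (Y ⊗ irr C m) S ∘ (Z ◁ inv (assoc Y (irr C m) S)))
      ∘ (Z ◁ Y ◁ coT (irr C m) T).
    rewrite b2T_tens (rw0 E1) !compA -brT_nat (rw2 (brT_nat _ _ _)).
    rewrite !(rw1 (esym (wlc _ _ _))) !compA.
    have -> : (Z ◁ evr (irr C m) T) ∘ b2T Z (irr C m) S ∘ (Z ◁ coT (irr C m) T) = lam i (irr C m) *: idm _.
      exact: lamP.
    by rewrite bmapZr wl1 compZr compZl compm1 -b2TE.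
  have I1 : idm (Z ⊗ ((Y ⊗ irr C m) ⊗ S)) = \sum_w \sum_a (Z ◁ ((@iinj k C _ w a ∘ iprj a) ▷ S)).
    rewrite -wl1 -(bmap1 _ _ S) -[X in Z ◁ (X ▷ S)]isum bmap_suml bmap_sumr.
    by apply: eq_bigr => w _; rewrite bmap_suml bmap_sumr.
  rewrite E2 -[b2T Z (Y ⊗ irr C m) S]compm1 I1.
  rewrite !(comp_sumr, comp_suml); apply: eq_bigr => w _.
  rewrite !(comp_sumr, comp_suml); apply: eq_bigr => a _.
  by rewrite /bendA /bendB wrc !wlc !compA -!(rw2 (b2T_r _ _ _)).
have R' w : dm (irr C w) ^+ 2 *: idm (Z ⊗ (Y ⊗ T)) = dm (irr C w) *:
   ringT j Z (irr C w) (Y ⊗ T).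
  by rewrite lamP // Hi scalerA.
apply: (scalerI Hd); rewrite !scaler_suml (eq_bigr _ (fun m _ => R m)) (eq_bigr _ (fun w _ => R' w)).
have [ka H] : exists ka : forall w m, 'I_(hdim (dual (irr C m)) (dual (irr C w) ⊗ Y)) -> hom (dual (irr C m)) (dual (irr C w) ⊗ Y),
   exists rh : forall w m, 'I_(hdim (dual (irr C m)) (dual (irr C w) ⊗ Y)) -> hom (dual (irr C w) ⊗ Y) (dual (irr C m)),
   forall w, is_isotypic (ka w) (rh w).
  pose G w := cid (isotypic (dual (irr C w) ⊗ Y) dual_complete).
  exists (fun w => projT1 (G w)); exists (fun w => projT1 (cid (projT2 (G w)))) => w.
  exact: projT2 (cid (projT2 (G w))).
have [rh iso] := H.
under eq_bigr do rewrite scaler_sumr.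
rewrite exchange_big; apply: eq_bigr => w _.
transitivity (\sum_m dm (irr C w) *: (\sum_c (Z ◁ bendB' (ka w m c) T)
     ∘ b2T Z (irr C w) (dual (irr C m) ⊗ T) ∘ (Z ◁ bendA' (rh w m c) T))).
  apply: eq_bigr => m _; apply: canonical; try exact: irr_simple.
  - by move=> P; apply: span_out (irr_complete C) (iinjP _).
  - by move=> Q; exact: span_in dual_complete (iso w).
rewrite -scaler_sumr; congr (_ *: _).
have [_ _ H3] := iso w.
have I2 : idm (Z ⊗ (irr C w ⊗ (dual (irr C w) ⊗ (Y ⊗ T)))) =
    \sum_m \sum_c (Z ◁ irr C w ◁ (assoc _ _ _ ∘ ((ka w m c ∘ rh w m c) ▷ T) ∘ inv (assoc _ _ _))).
  transitivity (Z ◁ irr C w ◁ (assoc _ _ _ ∘ (idm (dual (irr C w) ⊗ Y) ▷ T) ∘ inv (assoc _ _ _))).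
    by rewrite bmap1 compm1 invK !wl1.
  rewrite -[X in X ▷ T]H3 bmap_suml comp_sumr comp_suml !bmap_sumr; apply: eq_bigr => m _.
  by rewrite bmap_suml comp_sumr comp_suml !bmap_sumr.
rewrite /ringT -[b2T Z (irr C w) _]compm1 I2.
rewrite !(comp_sumr, comp_suml); apply: eq_bigr => m _.
rewrite !(comp_sumr, comp_suml); apply: eq_bigr => c _.
by rewrite /bendA' /bendB' !wrc !wlc !compA -!(rw2 (b2T_nat _ _ _)).
Qed.
End HandleSlide.

(** * Perron-Frobenius eigenvalues *)

Section Perron.
Variables (F : numClosedFieldType) (r : nat).
Implicit Types (A : 'M[F]_r) (u w : 'rV[F]_r).

Lemma real_max (s : 'I_r -> F) : (0 < r)%N -> (forall i, s i \is Num.real) ->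
  exists i, forall j, s j <= s i.
Proof.
move=> r0 sr; pose i0 := Ordinal r0.
suff [i Hi] : exists i, forall j, j \in enum 'I_r -> s j <= s i.
  by exists i => j; apply: Hi; rewrite mem_enum.
elim: (enum 'I_r) => [|a l [i IH]]; first by exists i0.
have /orP [le|le] := real_leVge (sr a) (sr i).
  by exists i => j; rewrite inE => /orP [/eqP ->|/IH].
exists a => j; rewrite inE => /orP [/eqP -> //|/IH h]; exact: le_trans h le.
Qed.

(** Rayleigh quotients: [w] is an eigenvector for the largest eigenvalue [mu]. Replacing its entries
    by absolute values does not decrease the quadratic form [Q], so [u] attains the maximum too and
    is an eigenvector; positivity of [A] then makes every entry of [u] positive. *)
Lemma perron A : (0 < r)%N -> (forall i j, 0 < A i j) -> A^T = A ->
  exists (v : 'rV[F]_r) mu, [/\ forall i, 0 < v 0 i, 0 < mu & v *m A = mu *: v].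
Proof.
move=> r0 A0 At.
have Ar : A \is a mxOver Num.real by apply/mxOverP => i j; exact: gtr0_real.
have As : A \is symmetricmx by apply/is_hermitianmxP; rewrite expr0 scale1r map_mx_id // At.
have Ah := realsym_hermsym As Ar.
have An := hermitian_normalmx Ah.
have AE := orthomx_spectralP An.
set P := spectralmx A in AE; set s := spectral_diag A in AE.
have sr j : s 0 j \is Num.real by have /mxOverP := hermitian_spectral_diag_real Ah.
have [i1 smax] := real_max r0 sr.
set mu := s 0 i1 in smax.
pose cj m n (B : 'M[F]_(m, n)) := map_mx Num.conj B^T.
have cjM m n p (B : 'M[F]_(m, n)) (D : 'M[F]_(n, p)) : cj _ _ (B *m D) = cj _ _ D *m cj _ _ B.
  by rewrite /cj trmx_mul map_mxM.
have Pu : P \in unitmx := spectral_unit A.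
have PcE : invmx P = cj _ _ P by rewrite invmx_unitary ?spectral_unitarymx.
have cjPc : cj _ _ (invmx P) = P by rewrite PcE /cj map_trmx trmxK -map_mx_comp map_mx_id // => x; rewrite /= conjCK.
pose nrm (x : 'rV[F]_r) := \sum_i `|x 0 i| ^+ 2.
have nrmE x : nrm x = (x *m cj _ _ x) 0 0.
  by rewrite mxE; apply: eq_bigr => i _; rewrite !mxE normCK.
have nrmP x : nrm (x *m invmx P) = nrm x.
  by rewrite !nrmE cjM cjPc mulmxA -[x *m _ *m _]mulmxA mulVmx // mulmx1.
pose Q (x : 'rV[F]_r) := (x *m A *m cj _ _ x) 0 0.
have QE x : Q x = \sum_i s 0 i * `|(x *m invmx P) 0 i| ^+ 2.
  have E : P *m cj _ _ x = cj _ _ (x *m invmx P) by rewrite cjM cjPc.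
  rewrite /Q {1}AE !mulmxA -[_ *m P *m _]mulmxA E.
  move: (x *m _) => y; rewrite mul_mx_diag mxE; apply: eq_bigr => i _.
  by rewrite !mxE mulrAC mulrC -normCK.
pose w := row i1 P.
have wA : w *m A = mu *: w.
  rewrite {1}AE !mulmxA /w -row_mul mulmxV // row1 -rowE row_diag_mx -scalemxAl -rowE.
  by [].
have w0 : w != 0.
  apply/eqP => w0; have : row i1 (P *m invmx P) = 0 by rewrite row_mul -/w w0 mul0mx.
  by rewrite mulmxV // => /rowP/(_ i1)/eqP; rewrite !mxE eqxx oner_eq0.
pose u := map_mx Num.norm w.
have nu : nrm u = nrm w by apply: eq_bigr => i _; rewrite mxE normr_id.
have nw : 0 < nrm w.
  rewrite lt_def sumr_ge0 ?andbT => [|i _]; last exact: exprn_ge0.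
  apply: contra w0; rewrite psumr_eq0 => [/allP H|i _]; last exact: exprn_ge0.
  apply/eqP/rowP => i; rewrite [RHS]mxE; apply/eqP.
  by have := H i (mem_index_enum _); rewrite sqrf_eq0 normr_eq0.
have Qw : Q w = mu * nrm w by rewrite /Q wA -scalemxAl mxE nrmE.
have Qu : `|Q w| <= Q u.
  rewrite /Q !mxE (le_trans (ler_norm_sum _ _ _)) // ler_sum // => i _.
  rewrite !mxE normrM norm_conjC conj_Creal ?normr_real // ler_wpM2r //.
  rewrite (le_trans (ler_norm_sum _ _ _)) // ler_sum // => l _.
  by rewrite !mxE normrM (gtr0_norm (A0 _ _)).
have mr : mu \is Num.real by exact: sr.
(* Each term is nonnegative and the sum measures by how much [u] misses the maximum. So every
   spectral coordinate of [u] with eigenvalue other than [mu] vanishes. *)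
have E0 : \sum_i (mu - s 0 i) * `|(u *m invmx P) 0 i| ^+ 2 = 0.
  apply/eqP; rewrite eq_le; apply/andP; split; last first.
    by apply: sumr_ge0 => i _; rewrite mulr_ge0 ?subr_ge0 ?exprn_ge0.
  under eq_bigr do rewrite mulrBl.
  rewrite sumrB -QE -mulr_sumr -/(nrm _) nrmP nu subr_le0 -Qw (le_trans _ Qu) //.
  by rewrite real_ler_norm // Qw rpredM // gtr0_real.
have uA : u *m A = mu *: u.
  rewrite {1}AE !mulmxA mul_mx_diag -[u in RHS](mulmxKV Pu) scalemxAl; congr (_ *m _).
  apply/rowP=> i; rewrite !mxE -/(nrm _).
  move/eqP: E0; rewrite psumr_eq0 => [/allP/(_ i (mem_index_enum _))|l _]; last first.
    by rewrite mulr_ge0 ?subr_ge0 ?exprn_ge0.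
  rewrite mulf_eq0 subr_eq0 sqrf_eq0 normr_eq0 mxE => /orP [/eqP ->|/eqP ->].
    by rewrite mulrC.
  by rewrite mul0r mulr0.
have u0 i : 0 <= u 0 i by rewrite mxE.
have [i2 ui2] : exists i, 0 < u 0 i.
  have /existsP [i Hi] : [exists i, w 0 i != 0].
    apply: contraT; rewrite negb_exists => /forallP H; case/eqP: w0.
    by apply/rowP => i; rewrite [RHS]mxE; apply/eqP; have := H i; rewrite negbK.
  by exists i; rewrite mxE normr_gt0.
have mu_u l : 0 < mu * u 0 l.
  have -> : mu * u 0 l = (u *m A) 0 l by rewrite uA [RHS]mxE.
  rewrite mxE (bigD1 i2) //= ltr_wpDr ?mulr_gt0 // sumr_ge0 // => i _.
  by rewrite mulr_ge0 // ltW.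
exists u, mu; split => // [i|].
  by rewrite lt_def u0 andbT; apply: contraTneq (mu_u i) => ->; rewrite mulr0 ltxx.
by have := mu_u i2; rewrite pmulr_lgt0.
Qed.

(** The eigenvalue equations for [v] and [w] make the Dirichlet form, the sum of [M i l * v i * v l]
    times the squared modulus of [w i / v i - w l / v l], equal to zero. Its terms are nonnegative,
    so the ratio is constant along positive entries of [M]. *)
Lemma dirichlet (M : 'I_r -> 'I_r -> F) (v w : 'I_r -> F) D :
  (forall i j, 0 <= M i j) -> (forall i j, M i j = M j i) -> (forall i, 0 < v i) -> D \is Num.real ->
  (forall i, \sum_l M i l * v l = D * v i) -> (forall i, \sum_l M i l * w l = D * w i) ->
  forall i l, 0 < M i l -> w i / v i = w l / v l.
Proof.
move=> M0 Ms v0 Dr Mv Mw.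
have [a aE] : exists a : 'I_r -> F, forall i, a i = w i / v i by exists (fun i => w i / v i).
have va i : v i * a i = w i by rewrite aE mulrC mulfVK // gt_eqF.
have vr i : (v i)^* = v i by rewrite conj_Creal // gtr0_real.
have Mr i l : (M i l)^* = M i l by rewrite conj_Creal // ger0_real.
have E : \sum_i \sum_l M i l * (v i * v l) * `|a i - a l| ^+ 2 = 0.
  transitivity (\sum_i \sum_l (M i l * v l * (v i * (a i * (a i)^* )) + M i l * v i * (v l * (a l * (a l)^* ))
      - (M i l * w l)^* * w i - (M i l * w l) * (w i)^* )).
    apply: eq_bigr => i _; apply: eq_bigr => l _.
    rewrite -!va normCK !rmorphB !rmorphM /= !vr Mr; ring.
  pose q := \sum_i D * (w i * (w i)^* ).
  have ww i : v i * (v i * (a i * (a i)^* )) = w i * (w i)^*.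
    by rewrite -va rmorphM /= vr; ring.
  have S1 : \sum_i \sum_l M i l * v l * (v i * (a i * (a i)^* )) = q.
    by apply: eq_bigr => i _; rewrite -mulr_suml Mv -mulrA ww.
  have S2 : \sum_i \sum_l M i l * v i * (v l * (a l * (a l)^* )) = q.
    rewrite exchange_big -S1; apply: eq_bigr => i _; apply: eq_bigr => l _.
    by rewrite Ms.
  have S3 : \sum_i \sum_l (M i l * w l)^* * w i = q.
    apply: eq_bigr => i _; rewrite -mulr_suml -rmorph_sum Mw rmorphM /= (conj_Creal Dr).
    by rewrite -mulrA [_^* * _]mulrC.
  have S4 : \sum_i \sum_l M i l * w l * (w i)^* = q.
    by apply: eq_bigr => i _; rewrite -mulr_suml Mw mulrA.
  transitivity (q + q - q - q); last by ring.
  rewrite -{1}S1 -{1}S2 -{1}S3 -{1}S4 -big_split -!sumrB /=; apply: eq_bigr => i _.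
  by rewrite -big_split -!sumrB.
move=> i l Mil; have v2 : 0 < v i * v l by rewrite mulr_gt0.
have t0 i' l' : 0 <= M i' l' * (v i' * v l') * `|a i' - a l'| ^+ 2.
  by rewrite mulr_ge0 ?exprn_ge0 // mulr_ge0 // mulr_ge0 // ltW.
move/eqP: E; rewrite psumr_eq0 => [/allP/(_ i (mem_index_enum _))|i' _]; last exact: sumr_ge0.
rewrite psumr_eq0 => [/allP/(_ l (mem_index_enum _))|//].
rewrite mulf_eq0 sqrf_eq0 normr_eq0 subr_eq0 (gt_eqF (mulr_gt0 Mil v2)) /= => /eqP.
by rewrite !aE.
Qed.
End Perron.

(** Pairing the absolute values of a left eigenvector with the positive right eigenvector [v] bounds
    every eigenvalue by [d], which is itself an eigenvalue. *)
Lemma max_eigenvalue_perron r (M : 'M[algC]_r) (v : 'I_r -> algC) d :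
  (0 < r)%N -> (forall i l, 0 <= M i l) -> (forall i, 0 < v i) -> 0 <= d ->
  (forall i, \sum_l M i l * v l = d * v i) -> max_eigenvalue M = d.
Proof.
move=> r0 M0 v0 d0 Mv; rewrite /max_eigenvalue; case: closed_field_poly_normal => s /= sE.
have rt a : (a \in s) = root (char_poly M) a.
  rewrite sE rootZ ?root_prod_XsubC //.
  by rewrite (monicP (char_poly_monic M)) oner_neq0.
have ds : d \in s.
  rewrite rt -eigenvalue_root_char /eigenvalue /eigenspace kermx_eq0 row_free_unit.
  apply/negP => U; pose z := \col_i v i.
  have : (M - d%:M) *m z = 0.
    apply/matrixP => i l; rewrite mulmxBl mul_scalar_mx !mxE -Mv; apply/eqP.
    by rewrite subr_eq0; apply/eqP/eq_bigr => h _; rewrite mxE.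
  move=> /(congr1 (mulmx (invmx (M - d%:M)))); rewrite mulKmx // mulmx0.
  by move=> /matrixP/(_ (Ordinal r0) 0); rewrite !mxE => /eqP; rewrite gt_eqF.
have sle a : a \in s -> `|a| <= d.
  rewrite rt -eigenvalue_root_char => /eigenvalueP [u uM u0].
  have p0 : 0 < \sum_l `|u 0 l| * v l.
    have g0 l : 0 <= `|u 0 l| * v l by rewrite mulr_ge0 // ltW.
    rewrite lt_def sumr_ge0 // andbT; apply: contra u0; rewrite psumr_eq0 // => /allP H.
    apply/eqP/rowP => l; rewrite [RHS]mxE; apply/eqP.
    have := H l (mem_index_enum _); rewrite mulf_eq0 normr_eq0 => /orP [//|].
    by rewrite gt_eqF.
  rewrite -(ler_pM2r p0) mulr_sumr.
  apply: (@le_trans _ _ (\sum_l \sum_i `|u 0 i| * M i l * v l)).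
    apply: ler_sum => l _; rewrite mulrA -normrM.
    have -> : a * u 0 l = (u *m M) 0 l by rewrite uM mxE.
    rewrite -mulr_suml; apply: ler_wpM2r; first exact: ltW.
    rewrite mxE (le_trans (ler_norm_sum _ _ _)) // ler_sum // => i _.
    by rewrite normrM (ger0_norm (M0 _ _)).
  rewrite exchange_big mulr_sumr ler_sum // => i _.
  under eq_bigr do rewrite -mulrA.
  by rewrite -mulr_sumr Mv mulrCA.
have step (x y : algC) : Num.max x y = x \/ Num.max x y = y.
  by rewrite /Num.max; case: ifP; [right|left].
(* The order of [algC] is partial, so the fold is controlled directly: over any list of roots it
   stays between 0 and [d], and it equals [d] once [d] occurs in the list. *)
suff H : forall t, {subset t <= s} -> let m := \big[Num.max/0]_(a <- t | 0 <= a) a in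
     0 <= m <= d /\ (d \in t -> m = d) by case: (H s) => // _ ->.
elim=> [_|a t IH sub] /=; first by rewrite big_nil lexx d0.
have [/andP [m0 md] mE] : 0 <= \big[Num.max/0]_(a <- t | 0 <= a) a <= d /\
     (d \in t -> \big[Num.max/0]_(a <- t | 0 <= a) a = d).
  by apply: IH => x xt; apply: sub; rewrite inE xt orbT.
rewrite big_cons; case: ifP => a0; last first.
  split; first by rewrite m0.
  by rewrite inE => /orP [/eqP da|//]; move: a0; rewrite -da d0.
have ad : a <= d by rewrite -(ger0_norm a0); apply: sle; apply: sub; rewrite inE eqxx.
move: (\big[Num.max/0]_(a <- t | 0 <= a) a) m0 md mE => m m0 md mE.
split; first by case: (step a m) => // ->; rewrite ?a0 ?m0.
rewrite inE => /orP [/eqP da|/mE ->]; rewrite /Num.max.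
  rewrite -da; case: ifP => // dm; apply/eqP; rewrite eq_le md; exact: ltW.
by case: ifP => // /negbT; rewrite -real_leNgt ?ger0_real // => da; apply/eqP; rewrite eq_le ad.
Qed.

Lemma subf_div (F : fieldType) (a b c d : F) : b != 0 -> d != 0 ->
  a / b - c / d = (a * d - c * b) / (b * d).
Proof. by move=> b0 d0; rewrite -mulNr addf_div // mulNr. Qed.

(** * Integer polynomials over fields of characteristic 0 *)

Section Char0.
Variables (F : fieldType).
Hypothesis F0 : [pchar F] =i pred0.

Lemma natF_eq0 n : ((n%:R : F) == 0) = (n == 0)%N.
Proof. by have /pcharf0P -> := F0. Qed.

Lemma intF_eq0 (z : int) : ((z%:~R : F) == 0) = (z == 0).
Proof.
case: z => n; first by rewrite -pmulrn natF_eq0.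
by rewrite NegzE mulrNz oppr_eq0 -pmulrn natF_eq0.
Qed.

Lemma natF_inj m n : (m%:R : F) = n%:R -> m = n.
Proof.
wlog le : m n / (m <= n)%N => [H E|E].
  by case/orP: (leq_total m n) => /H; [apply|move=> /(_ (esym E))].
apply/eqP; rewrite eqn_leq le -subn_eq0 -natF_eq0 natrB // E subrr; exact: eqxx.
Qed.

(** The embedding of the rationals. The characteristic hypothesis is an argument, so that the ring
    morphism instance can be attached to [ratF F0]. *)
Definition ratF of [pchar F] =i pred0 := fun x : rat => (numq x)%:~R / (denq x)%:~R : F.

Lemma ratFE (a b : int) : b != 0 -> ratF F0 (a%:~R / b%:~R) = a%:~R / b%:~R.
Proof.
move=> b0; set x := _ / _; rewrite /ratF.
apply/eqP; rewrite eqr_div ?intF_eq0 ?denq_neq0 //; apply/eqP.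
rewrite -!intrM; congr (_%:~R); apply: (@intr_inj rat); rewrite !intrM.
apply/eqP; rewrite -eqr_div ?intr_eq0 ?denq_neq0 //.
by rewrite divq_num_den.
Qed.

Lemma ratF_zmod : zmod_morphism (ratF F0).
Proof.
move=> x y; have dx := denq_neq0 x; have dy := denq_neq0 y.
have -> : x - y = (numq x * denq y - numq y * denq x)%:~R / (denq x * denq y)%:~R.
  rewrite -[in LHS](divq_num_den x) -[in LHS](divq_num_den y) rmorphB !rmorphM /=.
  by rewrite subf_div ?intr_eq0.
rewrite ratFE ?mulf_neq0 // /ratF rmorphB !rmorphM /=.
by rewrite subf_div ?intF_eq0.
Qed.

Lemma ratF_monoid : monoid_morphism (ratF F0).
Proof.
split; first by rewrite /ratF divr1.
move=> x y; have dx := denq_neq0 x; have dy := denq_neq0 y.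
have -> : x * y = (numq x * numq y)%:~R / (denq x * denq y)%:~R.
  rewrite -[in LHS](divq_num_den x) -[in LHS](divq_num_den y) !rmorphM /=.
  by rewrite mulf_div.
by rewrite ratFE ?mulf_neq0 // /ratF !rmorphM /= mulf_div.
Qed.
HB.instance Definition _ := GRing.isZmodMorphism.Build rat F (ratF F0) ratF_zmod.
HB.instance Definition _ := GRing.isMonoidMorphism.Build rat F (ratF F0) ratF_monoid.
End Char0.

(* A common root of two integer polynomials all of whose common complex roots lie
   in (0, 1] equals 1: the product of these roots is a positive integer. *)
Lemma common_root_1 (F : fieldType) (F0 : [pchar F] =i pred0) (p1 p2 : {poly int}) (x : F) :
  p2 \is monic -> root (map_poly intr p1) x -> root (map_poly intr p2) x ->
  (forall z : algC, root (map_poly intr p1) z -> root (map_poly intr p2) z -> 0 < z <= 1) ->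
  x = 1.
Proof.
move=> m2 r1 r2 H.
(* Greatest common divisors commute with field extension, so the roots of [g] in [F] and in [algC]
   are exactly the common roots there; this transports information between the two fields. *)
pose g := gcdp (map_poly intr p1 : {poly rat}) (map_poly intr p2).
have mapE (G : fieldType) (f : {rmorphism rat -> G}) (p : {poly int}) :
    map_poly f (map_poly intr p) = map_poly intr p.
  by rewrite -map_poly_comp; apply: eq_map_poly => a; rewrite /= rmorph_int.
have gx : root (map_poly (ratF F0) g) x by rewrite gcdp_map root_gcd !mapE r1.
have p2n0 : (map_poly intr p2 : {poly rat}) != 0.
  by apply/monic_neq0/monic_map.
have g0 : g != 0 by rewrite gcdp_eq0 negb_and p2n0 orbT.
pose g1 := (lead_coef g)^-1 *: g.
have mg1 : g1 \is monic by rewrite monicE lead_coefZ mulVf // lead_coef_eq0.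
have [rs rsE] := closed_field_poly_normal (map_poly (ratr : rat -> algC) g1).
have mono1 : map_poly (ratr : rat -> algC) g1 \is monic by rewrite monic_map.
rewrite (monicP mono1) scale1r in rsE.
have rsP z : z \in rs -> 0 < z <= 1 /\ z \in Aint.
  move=> zrs; have : root (map_poly (ratr : rat -> algC) g1) z by rewrite rsE root_prod_XsubC.
  rewrite map_polyZ rootZ ?fmorph_eq0 ?invr_eq0 ?lead_coef_eq0 //.
  rewrite gcdp_map root_gcd !mapE => /andP [z1 z2]; split; first exact: H.
  apply: (root_monic_Aint z2); first exact: monic_map.
  by apply/polyOverP => i; rewrite coef_map /= rpred_int.
pose c := \prod_(z <- rs) z.
have cA : c \in Aint.
  by rewrite /c big_seq rpred_prod // => z /rsP [].
have c1 : 0 < c <= 1.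
  rewrite /c big_seq; apply: (big_ind (fun c : algC => is_true (0 < c <= 1))); rewrite ?ltr01 ?lexx //.
    by move=> a b /andP [a0 a1] /andP [b0 b1]; rewrite mulr_gt0 //=; apply: mulr_ile1 => //; exact: ltW.
  by move=> z /rsP [].
have cR : c \in Crat.
  have : (map_poly (ratr : rat -> algC) g1).[0] = (-1) ^+ size rs * c.
    rewrite rsE horner_prod /c.
    under eq_bigr do rewrite hornerXsubC sub0r -mulN1r.
    rewrite big_split /= big_const_seq count_predT iter_mulr_1.
    by [].
  rewrite horner_coef0 coef_map /= => E.
  have -> : c = (-1) ^+ size rs * ratr g1`_0 by rewrite E mulrA -exprMn mulrNN mul1r expr1n mul1r.
  by rewrite rpredM ?Crat_rat // rpredX // rpredN rpred1.
have cE : c = 1.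
  have /natrP [n cn] : c \is a Num.nat.
    by rewrite natrEint (Cint_rat_Aint cR cA) ltW //; case/andP: c1.
  by move: c1; rewrite cn ltr0n lern1; case: n {cn} => [|[|n]].
have rs1 z : z \in rs -> z = 1.
  move=> zrs; have := cE; rewrite /c (big_rem z zrs) /=.
  have : 0 < \prod_(y <- rem z rs) y <= 1.
    rewrite big_seq; apply: (big_ind (fun c : algC => is_true (0 < c <= 1))); rewrite ?ltr01 ?lexx //.
      by move=> a b /andP [a0 a1] /andP [b0 b1]; rewrite mulr_gt0 //=; apply: mulr_ile1 => //; exact: ltW.
    by move=> y /mem_rem /rsP [].
  move=> /andP [y0 y1] E; have [/andP [z0 z1] _] := rsP z zrs.
  apply/eqP; rewrite eq_le z1 /= -E; apply: ler_piMr => //; exact: ltW.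
(* Since all complex roots are 1, the rational polynomial [g1] is a power of ['X - 1], and this
   remains true over [F]. *)
have E1 : g1 = ('X - 1) ^+ size rs.
  apply: (map_poly_inj (ratr : rat -> algC)); rewrite rsE rmorphXn rmorphB /= map_polyX rmorph1.
  rewrite big_seq (eq_bigr (fun=> 'X - 1)) => [|z /rs1 -> //].
  by rewrite -big_seq big_const_seq count_predT iter_mulr_1.
have : root (map_poly (ratF F0) g1) x.
  by rewrite map_polyZ rootZ ?fmorph_eq0 ?invr_eq0 ?lead_coef_eq0.
rewrite E1 rmorphXn rmorphB /= map_polyX rmorph1 /root horner_exp !hornerE expf_eq0.
by rewrite subr_eq0 => /andP [_ /eqP].
Qed.

Section Eigen.
Variables (F : fieldType) (r : nat) (B : 'I_r -> 'I_r -> nat).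
Definition natmx : 'M[int]_r := \matrix_(i, l) (B i l)%:Z.

Lemma eigen_root (w : 'I_r -> F) x i0 : w i0 != 0 ->
  (forall i, \sum_l (B i l)%:R * w l = x * w i) ->
  root (map_poly intr (char_poly natmx)) x.
Proof.
move=> wi0 Bw; rewrite map_char_poly -eigenvalue_root_char /eigenvalue /eigenspace.
rewrite kermx_eq0 row_free_unit; apply/negP => U; pose z := \col_i w i.
set A := _ - _ in U.
have : A *m z = 0.
  apply/matrixP => i l; rewrite mulmxBl mul_scalar_mx !mxE -Bw; apply/eqP.
  by rewrite subr_eq0; apply/eqP/eq_bigr => h _; rewrite !mxE.
move=> /(congr1 (mulmx (invmx A))); rewrite mulKmx // mulmx0.
by move=> /matrixP/(_ i0 0); rewrite !mxE => /eqP; rewrite (negPf wi0).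
Qed.

Lemma root_eigen x : (forall i l, B i l = B l i) -> root (map_poly intr (char_poly natmx)) x ->
  exists (w : 'I_r -> F) i0, w i0 != 0 /\ forall i, \sum_l (B i l)%:R * w l = x * w i.
Proof.
move=> Bs; rewrite map_char_poly -eigenvalue_root_char => /eigenvalueP [u uB u0].
have /existsP [i Hi] : [exists i, u 0 i != 0].
  apply: contraT; rewrite negb_exists => /forallP H; case/eqP: u0.
  by apply/rowP => i; rewrite [RHS]mxE; apply/eqP; have := H i; rewrite negbK.
exists (fun i => u 0 i), i; split => // l.
have -> : x * u 0 l = (u *m map_mx intr natmx) 0 l by rewrite uB mxE.
by rewrite mxE; apply: eq_bigr => h _; rewrite !mxE Bs mulrC.
Qed.
End Eigen.

Lemma root_int (F : fieldType) (p : {poly int}) (z : int) :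
  [pchar F] =i pred0 -> root (map_poly intr p) (z%:~R : F) = root p z.
Proof.
by move=> F0; rewrite /root horner_map /= intF_eq0.
Qed.

(** * Fusion rings *)

Section FusionRing.
Variables (r : nat) (N : 'I_r -> 'I_r -> 'I_r -> nat) (star : 'I_r -> 'I_r) (i0 : 'I_r).
Hypotheses (N1 : forall j l, N i0 j l = (j == l)) (NC : forall i j l, N i j l = N j i l).
Hypothesis NA : forall i j l p, (\sum_m N i j m * N m l p = \sum_m N j l m * N i m p)%N.
Hypotheses (ND : forall i j l, N i j l = N (star i) l j) (starK : involutive star).

Lemma N_conj i j l : N (star i) (star j) (star l) = N i j l.
Proof.
by rewrite [RHS]ND [RHS]NC [RHS]ND [RHS]NC [RHS]ND [RHS]NC.
Qed.

Lemma star1 : star i0 = i0.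
Proof. by have := ND i0 i0 i0; rewrite N1 eqxx NC N1; case: eqP. Qed.

Lemma N_unit i j : N i j i0 = (star i == j) :> nat.
Proof. by rewrite ND NC N1. Qed.

(* Matrix of multiplication by the Casimir element \sum_a X_a X_a^*. *)
Definition cas i l := (\sum_a \sum_m N a i m * N (star a) m l)%N.

Lemma cas_sym i l : cas i l = cas l i.
Proof.
apply: eq_bigr => a _; apply: eq_bigr => m _.
by rewrite mulnC [N a i m]ND [N (star a) m l]ND starK.
Qed.

Lemma cas_unit l : cas i0 l = (\sum_a N (star a) a l)%N.
Proof.
apply: eq_bigr => a _; rewrite (bigD1 a) //= NC N1 eqxx mul1n big1 ?addn0 // => m ma.
by rewrite NC N1 eq_sym (negPf ma).
Qed.

Lemma cas_unit_gt0 a l : (0 < N (star a) a l)%N -> (0 < cas i0 l)%N.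
Proof. by rewrite cas_unit (bigD1 a) //= => h; rewrite addn_gt0 h. Qed.

Definition is_char (F : nzRingType) (c : 'I_r -> F) :=
  c i0 = 1 /\ forall i j, \sum_l (N i j l)%:R * c l = c i * c j.

Lemma cas_char (F : comNzRingType) (c : 'I_r -> F) i : is_char c ->
  \sum_l (cas i l)%:R * c l = (\sum_a c a * c (star a)) * c i.
Proof.
move=> [_ H]; rewrite mulr_suml.
under eq_bigr => l _ do rewrite /cas natr_sum mulr_suml.
rewrite exchange_big; apply: eq_bigr => a _ /=.
under eq_bigr => l _ do rewrite natr_sum mulr_suml.
rewrite exchange_big /= mulrAC -H mulr_suml; apply: eq_bigr => m _.
by rewrite -mulrA [c m * _]mulrC -H mulr_sumr; apply: eq_bigr => l _; rewrite natrM mulrA.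
Qed.

(** By [ND] the Casimir matrix is the sum over [a] of a fusion matrix times its transpose, a sum of
    squares in which the unit contributes the identity. Hence its eigenvalues are at least 1. *)
Lemma cas_pos (w : 'I_r -> algC) : 
  \sum_i `|w i| ^+ 2 <= \sum_i (w i)^* * \sum_l (cas i l)%:R * w l.
Proof.
have E : \sum_i (w i)^* * \sum_l (cas i l)%:R * w l
   = \sum_a \sum_m `|\sum_l (N (star a) m l)%:R * w l| ^+ 2.
  transitivity (\sum_i \sum_a \sum_m ((N a i m)%:R * (w i)^* ) * \sum_l (N (star a) m l)%:R * w l).
    apply: eq_bigr => i _; rewrite mulr_sumr.
    under eq_bigr => l _ do rewrite /cas natr_sum mulr_suml mulr_sumr.
    rewrite exchange_big; apply: eq_bigr => a _ /=.
    under eq_bigr => l _ do rewrite natr_sum mulr_suml mulr_sumr.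
    rewrite exchange_big; apply: eq_bigr => m _ /=.
    by rewrite mulr_sumr; apply: eq_bigr => l _; rewrite natrM; ring.
  rewrite exchange_big; apply: eq_bigr => a _ /=; rewrite exchange_big; apply: eq_bigr => m _ /=.
  rewrite normCK -mulr_suml mulrC; congr (_ * _); rewrite rmorph_sum; apply: eq_bigr => i _.
  by rewrite rmorphM /= conjC_nat ND.
rewrite E [X in _ <= X](bigD1 i0) //= -[X in X <= _]addr0 lerD //; last first.
  by apply: sumr_ge0 => a _; apply: sumr_ge0 => m _; rewrite exprn_ge0.
rewrite ler_sum // => m _; rewrite (bigD1 m) //= star1 N1 eqxx mul1r big1 ?addr0 // => l lm.
by rewrite N1 eq_sym (negPf lm) mul0r.
Qed.

(** [A] is multiplication by the sum of all simple objects. Its Perron eigenspace is one-dimensional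
    by [dirichlet] and stable under every [N i], which commutes with [A]; so the Perron vector,
    normalised to 1 at the unit, is a character. *)
Lemma fp_exists : exists v : 'I_r -> algC, (forall i, 0 < v i) /\ is_char v.
Proof.
have r0 : (0 < r)%N by apply: leq_ltn_trans (ltn_ord i0).
pose A : 'M[algC]_r := \matrix_(j, l) (\sum_i N i j l)%:R.
(* Were the entry zero, the product of [star j] and [l] would be zero. Multiplied by [j] it contains
   [l], because [j] times [star j] contains the unit. *)
have A0 j l : 0 < A j l.
  rewrite mxE ltr0n lt0n; apply/eqP => Z.
  have Z' i : N (star j) l i = 0%N.
    by move/eqP: Z; rewrite sum_nat_eq0 => /forallP/(_ i)/eqP; rewrite NC ND.
  have := NA j (star j) l l; rewrite [RHS]big1 => [|m _]; last by rewrite Z'.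
  by rewrite (bigD1 i0) //= N_unit N1 !eqxx.
have At : A^T = A.
  apply/matrixP => j l; rewrite !mxE; congr (_%:R).
  rewrite (reindex_inj (inv_inj starK)); apply: eq_bigr => i _ /=.
  by rewrite [RHS]ND.
have [u [mu [u0 mu0 uA]]] := perron r0 A0 At.
have uA' w : (forall j, \sum_l A j l * w l = mu * w j) -> forall j, w j = w i0 / u 0 i0 * u 0 j.
  move=> wA j; have H i : \sum_l A i l * u 0 l = mu * u 0 i.
    have -> : mu * u 0 i = (u *m A) 0 i by rewrite uA mxE.
    by rewrite mxE; apply: eq_bigr => l _; rewrite -[in LHS]At mxE mulrC.
  have As i l : A i l = A l i by rewrite -[in LHS]At mxE.
  have := @dirichlet _ _ A (fun i => u 0 i) w mu (fun i l => ltW (A0 i l)) As u0 (gtr0_real mu0) H wA j i0 (A0 _ _).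
  by move=> <-; rewrite mulfVK // gt_eqF.
have uE j : \sum_l A j l * u 0 l = mu * u 0 j.
  have -> : mu * u 0 j = (u *m A) 0 j by rewrite uA mxE.
  by rewrite mxE; apply: eq_bigr => l _; rewrite -[in LHS]At mxE mulrC.
pose v i := u 0 i / u 0 i0.
have v0 i : 0 < v i by rewrite divr_gt0.
exists v; split => //; split; first by rewrite /v mulfV // gt_eqF.
move=> i j.
have H j' : \sum_l A j' l * (\sum_p (N i l p)%:R * u 0 p) = mu * \sum_p (N i j' p)%:R * u 0 p.
  transitivity (\sum_l (N i j' l)%:R * \sum_p A l p * u 0 p); last first.
    by rewrite mulr_sumr; apply: eq_bigr => l _; rewrite uE; ring.
  under eq_bigr => l _ do rewrite mulr_sumr.
  rewrite exchange_big.
  under [RHS]eq_bigr => l _ do rewrite mulr_sumr.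
  rewrite [RHS]exchange_big; apply: eq_bigr => p _ /=.
  under eq_bigr => l _ do rewrite mulrA.
  under [RHS]eq_bigr => l _ do rewrite mulrA.
  rewrite -!mulr_suml; congr (_ * _).
  under eq_bigr => l _ do rewrite mxE -natrM.
  under [RHS]eq_bigr => l _ do rewrite mxE -natrM.
  rewrite -!natr_sum; congr (_%:R).
  under eq_bigr => l _ do rewrite big_distrl.
  under [RHS]eq_bigr => l _ do rewrite big_distrr.
  rewrite exchange_big [RHS]exchange_big; apply: eq_bigr => a _ /=.
  under eq_bigr => l _ do rewrite [N i l p]NC.
  by rewrite NA; apply: eq_bigr => l _; rewrite [N j' i l]NC.
have E0 : \sum_p (N i i0 p)%:R * u 0 p = u 0 i.
  rewrite (bigD1 i) //= NC N1 eqxx mul1r big1 ?addr0 // => l li.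
  by rewrite NC N1 eq_sym (negPf li) mul0r.
have := uA' _ H j; rewrite E0.
rewrite /v => E; transitivity ((\sum_p (N i j p)%:R * u 0 p) / u 0 i0).
  by rewrite mulr_suml; apply: eq_bigr => p _; rewrite mulrA.
by rewrite E; ring.
Qed.

Lemma N_mx_charE (v : 'I_r -> algC) i : (forall i, 0 < v i) -> is_char v ->
  max_eigenvalue (\matrix_(j, l) (N i j l)%:R) = v i.
Proof.
move=> v0 [_ vM]; apply: (max_eigenvalue_perron (v := v)) => //.
- exact: leq_ltn_trans (ltn_ord i0).
- by move=> j l; rewrite mxE ler0n.
- exact: ltW.
by move=> j; rewrite -vM; apply: eq_bigr => l _; rewrite mxE.
Qed.

Section FP.
Variable v : 'I_r -> algC.
Hypotheses (v0 : forall i, 0 < v i) (vc : is_char v).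

(** [N (star i)] is the transpose of [N i] and [v] is an eigenvector of both; pairing with [v]
    equates the eigenvalues. *)
Lemma v_star i : v (star i) = v i.
Proof.
have vM := vc.2.
have p0 : 0 < \sum_j v j * v j.
  by rewrite (bigD1 i0) //= ltr_wpDr ?mulr_gt0 // sumr_ge0 // => j _; rewrite mulr_ge0 // ltW.
have pn : \sum_j v j * v j != 0 by rewrite gt_eqF.
apply: (mulIf pn); rewrite !mulr_sumr.
transitivity (\sum_j \sum_l (N (star i) j l)%:R * v l * v j).
  by apply: eq_bigr => j _; rewrite mulrA -vM mulr_suml.
rewrite exchange_big; apply: eq_bigr => l _ /=.
rewrite mulrA -vM mulr_suml; apply: eq_bigr => j _.
by rewrite [N i l j]ND; ring.
Qed.

Definition fpdim := \sum_i v i ^+ 2.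

Lemma cas_v i : \sum_l (cas i l)%:R * v l = fpdim * v i.
Proof.
rewrite cas_char //; congr (_ * _); apply: eq_bigr => a _.
by rewrite v_star expr2.
Qed.

Lemma fpdim_gt0 : 0 < fpdim.
Proof.
rewrite /fpdim (bigD1 i0) //= ltr_wpDr ?exprn_gt0 // sumr_ge0 // => i _.
by rewrite exprn_ge0 // ltW.
Qed.

(** The lower bound is [cas_pos] tested on an eigenvector. The upper bound pairs its absolute values
    with [v], a positive eigenvector for [fpdim] by [cas_v]. *)
Lemma cas_root (z : algC) : root (map_poly intr (char_poly (natmx cas))) z -> 1 <= z <= fpdim.
Proof.
move=> /(root_eigen cas_sym) [w [j [wj wM]]].
have nw : 0 < \sum_i `|w i| ^+ 2.
  rewrite (bigD1 j) //= ltr_wpDr ?exprn_gt0 ?normr_gt0 // sumr_ge0 // => i _.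
  by rewrite exprn_ge0.
have := cas_pos w.
under [X in _ <= X]eq_bigr => i _ do rewrite wM mulrCA [_^* * _]mulrC -normCK.
rewrite -mulr_sumr -[X in X <= _]mul1r ler_pM2r // => z1; rewrite z1 /=.
have z0 : 0 <= z := le_trans ler01 z1.
have p0 : 0 < \sum_l `|w l| * v l.
  rewrite (bigD1 j) //= ltr_wpDr ?mulr_gt0 ?normr_gt0 // sumr_ge0 // => i _.
  by rewrite mulr_ge0 // ltW.
rewrite -(ler_pM2r p0) mulr_sumr.
apply: (@le_trans _ _ (\sum_l \sum_i (cas l i)%:R * `|w i| * v l)).
  apply: ler_sum => l _; rewrite mulrA -{1}(ger0_norm z0) -normrM -wM -mulr_suml.
  apply: ler_wpM2r; first exact: ltW.
  rewrite (le_trans (ler_norm_sum _ _ _)) // ler_sum // => i _.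
  by rewrite normrM normr_nat.
rewrite exchange_big mulr_sumr ler_sum // => i _ /=.
rewrite (eq_bigr (fun l => `|w i| * ((cas i l)%:R * v l))) => [|l _].
  by rewrite -mulr_sumr cas_v mulrCA.
by rewrite cas_sym; ring.
Qed.

Lemma v_sq a : v a ^+ 2 = \sum_l (N (star a) a l)%:R * v l.
Proof. by rewrite vc.2 v_star expr2. Qed.

Variable Dn : nat.
Hypothesis HD : fpdim = Dn%:R.

Lemma ker_rational (F : fieldType) (f : {rmorphism rat -> F}) (w : 'I_r -> F) :
  (forall i, \sum_l (cas i l)%:R * w l = Dn%:R * w i) ->
  exists x : 'rV[F]_r,
    \row_l w l = x *m map_mx f (kermx (map_mx intr (natmx cas) - Dn%:R%:M)).
Proof.
move=> wM; apply/submxP; rewrite map_kermx; apply/sub_kermxP/rowP => i.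
rewrite map_mxB map_scalar_mx rmorph_nat mulmxBr mul_mx_scalar !mxE -wM.
apply/eqP; rewrite subr_eq0; apply/eqP/eq_bigr => l _.
by rewrite !mxE -[X in w l * X]/(f (cas l i)%:Z%:~R) rmorph_int -pmulrn cas_sym mulrC.
Qed.

(** Since [Dn] is an integer, its eigenspace is spanned by the rational rows of [K]. By [dirichlet]
    each row is proportional to [v] on the indices with [0 < cas i0 l], the constituents of the
    products of [star a] and [a]. So the same rational ratios [c] serve every eigenvector for [Dn]
    over every extension of the rationals, in particular over [k]. *)
Lemma ad_rational : exists c : 'I_r -> rat,
  (forall l, (0 < cas i0 l)%N -> v l = ratr (c l)) /\
  forall (F : fieldType) (f : {rmorphism rat -> F}) (w : 'I_r -> F),
    (forall i, \sum_l (cas i l)%:R * w l = Dn%:R * w i) ->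
    forall l, (0 < cas i0 l)%N -> w l = w i0 * f (c l).
Proof.
move KE : (kermx (map_mx intr (natmx cas) - Dn%:R%:M : 'M[rat]_r)) => K.
have vM i : \sum_l (cas i l)%:R * v l = Dn%:R * v i by rewrite cas_v HD.
have KM a i : \sum_l (cas i l)%:R * (ratr (K a l) : algC) = Dn%:R * ratr (K a i).
  have : (K *m (map_mx intr (natmx cas) - Dn%:R%:M)) a i = 0 by rewrite -KE mulmx_ker mxE.
  rewrite mulmxBr mul_mx_scalar !mxE => /eqP; rewrite subr_eq0 => /eqP E.
  rewrite -[Dn%:R](ratr_nat algC) -rmorphM -E rmorph_sum; apply: eq_bigr => l _.
  by rewrite !mxE rmorphM /= ratr_int cas_sym mulrC.
have KD a l : (0 < cas i0 l)%N -> (ratr (K a l) : algC) = v l * ratr (K a i0).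
  move=> cl; have := @dirichlet _ _ (fun i l => (cas i l)%:R : algC) v (fun l => ratr (K a l)) Dn%:R.
  move=> /(_ (fun i l => ler0n _ _)) /(_ _ v0 (realn _ _) vM (KM a) i0 l).
  rewrite ltr0n vc.1 divr1 => -> //; last by move=> i l'; rewrite cas_sym.
  by rewrite mulrC mulfVK // gt_eqF.
have [x xE] := ker_rational (ratr : {rmorphism rat -> algC}) vM; rewrite KE in xE.
have /existsP [a Ka] : [exists a, K a i0 != 0].
  apply: contraT; rewrite negb_exists => /forallP H.
  have := congr1 (fun y : 'rV__ => y 0 i0) xE; rewrite !mxE vc.1 big1 => [/eqP|i _].
    by rewrite oner_eq0.
  by rewrite mxE; have := H i; rewrite negbK => /eqP ->; rewrite rmorph0 mulr0.
have ra : (ratr (K a i0) : algC) != 0 by rewrite fmorph_eq0.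
exists (fun l => K a l / K a i0).
have H1 l : (0 < cas i0 l)%N -> v l = ratr (K a l / K a i0).
  move=> cl; apply: (etrans _ (esym (fmorph_div (ratr : {rmorphism rat -> algC}) _ _))).
  by rewrite /= KD // mulfK.
split=> // F f w wM l cl.
have [y yE] := ker_rational f wM; rewrite KE in yE.
have := congr1 (fun y : 'rV__ => y 0 l) yE; have := congr1 (fun y : 'rV__ => y 0 i0) yE.
rewrite !mxE => -> ->; rewrite mulr_suml; apply: eq_bigr => b _; rewrite !mxE.
rewrite -mulrA -rmorphM; congr (_ * f _); apply: (fmorph_inj (ratr : {rmorphism rat -> algC})).
apply: (etrans (KD b l cl)); rewrite (H1 l cl) mulrC.
exact: (esym (rmorphM (ratr : {rmorphism rat -> algC}) _ _)).
Qed.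

(** By [v_sq] and [ad_rational] the square is rational, and [v a] is an eigenvalue of the integer
    matrix [N a]; a rational algebraic integer is an integer. *)
Lemma v_sq_nat a : exists n : nat, v a ^+ 2 = n%:R.
Proof.
have [c [cv _]] := ad_rational.
have R : v a ^+ 2 \in Crat.
  rewrite v_sq rpred_sum // => l _; case: (posnP (N (star a) a l)) => [->|n0].
    by rewrite mul0r rpred0.
  by rewrite (cv l (cas_unit_gt0 n0)) rpredM ?Crat_rat // rpred_nat.
have I : v a \in Aint.
  have rt : root (map_poly intr (char_poly (natmx (N a)))) (v a).
    apply: (@eigen_root _ _ _ v _ i0); first by rewrite gt_eqF.
    by move=> i; rewrite vc.2.
  apply: (root_monic_Aint rt); first by rewrite monic_map // char_poly_monic.
  by apply/polyOverP => i; rewrite coef_map /= rpred_int.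
have /natrP [n nE] : v a ^+ 2 \is a Num.nat.
  by rewrite natrEint (Cint_rat_Aint R) ?rpredX // exprn_ge0 // ltW.
by exists n.
Qed.

(** * Characters from the S-matrix and the global dimension *)

Section SData.
Variables (k : fieldType) (lam : 'I_r -> 'I_r -> k) (d : 'I_r -> k).
Hypothesis k0 : [pchar k] =i pred0.
Hypotheses (S1 : forall i, is_char (lam i)) (S2 : forall i l, d i * lam i l = d l * lam l i).
Hypotheses (S3 : lam i0 = d) (d0 : forall i, d i != 0) (dstar : forall i, d (star i) = d i).
Hypothesis S4 : forall i, (forall l, lam i l = d l) -> \sum_l d l ^+ 2 != 0 -> i = i0.
Let dimC := \sum_l d l ^+ 2.

Lemma d_char : is_char d. Proof. by rewrite -S3. Qed.

Lemma cas_d i : \sum_l (cas i l)%:R * d l = dimC * d i.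
Proof.
rewrite (cas_char _ d_char); congr (_ * _); apply: eq_bigr => a _.
by rewrite dstar expr2.
Qed.

Lemma cas_rootF (z : int) : root (map_poly intr (char_poly (natmx cas))) (z%:~R : k) ->
  1 <= (z%:~R : algC) <= fpdim.
Proof.
rewrite root_int // => h; apply: cas_root; rewrite root_int //; exact: pchar_num.
Qed.

(** [dimC] is an eigenvalue of the Casimir matrix. If it vanished in [k], then 0 would be a root of
    the integer characteristic polynomial over the complex numbers too, where all roots are at least
    1. *)
Lemma dimC_neq0 : dimC != 0.
Proof.
apply/eqP => D0; have := @cas_rootF 0; rewrite !mulr0z.
have -> : root (map_poly intr (char_poly (natmx cas))) (0 : k).
  by apply: (eigen_root (d0 i0)) => i; rewrite cas_d D0.
by case/(_ isT)/andP; rewrite ler10.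
Qed.

(** Multiplication by [l] acts on the sum both as [lam i l] and as [d l]. If the sum is nonzero, row
    [i] equals the row of dimensions and [S4] identifies [i] with the unit. *)
Lemma killing i : \sum_l d l * lam i l = (i == i0)%:R * dimC.
Proof.
case: eqVneq => [->|ni].
  by rewrite mul1r S3; apply: eq_bigr => l _; rewrite expr2.
rewrite mul0r; apply/eqP; apply: contraNT ni => s0; apply/eqP; apply: S4; last exact: dimC_neq0.
move=> l; apply: (mulIf s0); rewrite -[d l]dstar !mulr_sumr.
transitivity (\sum_m \sum_p d m * ((N l m p)%:R * lam i p)).
  by apply: eq_bigr => m _; rewrite mulrCA -(S1 i).2 mulr_sumr.
rewrite exchange_big; apply: eq_bigr => p _ /=.
rewrite mulrA -d_char.2 mulr_suml; apply: eq_bigr => m _.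
by rewrite ND; ring.
Qed.

Lemma s_orth j l : \sum_y (d j * lam j y) * (d (star l) * lam (star l) y) = (j == l)%:R * dimC.
Proof.
transitivity (\sum_y \sum_m (N j (star l) m)%:R * (d m * (d y * lam m y))).
  apply: eq_bigr => y _; rewrite (S2 j) (S2 (star l)).
  transitivity (d y * d y * (lam y j * lam y (star l))); first by ring.
  rewrite -(S1 y).2 mulr_sumr; apply: eq_bigr => m _.
  by rewrite [X in _ = _ * X]mulrCA S2; ring.
rewrite exchange_big /=.
under eq_bigr => m _ do rewrite -!mulr_sumr killing.
rewrite (bigD1 i0) //= eqxx big1 => [|m /negPf ->]; last by rewrite mul0r !mulr0.
by rewrite N_unit d_char.1 mul1r addr0 (inj_eq (inv_inj starK)) mul1r.
Qed.

Lemma lam_inj j l : lam j = lam l -> j = l.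
Proof.
move=> E; have := s_orth j l; have := s_orth l l; rewrite eqxx E mul1r.
case: eqVneq => // _; rewrite mul0r.
under eq_bigr do rewrite -mulrA; under [X in _ -> X = _ -> _]eq_bigr do rewrite -mulrA.
rewrite -!mulr_sumr => H /eqP; rewrite mulf_eq0 (negPf (d0 j)) /= => /eqP H0.
by move: H; rewrite H0 mulr0 => /esym/eqP; rewrite (negPf dimC_neq0).
Qed.

Definition codeg j := \sum_a lam j a * lam j (star a).

Lemma lam_orth j l : j != l -> \sum_y lam j (star y) * lam l y = 0.
Proof.
move=> jl; have [z nz] : exists z, lam j z != lam l z.
  apply/existsP; apply: contraR jl; rewrite negb_exists => /forallP H.
  apply/eqP/lam_inj/functional_extensionality_dep => z; apply/eqP.
  by have := H z; rewrite negbK.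
apply/eqP; rewrite -subr_eq0 in nz; apply: contraNT nz => s0; apply/eqP; apply: (mulIf s0).
rewrite mul0r mulrBl; apply/eqP; rewrite subr_eq0; apply/eqP; rewrite !mulr_sumr.
transitivity (\sum_y \sum_m (N z (star y) m)%:R * lam j m * lam l y).
  by apply: eq_bigr => y _; rewrite mulrA -(S1 j).2 mulr_suml.
rewrite exchange_big (reindex_inj (inv_inj starK)); apply: eq_bigr => m _ /=.
rewrite mulrCA -(S1 l).2 mulr_sumr; apply: eq_bigr => y _.
rewrite -[N z m y]N_conj [N (star z) _ _]ND starK; ring.
Qed.

(** Weighted by [d l ^+ 2], the characters add up to the functional that reads off the coefficient
    of the unit, times [dimC]. This is the inversion formula behind [codegE] and [root_codeg]. *)
Lemma tau_sum y : \sum_l d l ^+ 2 * lam l y = (y == i0)%:R * dimC.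
Proof.
transitivity (d y * \sum_l d l * lam y l).
  by rewrite mulr_sumr; apply: eq_bigr => l _; rewrite expr2 -mulrA S2 mulrCA.
by rewrite killing; case: eqVneq => [->|_]; rewrite ?d_char.1 ?mul1r // !mul0r mulr0.
Qed.

Lemma codegE j : d j ^+ 2 * codeg j = dimC.
Proof.
have := tau_sum; move=> H.
transitivity (\sum_l d l ^+ 2 * \sum_y lam j (star y) * lam l y).
  rewrite [RHS](bigD1 j) //= [X in _ + X]big1 ?addr0 => [|l lj]; last first.
    by rewrite lam_orth 1?eq_sym // mulr0.
  by congr (_ * _); apply: eq_bigr => a _; rewrite mulrC.
under eq_bigr do rewrite mulr_sumr.
rewrite exchange_big /=.
under eq_bigr => y _.
  rewrite (eq_bigr (fun l => lam j (star y) * (d l ^+ 2 * lam l y))); last by move=> l _; rewrite mulrCA.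
  rewrite -mulr_sumr H; over.
rewrite (bigD1 i0) //= eqxx big1 => [|m /negPf ->]; last by rewrite mul0r mulr0.
by rewrite star1 (S1 j).1 !mul1r addr0.
Qed.

Lemma cas_lam j i : \sum_l (cas i l)%:R * lam j l = codeg j * lam j i.
Proof. exact: cas_char (S1 j). Qed.

(** [h j] pairs an eigenvector [w] with the [j]-th character, on which the Casimir element acts by
    [codeg j]. If every [h j] vanished, the inversion formula [tau_sum] would give [w = 0]. *)
Lemma root_codeg x : root (map_poly intr (char_poly (natmx cas))) x -> exists j, x = codeg j.
Proof.
move=> /(root_eigen cas_sym) [w [i1 [wi wM]]].
pose h j := \sum_i lam j i * w i.
have fh j : codeg j * h j = x * h j.
  transitivity (\sum_i lam j i * \sum_l (cas i l)%:R * w l); last first.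
    by rewrite mulr_sumr; apply: eq_bigr => i _; rewrite wM mulrCA.
  under [RHS]eq_bigr do rewrite mulr_sumr.
  rewrite exchange_big mulr_sumr; apply: eq_bigr => l _ /=.
  rewrite mulrA -cas_lam mulr_suml; apply: eq_bigr => i _.
  by rewrite cas_sym; ring.
suff /existsP [j hj] : [exists j, h j != 0] by exists j; apply: (mulIf hj); rewrite fh.
apply: contraT; rewrite negb_exists => /forallP H; case/negP: wi.
suff : \sum_j d j ^+ 2 * lam j (star i1) * h j = w i1 * dimC.
  rewrite big1 => [/esym/eqP|j _]; first by rewrite mulf_eq0 (negPf dimC_neq0) orbF.
  by have := H j; rewrite negbK => /eqP ->; rewrite mulr0.
rewrite /h; under eq_bigr do rewrite mulr_sumr.
rewrite exchange_big /=.
transitivity (\sum_i w i * \sum_m (N (star i1) i m)%:R * ((m == i0)%:R * dimC)).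
  apply: eq_bigr => i _.
  transitivity (w i * \sum_l d l ^+ 2 * (lam l (star i1) * lam l i)).
    by rewrite mulr_sumr; apply: eq_bigr => l _; ring.
  congr (_ * _); under [RHS]eq_bigr => m _ do rewrite -tau_sum mulr_sumr.
  rewrite exchange_big; apply: eq_bigr => l _ /=; rewrite -(S1 l).2 mulr_sumr.
  by apply: eq_bigr => m _; ring.
rewrite (bigD1 i1) //= [X in _ + X]big1 ?addr0 => [|i ii].
  rewrite (bigD1 i0) //= eqxx N_unit starK eqxx big1 => [|m /negPf ->].
    by rewrite addr0 !mul1r.
  by rewrite mul0r mulr0.
rewrite (bigD1 i0) //= N_unit starK eq_sym (negPf ii) mul0r add0r big1 ?mulr0 // => m /negPf ->.
by rewrite mul0r mulr0.
Qed.

Lemma dimCE : dimC = Dn%:R.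
Proof.
have rD : root (map_poly intr (char_poly (natmx cas))) (Dn%:R : k).
  have -> : (Dn%:R : k) = Dn%:Z%:~R by [].
  rewrite root_int // -(@root_int algC); last exact: pchar_num.
  by apply: (@eigen_root _ _ _ v _ i0); [rewrite gt_eqF|move=> i; rewrite cas_v HD].
have [j jE] := root_codeg rD.
have Dn0 : (0 < Dn)%N by rewrite -(ltr0n algC) -HD fpdim_gt0.
suff d1 : d j ^+ 2 = 1 by rewrite -(codegE j) d1 mul1r.
pose B2 a l := (\sum_m N j a m * N j m l)%N.
(* The unknown is [x = d j ^+ 2], and [Dn%:R * x] is the Casimir eigenvalue [dimC]: this is the
   first polynomial. The second, monic one comes from the square of [N j], which has eigenvalue [x].
   Over [algC] a root [z] of the first satisfies [1 <= Dn%:R * z <= Dn%:R]. *)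
apply: (@common_root_1 k k0 ((char_poly (natmx cas)) \Po (Dn%:Z *: 'X)) (char_poly (natmx B2))).
- exact: char_poly_monic.
- rewrite map_comp_poly /root horner_comp map_polyZ map_polyX /= hornerZ hornerX.
  have -> : Dn%:R * d j ^+ 2 = dimC by rewrite jE mulrC codegE.
  by apply: (eigen_root (d0 i0)) => i; rewrite cas_d.
- apply: (eigen_root (d0 i0)) => i; rewrite expr2 -mulrA -d_char.2 mulr_sumr.
  under eq_bigr => l _ do rewrite /B2 natr_sum mulr_suml.
  rewrite exchange_big; apply: eq_bigr => m _ /=; rewrite mulrCA -d_char.2 mulr_sumr.
  by apply: eq_bigr => l _; rewrite natrM mulrA.
move=> z; rewrite map_comp_poly /root horner_comp map_polyZ map_polyX /= hornerZ hornerX => r1 _.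
have /andP [z1 z2] := cas_root r1.
have D0 : 0 < (Dn%:R : algC) by rewrite ltr0n.
apply/andP; split; first by rewrite -(pmulr_rgt0 _ D0); exact: lt_le_trans ltr01 z1.
by rewrite -(ler_pM2l D0) mulr1; apply: le_trans z2 _; rewrite HD.
Qed.

(** By [dimCE], [d] is an eigenvector for [Dn], so [ad_rational] writes both squares as the same
    rational number. Moreover [Dn / n] is the formal codegree of [i], a rational eigenvalue of an
    integer matrix, hence an integer. *)
Lemma dims_sq i : exists n : nat, [/\ v i ^+ 2 = n%:R, d i ^+ 2 = n%:R & n %| Dn]%N.
Proof.
have [n nE] := v_sq_nat i.
have [c [cv cw]] := ad_rational.
have dE : d i ^+ 2 = n%:R.
  have -> : d i ^+ 2 = \sum_l (N (star i) i l)%:R * d l by rewrite d_char.2 dstar expr2.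
  have cE : \sum_l (N (star i) i l)%:R * c l = n%:R.
    apply: (fmorph_inj (ratr : {rmorphism rat -> algC})); rewrite rmorph_nat -nE v_sq rmorph_sum.
    apply: eq_bigr => l _; rewrite rmorphM rmorph_nat /=.
    by case: (posnP (N (star i) i l)) => [->|n0]; rewrite ?mul0r // (cv l (cas_unit_gt0 n0)).
  rewrite -(rmorph_nat (ratF k0)) -cE rmorph_sum; apply: eq_bigr => l _; rewrite rmorphM rmorph_nat /=.
  case: (posnP (N (star i) i l)) => [->|n0]; rewrite ?mul0r //; congr (_ * _).
  rewrite (cw _ (ratF k0) d) ?d_char.1 ?mul1r // ?(cas_unit_gt0 n0) // => a.
  by rewrite cas_d dimCE.
exists n; split => //.
have n0 : (n != 0)%N by rewrite -(natF_eq0 k0) -dE expf_eq0 (negPf (d0 i)) andbF.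
pose y : rat := Dn%:R / n%:R.
have fy : ratF k0 y = codeg i.
  have nk : (n%:R : k) != 0 by rewrite natF_eq0.
  by apply: (mulfI nk); rewrite -{2}dE codegE dimCE fmorph_div !rmorph_nat mulrC mulfVK.
have rt : root (map_poly intr (char_poly (natmx cas))) (ratr y : algC).
  have mapE (G : fieldType) (f : {rmorphism rat -> G}) (p : {poly int}) :
      map_poly f (map_poly intr p) = map_poly intr p.
    by rewrite -map_poly_comp; apply: eq_map_poly => a; rewrite /= rmorph_int.
  rewrite -(mapE _ (ratr : {rmorphism rat -> algC})) fmorph_root -(fmorph_root (ratF k0)) mapE.
  have E z : z = codeg i -> root (map_poly intr (char_poly (natmx cas))) z.
    move=> ->; apply: (@eigen_root _ _ _ (lam i) _ i0); first by rewrite (S1 i).1 oner_neq0.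
    by move=> a; rewrite cas_lam.
  exact: E fy.
have yA : ratr y \in Aint.
  apply: (root_monic_Aint rt); first by rewrite monic_map // char_poly_monic.
  by apply/polyOverP => a; rewrite coef_map /= rpred_int.
have /natrP [m mE] : (ratr y : algC) \is a Num.nat.
  by rewrite natrEint (Cint_rat_Aint (Crat_rat _) yA) ler0q divr_ge0 ?ler0n.
apply/dvdnP; exists m; apply/eqP; rewrite -(eqr_nat algC) natrM -mE fmorph_div !rmorph_nat mulfVK //.
by rewrite pnatr_eq0.
Qed.
End SData.
End FP.
End FusionRing.

(** * Centralizers *)

Section Cen.
Variables (k : fieldType) (C : braided_fusion_cat k).
Implicit Types W X Y Z T S : C.

Definition cen W Z (c : k) := forall T, b2T W Z T = c *: idm _.

Lemma cenP W Z : cen W Z 1 <-> braid Z W ∘ braid W Z = idm (W ⊗ Z).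
Proof.
split=> [H|H T]; last by rewrite b2T_opT H opT1 scale1r.
by apply: opT_one_inj; rewrite -b2T_opT H scale1r opT1.
Qed.

Lemma cen_sym W Z c : cen W Z c -> cen Z W c.
Proof.
move=> H T; apply: (iso_can_r (f := brTi W Z T)) => /=.
by rewrite b2TE -compA -b2TE H compZr compm1 compZl comp1m.
Qed.

Lemma cen_tens W X Y a b : cen W X a -> cen W Y b -> cen W (X ⊗ Y) (a * b).
Proof.
move=> HX HY T; apply: (iso_can_l (f := wli W (assoc X Y T))) => /=.
rewrite b2T_tens HY bmapZr wl1 !(compZr, compZl) !compm1 -b2TE HX.
by rewrite compZl comp1m scalerA mulrC.
Qed.

Lemma cen_retract W X Y (i : hom Y X) (p : hom X Y) c :
  p ∘ i = idm Y -> cen W X c -> cen W Y c.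
Proof.
move=> pi H T; have E : (W ◁ (p ▷ T)) ∘ (W ◁ (i ▷ T)) = idm _.
  by rewrite -wlc -wrc pi bmap1 wl1.
rewrite -[LHS]comp1m -E -compA -b2T_r H compZl comp1m compZr E; reflexivity.
Qed.

Lemma cen_iso W X Y c : isomorphic X Y -> cen W X c -> cen W Y c.
Proof. by case=> f; apply: (cen_retract (i := inv f) (p := f)); exact: invK. Qed.

Lemma cen_sum W (I : finType) (s : I -> C) S c :
  direct_sum s S -> (forall i, cen W (s i) c) -> cen W S c.
Proof.
case=> inj [prj [_ _ E]] H T.
rewrite -[LHS]compm1 -[in RHS](wl1 W) -(wl1 W) -(bmap1 _ S T) -E.
rewrite !(bmap_suml, bmap_sumr) comp_sumr scaler_sumr; apply: eq_bigr => i _.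
by rewrite wrc wlc compA b2T_r H compZr compm1 compZl.
Qed.

Lemma cen_one W : cen W one 1.
Proof. by apply: cen_sym => T; rewrite b2T_one scale1r. Qed.

Lemma br_ev W Z T : evT Z (W ⊗ T) ∘ (dual Z ◁ brT W Z T) ∘ brT W (dual Z) (Z ⊗ T) = W ◁ evT Z T.
Proof.
have H := hexr W (dual Z) Z T.
have E1 : evT Z (W ⊗ T) = lunit (W ⊗ T) ∘ (ev Z ▷ (W ⊗ T)) ∘ inv (assoc (dual Z) Z (W ⊗ T)).
  by rewrite evTE.
have E2 : (dual Z ◁ brT W Z T) ∘ brT W (dual Z) (Z ⊗ T)
   = assoc (dual Z) Z (W ⊗ T) ∘ brT W (dual Z ⊗ Z) T ∘ (W ◁ inv (assoc (dual Z) Z T)).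
  by rewrite H -compA -wlc invK wl1 compm1.
rewrite -compA E2 E1 !compA (rw0 (fwdK _)) -(compA _ (ev Z ▷ _)) -brT_r compA lunit_br.
by rewrite evTE /pairT !wlc.
Qed.

Lemma br_co W Z T : brT Z W (dual Z ⊗ T) ∘ (Z ◁ brT (dual Z) W T) ∘ coT Z (W ⊗ T) = W ◁ coT Z T.
Proof.
have H := hexl Z (dual Z) W T.
have E2 : brT Z W (dual Z ⊗ T) ∘ (Z ◁ brT (dual Z) W T)
  = (W ◁ assoc Z (dual Z) T) ∘ brT (Z ⊗ dual Z) W T ∘ inv (assoc Z (dual Z) (W ⊗ T)).
  by rewrite H -compA invK compm1.
rewrite E2 !coTE !compA (rw0 (fwdK _)) -(compA _ (brT _ _ _)) brT_l !compA !wlc.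
rewrite -(compA _ (brT one W T)); congr (_ ∘ _).
apply: (iso_can_l (f := wli W (lunit T))); rewrite /= compA br_lunit invK.
by rewrite -wlc invK wl1.
Qed.

(** Bending expresses the braiding of [dual Z] past [W] through that of [W] past [Z], once [Z]
    centralizes [W]. With [br_ev] the double braiding collapses to a zigzag. *)
Lemma cen_dual W Z : cen W Z 1 -> cen W (dual Z) 1.
Proof.
move=> H T; rewrite scale1r.
have E1 : (Z ◁ brT (dual Z) W T) ∘ coT Z (W ⊗ T) = brT W Z (dual Z ⊗ T) ∘ (W ◁ coT Z T).
  have K : brT W Z (dual Z ⊗ T) ∘ brT Z W (dual Z ⊗ T) = idm _.
    by rewrite -b2TE (cen_sym H) scale1r.
  by rewrite -br_co !compA K comp1m.
have E2 : brT (dual Z) W T = evT Z _ ∘ (dual Z ◁ brT W Z (dual Z ⊗ T)) ∘ (dual Z ◁ W ◁ coT Z T).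
  rewrite -compA -wlc -E1 wlc compA evT_nat -compA zig2 compm1.
  by [].
rewrite b2TE E2 -compA -brT_nat compA br_ev -wlc zig2 wl1.
by [].
Qed.
End Cen.

Section Link.
Variables (k : closedFieldType) (C : braided_fusion_cat k).
Implicit Types W X Y Z T S V : C.

Definition fus i j l := hdim (irr C l) (irr C i ⊗ irr C j).
Definition unit_irr := projT1 (cid (irr_full (@one_simple k C))).
Lemma unit_irrP : isomorphic one (irr C unit_irr).
Proof. exact: projT2 (cid (irr_full (@one_simple k C))). Qed.

Lemma tens_iso X X' Y Y' : isomorphic X X' -> isomorphic Y Y' -> isomorphic (X ⊗ Y) (X' ⊗ Y').
Proof. by move=> [f] [g]; split; exact: biso. Qed.

(** A linear functor carries a decomposition of [V] to one of [F V], so multiplicities add up.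
    Tensoring on either side with a fixed object yields the associativity [fusA]. *)
Lemma hdim_decomp (F : functor C C) p V :
  hdim (irr C p) (F V) = (\sum_m hdim (irr C m) V * hdim (irr C p) (F (irr C m)))%N.
Proof.
pose T_ (m : 'I_(rank C)) : finType := ('I_(hdim (irr C m) V) * 'I_(hdim (irr C p) (F (irr C m))))%type.
pose A : finType := {m : 'I_(rank C) & T_ m}.
pose tg m (x : T_ m) : A := existT T_ m x.
transitivity #|A|; last first.
  rewrite card_tagged sumnE big_map big_enum; apply: eq_bigr => m _.
  by rewrite card_prod !card_ord.
pose e (x : A) := fmap F (iinj (tagged x).1) ∘ iinj (tagged x).2.
pose c (x : A) (v : hom (irr C p) (F V)) := sc (iprj (tagged x).2 ∘ fmap F (iprj (tagged x).1) ∘ v).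
apply: (@vaxiom_basis k _ _ A e c (hdimP _ _)).
- move=> x a u v; rewrite /c (comp_linearr (_ ∘ _)) (sc_linear (irr_simple p)) //.
- move=> [m [a b]] [m' [a' b']]; rewrite /c /e /=.
  rewrite !compA (rw1 (esym (fmap_comp F _ _))).
  case: (eqVneq m m') => [mm|ne]; last first.
    rewrite iprj_inj0 // (lin0 (@fmap_linear _ _ _ F _ _)) comp0r comp0l sc0; last exact: irr_simple.
    by case: eqP => // /(congr1 tag) /= E; rewrite E eqxx in ne.
  subst m'; rewrite iprj_inj (linZ (@fmap_linear _ _ _ F _ _)) fmap1 compZr compm1 compZl iprj_inj.
  rewrite scalerA scZ1 ?mulr_natl; last exact: irr_simple.
  rewrite eq_Tagged /= xpair_eqE; by case: (a == a'); case: (b == b').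
move=> v; rewrite -[LHS]comp1m -(fmap1 F) -isum (lin_sum (@fmap_linear _ _ _ F _ _)) comp_suml.
transitivity (\sum_(m < rank C) \sum_(x : T_ m) c (tg m x) v *: e (tg m x)); last first.
  by rewrite (sig_big_dep _ _ (fun m (x : T_ m) => c (tg m x) v *: e (tg m x))) /=;
     apply: eq_bigr => -[].
apply: eq_bigr => m _.
rewrite -(pair_bigA _ (fun a b => c (tg m (a, b)) v *: e (tg m (a, b)))) /=.
rewrite (lin_sum (@fmap_linear _ _ _ F _ _)) comp_suml; apply: eq_bigr => a _.
rewrite fmap_comp -compA (span_in (fmap F (iprj a) ∘ v) (irr_complete C) (iinjP _)) comp_sumr.
apply: eq_bigr => b _.
rewrite (scE (iprj b ∘ (fmap F (iprj a) ∘ v)) (irr_simple p)) !compZr compm1 /c /e /=.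
by rewrite !compA.
Qed.

Definition lfun X : functor C C :=
  Functor (bmap1 (tens C) X) (fun _ _ _ g f => wlc X g f) (fun _ _ => bmap_linearr (tens C) (idm X)).
Definition rfun X : functor C C :=
  Functor (fun Y => bmap1 (tens C) Y X) (fun _ _ _ g f => wrc X g f)
    (fun _ _ => bmap_linearl (tens C) (idm X)).

Lemma fus1 j l : fus unit_irr j l = (j == l).
Proof.
rewrite /fus eq_sym -hdim_simple; apply: hdim_iso; first exact: isomorphic_refl.
apply: isomorphic_trans (tens_iso (isomorphic_sym unit_irrP) (isomorphic_refl _)) _.
by split; exact: lunit.
Qed.

Lemma fusC i j l : fus i j l = fus j i l.
Proof. by apply: hdim_iso; [exact: isomorphic_refl|split; exact: braid]. Qed.

Lemma fusA i j l p : (\sum_m fus i j m * fus m l p = \sum_m fus j l m * fus i m p)%N.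
Proof.
rewrite -(hdim_decomp (rfun (irr C l)) p (irr C i ⊗ irr C j)).
rewrite -(hdim_decomp (lfun (irr C i)) p (irr C j ⊗ irr C l)) /=.
by apply: hdim_iso; [exact: isomorphic_refl|split; exact: assoc].
Qed.

Lemma hdim_ladj X Y Z : hdim (dual X ⊗ Y) Z = hdim Y (X ⊗ Z).
Proof.
apply: (@hdim_lin _ _ _ _ _ _ (fun f => (X ◁ f) ∘ coT X Y) (fun g => evT X Z ∘ (dual X ◁ g))).
- by move=> a f g; rewrite (bmap_linearr (tens C)) (comp_linearl (coT X Y)).
- by move=> a f g; rewrite (bmap_linearr (tens C)) (comp_linearr (evT X Z)).
- by move=> f; rewrite wlc compA evT_nat -compA zig2 compm1.
- by move=> g; rewrite wlc -compA -coT_nat compA zig1 comp1m.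
Qed.

Section Dual.
Variable j : forall X : C, iso X (dual (dual X)).
Hypothesis sj : spherical j.

Lemma star_ex i : exists i', isomorphic (dual (irr C i)) (irr C i').
Proof. exact/irr_full/simple_dual/irr_simple. Qed.
Definition star i := projT1 (cid (star_ex i)).
Lemma starP i : isomorphic (dual (irr C i)) (irr C (star i)).
Proof. exact: projT2 (cid (star_ex i)). Qed.

Lemma fusD i l m : fus i l m = fus (star i) m l.
Proof.
rewrite /fus -(hdim_sym _ l (irr_complete C)) -hdim_ladj; apply: hdim_iso; last exact: isomorphic_refl.
apply: tens_iso (starP i) (isomorphic_refl _).
Qed.

Lemma star_inv : involutive star.
Proof.
move=> i; apply: irr_inj; apply: isomorphic_trans (isomorphic_sym (starP _)) _.
apply: isomorphic_trans (dual_isom (isomorphic_sym (starP _))) _.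
apply: isomorphic_sym; split; exact: j.
Qed.

Local Notation d := (fun i => dm j (irr C i)).
Local Notation lm := (fun i l => lam j i (irr C l)).

Lemma dm_one : dm j (one : C) = 1.
Proof.
have n0 := dm_neq0 j (@one_simple k C).
apply: (mulIf n0); rewrite mul1r -(dm_tens sj).
by apply: (dm_iso sj); split; exact: lunit.
Qed.

Lemma d_unit : d unit_irr = 1.
Proof. by rewrite -dm_one; apply: (dm_iso sj); exact/isomorphic_sym/unit_irrP. Qed.

Lemma lam_unit_l : (lm unit_irr) = d.
Proof.
apply: functional_extensionality_dep => l; apply: lam_trans => // S.
have H : cen (irr C l) (irr C unit_irr) 1 by apply: cen_iso unit_irrP (cen_one _).
by rewrite (cen_sym H) scale1r.
Qed.

Lemma lam_char i : is_char fus unit_irr (lm i).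
Proof.
split.
  apply: (mulfI (dm_neq0 j (irr_simple i))); rewrite lam_sym // d_unit mul1r mulr1.
  by have := congr1 (fun f => f i) lam_unit_l.
by move=> a b; rewrite -lam_mul // lam_sum.
Qed.

Lemma cen_full i : (forall y T, b2T (irr C i) (irr C y) T = idm _) -> in_mueger_center (irr C i).
Proof.
move=> H Y; apply/cenP.
have [n [s [ss dsm]]] := fus_semisimple Y.
apply: (cen_sum dsm) => a; have [y iy] := irr_full (ss a).
by apply: cen_iso (isomorphic_sym iy) _ => T; rewrite H scale1r.
Qed.

Lemma mueger_unit i : non_degenerate C -> in_mueger_center (irr C i) -> i = unit_irr.
Proof.
move=> nd /nd [n [inj [prj [pi1 pi0 ip]]]].
case: n inj prj pi1 pi0 ip => [|n] inj prj pi1 pi0 ip.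
  by case: (irr_simple i) => + _; case; rewrite /is_zero -ip big_ord0.
have /is_isoP [g [g1 g2]] := retract_simple (pi1 ord0) (@one_simple k C).1 (irr_simple i).
apply: irr_inj; apply: isomorphic_trans unit_irrP; apply: isomorphic_sym.
by split; exact: Iso g1 g2.
Qed.

Lemma lam_trivial i : non_degenerate C -> (forall l, lm i l = d l) -> \sum_l d l ^+ 2 != 0 ->
  i = unit_irr.
Proof.
move=> nd H nz; apply: mueger_unit => //; apply: cen_full => y T.
exact: (handle_slide sj).
Qed.

Lemma d_star i : d (star i) = d i.
Proof.
rewrite /= -[RHS](dm_dual sj); apply: (dm_iso sj).
exact/isomorphic_sym/starP.
Qed.
End Dual.
End Link.

(** * A simple object fixed by an invertible object with trivial self-braiding *)

Section FixedByBoson.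
Variables (k : closedFieldType) (C : braided_fusion_cat k).
Variable j : forall X : C, iso X (dual (dual X)).
Variables (g X : C) (f : iso (g ⊗ X) X).
Hypotheses (sX : simple X) (sg : simple g) (gg : forall T, brT g g T = idm _).

Let fT T : iso (g ⊗ (X ⊗ T)) (X ⊗ T) :=
  iso_trans (biso (tens C) f (iso_refl T)) (iso_sym (assoc g X T)).
Let mfT : mor [:: g; X] [:: X] := mcomp (mrw [::] f) (mspi g X [::]).
Let fT_nat T S (h : hom T S) : fT S ∘ (g ◁ X ◁ h) = (X ◁ h) ∘ fT T.
Proof. exact: (mor_nat mfT h). Qed.

Let fT' T : iso (X ⊗ (g ⊗ T)) (X ⊗ T) := iso_trans (fT T) (brTi X g T).
(** Absorbing [g] into [X] from the left by [f], or from the right by [f] after a braiding, gives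
    commuting operations because [g] braids trivially with itself. *)
Let fT'_fT T : fT' T ∘ fT (g ⊗ T) = fT T ∘ (g ◁ fT' T).
Proof.
have E : brT (g ⊗ X) g T ∘ inv (assoc g X (g ⊗ T)) = (g ◁ inv (assoc g X T)) ∘ (g ◁ brT X g T).
  apply: (iso_can_l (f := wli g (assoc g X T))); rewrite /= !compA hexl gg comp1m.
  by rewrite -!wlc invK comp1m -compA invK compm1.
rewrite /= !wlc -!compA; congr (_ ∘ _); congr (_ ∘ _).
by rewrite !compA brT_l -compA E !compA.
Qed.

Let simple_mor (F : mor [:: X] [:: X]) : exists a, forall T, F T = a *: idm (X ⊗ T).
Proof.
have [h hP] := mor_obj F; have [a ha] := schur_end h sX.
by exists a => T; rewrite hP ha bmapZl wl1.
Qed.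

Let comm_one (P : mor [:: X] [:: X; one]) T : fT (one ⊗ T) ∘ (g ◁ P T) = P T ∘ fT T.
Proof.
have [a aP] := simple_mor (mcomp (mlw X (mun [::])) P).
have {}aP : (X ◁ lunit T) ∘ P T = a *: idm (X ⊗ T) := aP T.
have L Z (u v : hom Z (X ⊗ (one ⊗ T))) : (X ◁ lunit T) ∘ u = (X ◁ lunit T) ∘ v -> u = v.
  exact: (@iso_can_l _ _ _ _ _ (wli X (lunit T))).
apply: L; rewrite [LHS]compA [RHS]compA -fT_nat aP -[LHS]compA -wlc aP.
by rewrite bmapZr wl1 !(compZr, compZl) compm1 comp1m.
Qed.

Let mfT' : mor [:: X; g] [:: X] := mcomp mfT (mop (braid X g) [::]).
(** [fT' T ∘ P T] is a scalar by Schur's lemma, so [P] is a multiple of the inverse of [fT'], and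
    the claim reduces to [fT'_fT]. *)
Let comm_g (P : mor [:: X] [:: X; g]) T : fT (g ⊗ T) ∘ (g ◁ P T) = P T ∘ fT T.
Proof.
have [a aP] := simple_mor (mcomp mfT' P).
have {}aP : fT' T ∘ P T = a *: idm (X ⊗ T) by rewrite -aP /= brTE.
apply: (iso_can_l (f := fT' T)); rewrite [LHS]compA fT'_fT -[LHS]compA -wlc aP [RHS]compA aP.
by rewrite bmapZr wl1 compZr compZl compm1 comp1m.
Qed.

(** At the identity, [K] is the coevaluation. Splitting the identity of [dual X ⊗ X] into pieces
    that factor through [one] or [g] reduces its commutation with [fT] to [comm_one] and
    [comm_g]. *)
Let K (u : hom (dual X ⊗ X) (dual X ⊗ X)) T := (X ◁ opT u T) ∘ coT X (X ⊗ T).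
Let comm u := forall T, fT (dual X ⊗ (X ⊗ T)) ∘ (g ◁ K u T) = K u T ∘ fT T.

Let comm_mor m (a : hom (dual X ⊗ X) m) (b : hom m (dual X ⊗ X)) :
  (forall (P : mor [:: X] [:: X; m]) T, fT (m ⊗ T) ∘ (g ◁ P T) = P T ∘ fT T) -> comm (b ∘ a).
Proof.
move=> H T.
pose P := mcomp (mlw X (mcomp (mrw [::] a) (mspi (dual X) X [::]))) (mco X [:: X]).
have E : K (b ∘ a) T = (X ◁ (assoc (dual X) X T ∘ (b ▷ T))) ∘ P T.
  by rewrite /K opTE wrc /= !compA -!wlc !compA.
rewrite E [X in fT _ ∘ X]wlc [LHS]compA fT_nat -[LHS]compA -[RHS]compA; congr (_ ∘ _); exact: H.
Qed.

Let comm_sum I (r : seq I) P F : (forall i, comm (F i)) -> comm (\sum_(i <- r | P i) F i).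
Proof.
move=> H; have KD a u v T : K (a *: u + v) T = a *: K u T + K v T.
  by rewrite /K !opTE bmapDl bmapZl !(compDr, compDl, compZr, compZl) bmapDr bmapZr compDl compZl.
have KS T : K (\sum_(i <- r | P i) F i) T = \sum_(i <- r | P i) K (F i) T.
  by apply: (lin_sum (f := fun u => K u T)) => a u v; exact: KD.
move=> T; rewrite KS bmap_sumr comp_sumr comp_suml.
by apply: eq_bigr => i _; exact: H.
Qed.

(* If g is transparent to itself and the constituents of X^* X are 1 and g, then the
   isomorphism gX -> X commutes with the coevaluation of X^* ; closing the loop turns
   it into a morphism g -> 1 tensored with X. *)
Lemma fixed_by_boson :
  (forall p, (0 < hdim (irr C p) (dual X ⊗ X))%N -> isomorphic (irr C p) one \/ isomorphic (irr C p) g) ->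
  isomorphic g one.
Proof.
move=> H; apply: contrapT => ng.
have c1 : comm (idm _).
  rewrite -isum; apply: comm_sum => i; apply: comm_sum => a.
  have n0 : (0 < hdim (irr C i) (dual X ⊗ X))%N by exact: leq_ltn_trans (ltn_ord a).
  rewrite -[iinj a]compm1.
  have Hm m (s : iso (irr C i) m) : iinj a ∘ idm _ ∘ iprj a = (iinj a ∘ inv s) ∘ (s ∘ iprj a).
    by rewrite -(fwdK s) !compA.
  by case: (H i n0) => -[s]; rewrite (Hm _ s); apply: comm_mor.
have Th T : evrT j X T ∘ fT (dual X ⊗ T) ∘ (g ◁ coT X T) = 0.
  pose M : mor [:: g] [:: one] :=
    mcomp (muni [::]) (mcomp (mcomp (mevr j X [::]) (mcomp (mrw [:: dual X] f) (mspi g X [:: dual X]))) (mlw g (mco X [::]))).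
  have [h hP] := mor_obj M.
  apply: (iso_can_l (f := iso_sym (lunit T))); rewrite /= comp0r.
  have := hP T; rewrite (schur0 h sg (@one_simple _ C)) // bmap0l => <-.
  by rewrite /= !compA.
(* Moving [fT] past the coevaluation closes a free loop, so the vanishing composite equals [dm X]
   times [fT one], an isomorphism. *)
have := Th (X ⊗ one); rewrite -compA.
have := c1 one; rewrite /K opT1 wl1 comp1m => ->.
rewrite [LHS]compA dmP compZl comp1m => /eqP; rewrite scaler_eq0 (negPf (dm_neq0 j sX)) /= => /eqP f0; have {}f0 : fwd (fT one) = 0 := f0.
case: sX => nX _; apply: nX; apply: (wr_inj (X := X)).
by rewrite /is_zero bmap1 bmap0l -(invK (fT one)) f0 comp0l.
Qed.
End FixedByBoson.

Section BraidSquare.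
Variables (k : fieldType) (C : braided_fusion_cat k).

Lemma brT_square (b : C) (e : k) : (forall T, brT b b T = e *: idm _) ->
  forall T, brT (b ⊗ b) (b ⊗ b) T = e ^+ 4 *: idm _.
Proof.
move=> H T; set Z := b ⊗ b.
have E S : brT b Z S = e ^+ 2 *: (inv (assoc b b (b ⊗ S)) ∘ (b ◁ assoc b b S)).
  apply: (iso_can_l (f := assoc b b (b ⊗ S))); rewrite [RHS]compZr compA invK comp1m hexr !H bmapZr wl1.
  by rewrite !(compZl, compZr) !comp1m scalerA.
apply: (iso_can_l (f := wli Z (assoc b b T))) => /=; rewrite hexl !E bmapZr wlc.
rewrite !(compZr, compZl) scalerA -exprD !compA compm1.
rewrite (rw0 (_ : (b ◁ assoc b b (b ⊗ T)) ∘ (b ◁ inv (assoc b b (b ⊗ T))) = idm _)); last first.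
  by rewrite -wlc invK wl1.
by rewrite -!compA -an3 !compA fwdK comp1m.
Qed.

Lemma brT_isom (X Y : C) (s : iso X Y) e : (forall T, brT X X T = e *: idm _) ->
  forall T, brT Y Y T = e *: idm _.
Proof.
move=> H T.
apply: (iso_can_r (f := wri (Y ⊗ T) s)); apply: (iso_can_r (f := wli X (wri T s))); rewrite /=.
by rewrite brT_l -compA brT_r H !(compZr, compZl) compm1 comp1m wex.
Qed.
End BraidSquare.

(** * Invertible objects and dimensions *)

(** Isolating [b%:R * w] and squaring makes [b ^ 2 * q] a perfect square; for positive [b] its
    valuation at [q] is odd. *)
Lemma sqrt_prime_irrational (q a b c : nat) (w : algC) : prime q -> w ^+ 2 = q%:R ->
  a%:R + b%:R * w = c%:R -> b = 0%N.
Proof.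
move=> pq w2 E; apply/eqP; case: (posnP b) => [//|b0].
have E1 : b%:R * w = c%:R - a%:R by rewrite -E addrC addKr.
have E2 : (b ^ 2 * q)%:R = ((c%:Z - a%:Z) ^+ 2)%:~R :> algC.
  by rewrite natrM natrX -w2 -exprMn E1 rmorphXn rmorphB /=.
have E3 : (b ^ 2 * q = `|c%:Z - a%:Z| ^ 2)%N.
  by apply/eqP; rewrite -(eqr_nat algC) E2 -abszX natr_absz ger0_norm ?sqr_ge0.
have := congr1 (logn q) E3; rewrite lognM ?expn_gt0 ?b0 ?prime_gt0 // !lognX (logn_prime q pq) eqxx.
by move=> /(congr1 odd); rewrite oddD !oddM.
Qed.

Section Combi.
Variables (k : closedFieldType) (C : braided_fusion_cat k).
Hypotheses (k0 : [pchar k] =i pred0) (nd : non_degenerate C).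
Variable j : forall X : C, iso X (dual (dual X)).
Hypothesis sj : spherical j.

Local Notation r := (rank C).
Local Notation N := (@fus k C).
Local Notation st := (@star k C).
Local Notation i0 := (unit_irr C).
Local Notation d := (fun i => dm j (irr C i)).
Local Notation lm := (fun i l => lam j i (irr C l)).
Local Notation ND := (@fusD k C).
Local Notation stK := (@star_inv k C j).

Lemma FPdim_fp (v : 'I_r -> algC) : (forall i, 0 < v i) -> is_char N i0 v -> FPdim C = fpdim v.
Proof.
move=> v0 vc; apply: eq_bigr => i _; rewrite /FPdim_irr; congr (_ ^+ 2).
by rewrite -(N_mx_charE i v0 vc).
Qed.

Variable Dn : nat.
Hypothesis HD : FPdim C = Dn%:R.

Lemma fp_data : exists v : 'I_r -> algC, [/\ forall i, 0 < v i, is_char N i0 v & fpdim v = Dn%:R].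
Proof.
have [v [v0 vc]] := fp_exists (@fus1 k C) (@fusC k C) (@fusA k C) ND stK.
by exists v; split; rewrite // -HD (FPdim_fp v0 vc).
Qed.
Definition fp : 'I_r -> algC := projT1 (cid fp_data).
Lemma fp_gt0 i : 0 < fp i. Proof. by rewrite /fp; case: cid => v []. Qed.
Lemma fp_char : is_char N i0 fp. Proof. by rewrite /fp; case: cid => v []. Qed.
Lemma fp_dim : fpdim fp = Dn%:R. Proof. by rewrite /fp; case: cid => v []. Qed.

Lemma dims i : exists n : nat, [/\ fp i ^+ 2 = n%:R, d i ^+ 2 = n%:R & n %| Dn]%N.
Proof.
apply: (dims_sq (fus1 (C:=C)) (@fusC k C) ND stK fp_gt0 fp_char fp_dim k0 (lam := lm) (d := d)).
- exact: lam_char sj.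
- by move=> a b; exact: lam_sym sj _ _.
- exact: lam_unit_l j.
- by move=> a; apply: dm_neq0; exact: irr_simple.
- exact: d_star sj.
- by move=> a; exact: (lam_trivial sj nd).
Qed.

Definition sqdim i : nat := projT1 (cid (dims i)).
Lemma fp_sq i : fp i ^+ 2 = (sqdim i)%:R. Proof. by rewrite /sqdim; case: cid => n []. Qed.
Lemma d_sq i : d i ^+ 2 = (sqdim i)%:R. Proof. by rewrite /sqdim; case: cid => n []. Qed.
Lemma sqdim_dvd i : (sqdim i %| Dn)%N. Proof. by rewrite /sqdim; case: cid => n []. Qed.
Lemma sqdim_gt0 i : (0 < sqdim i)%N.
Proof. by rewrite -(ltr0n algC) -fp_sq exprn_gt0 // fp_gt0. Qed.
Lemma sqdim_sum : (\sum_i sqdim i = Dn)%N.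
Proof.
apply/eqP; rewrite -(eqr_nat algC) -fp_dim natr_sum; apply/eqP.
by apply: eq_bigr => i _; rewrite fp_sq.
Qed.
Lemma sqdim_unit : sqdim i0 = 1%N.
Proof. by apply/eqP; rewrite -(eqr_nat algC) -fp_sq fp_char.1 expr1n. Qed.
Lemma fp_star i : fp (st i) = fp i.
Proof. exact: (v_star ND fp_gt0 fp_char i). Qed.
Lemma sqdim_eq i l : (fp i == fp l) = (sqdim i == sqdim l).
Proof. by rewrite -(eqr_nat algC) -!fp_sq eqrXn2 // ltW // fp_gt0. Qed.

(** Invertibility in numerical form; [inv_irr_invertible] and [invertible_inv_irr] identify it with
    the categorical notion. *)
Definition inv_irr i := sqdim i == 1%N.
Lemma inv_fp i : inv_irr i = (fp i == 1).
Proof. by rewrite -fp_char.1 sqdim_eq sqdim_unit. Qed.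
Lemma inv_unit : inv_irr i0. Proof. by rewrite /inv_irr sqdim_unit. Qed.

Lemma fp_le i l m : (0 < N i l m)%N -> fp m <= fp i * fp l.
Proof.
move=> n0; rewrite -fp_char.2 (bigD1 m) //= -[X in X <= _]addr0 lerD //.
  by rewrite -[X in X <= _]mul1r ler_wpM2r ?ler1n // ltW // fp_gt0.
by rewrite sumr_ge0 // => p _; rewrite mulr_ge0 ?ler0n // ltW // fp_gt0.
Qed.

(** The product of [g] and [l] has dimension [fp l], and by reciprocity [l] occurs in the product of
    [star g] with any constituent [m], so [fp l <= fp m]. Hence there is one constituent, with
    multiplicity 1. *)
Lemma act_ex g l : inv_irr g -> exists m, fp m = fp l /\ forall p, N g l p = (p == m).
Proof.
rewrite inv_fp => /eqP g1.
have E : \sum_p (N g l p)%:R * fp p = fp l by rewrite fp_char.2 g1 mul1r.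
have [m n0] : exists m, (0 < N g l m)%N.
  apply: contrapT => H; have := fp_gt0 l; rewrite -E big1 ?ltxx // => p _.
  case: (posnP (N g l p)) => [->|n0]; first by rewrite mul0r.
  by case: H; exists p.
have ml : fp m = fp l.
  apply/eqP; rewrite eq_le -{1}[fp l]mul1r -{1}g1 fp_le //=.
  by rewrite -{1}[fp m]mul1r -g1 -(fp_star g) fp_le // -ND.
exists m; split => // p.
have F0 (x : 'I_r) : 0 <= (N g l x)%:R * fp x by rewrite mulr_ge0 ?ler0n // ltW // fp_gt0.
move: E; rewrite (bigD1 m) //= ml => E.
have Nm : N g l m = 1%N.
  apply/eqP; rewrite eqn_leq n0 andbT -(ler_nat algC) -(ler_pM2r (fp_gt0 l)) mul1r -[X in _ <= X]E.
  by rewrite lerDl sumr_ge0.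
case: eqVneq => [->//|pm]; move: E; rewrite Nm mul1r -[X in _ = X]addr0 => /addrI/eqP.
rewrite psumr_eq0 // => /allP/(_ p (mem_index_enum _)).
by rewrite pm mulf_eq0 (gt_eqF (fp_gt0 _)) orbF pnatr_eq0 => /eqP.
Qed.

(** The action of invertible objects on simple ones, made total by acting trivially when [g] is not
    invertible. *)
Definition actI g l : 'I_r :=
  if pselect (inv_irr g) is left h then projT1 (cid (act_ex l h)) else l.
Lemma actP g l p : inv_irr g -> N g l p = (p == actI g l).
Proof. by move=> h; rewrite /actI; case: pselect => // h'; case: cid => m []. Qed.
Lemma act_fp g l : inv_irr g -> sqdim (actI g l) = sqdim l.
Proof.
move=> h; apply/eqP; rewrite -sqdim_eq; apply/eqP.
by rewrite /actI; case: pselect => // h'; case: cid => m [].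
Qed.
Lemma act_inv g l : inv_irr g -> inv_irr (actI g l) = inv_irr l.
Proof. by move=> h; rewrite /inv_irr act_fp. Qed.
Lemma inv_star g : inv_irr (st g) = inv_irr g.
Proof. by rewrite !inv_fp fp_star. Qed.
Lemma actK g : inv_irr g -> cancel (actI g) (actI (st g)).
Proof.
move=> h l; apply/eqP; rewrite eq_sym; apply/eqP; apply/eqP.
have := actP (actI g l) l (etrans (inv_star g) h); rewrite -ND actP // eqxx.
by case: eqP.
Qed.
Lemma actKV g : inv_irr g -> cancel (actI (st g)) (actI g).
Proof. by move=> ig; rewrite -{2}[g]stK; apply: actK; rewrite inv_star. Qed.
Lemma actI_inj g : inv_irr g -> injective (actI g).
Proof. by move=> h; exact: can_inj (actK h). Qed.
Lemma act1 l : actI i0 l = l.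
Proof. by have := actP l l inv_unit; rewrite fus1 eqxx; case: eqP. Qed.
Lemma actC g h : inv_irr g -> inv_irr h -> actI g h = actI h g.
Proof.
move=> ig ih; have := actP h (actI g h) ig; rewrite eqxx fusC actP //.
by case: eqP.
Qed.

Lemma tens_irr X Y m : (forall p, hdim (irr C p) (X ⊗ Y) = (p == m)) -> isomorphic (X ⊗ Y) (irr C m).
Proof.
move=> H; have H0 p : p != m -> hdim (irr C p) (X ⊗ Y) = 0%N by move=> /negPf pm; rewrite H pm.
have E := isum (X ⊗ Y).
rewrite (bigD1 m) //= [X in _ + X]big1 ?addr0 in E; last first.
  by move=> p /H0 h0; apply: big1 => a _; exfalso; have := ltn_ord a; move: (nat_of_ord a) => x; rewrite h0.
have a : 'I_(hdim (irr C m) (X ⊗ Y)) by rewrite H eqxx; exact: ord0.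
have all1 b : b = a.
  by apply: ord_inj; have := ltn_ord a; have := ltn_ord b; move: (nat_of_ord a) (nat_of_ord b) => x y; rewrite H eqxx; case: x; case: y.
rewrite (bigD1 a) //= big1 ?addr0 in E; last by move=> b; rewrite (all1 b) eqxx.
by split; exists (iprj a) (iinj a) => //; rewrite iprj_inj eqxx scale1r.
Qed.

Lemma act_iso g l : inv_irr g -> isomorphic (irr C g ⊗ irr C l) (irr C (actI g l)).
Proof. by move=> h; apply: tens_irr => p; exact: actP. Qed.

(** For invertible [g] this quotient is the scalar by which the double braiding of [g] and [l] acts,
    as [chi_cen] shows. *)
Definition chi g l := lm g l / d l.
Lemma d_neq0 l : d l != 0. Proof. exact: dm_neq0 (irr_simple l). Qed.

Lemma cen_chi g l c : cen (irr C g) (irr C l) c -> c = chi g l.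
Proof.
move=> H; rewrite /chi; suff -> : lm g l = c * d l by rewrite mulfK // d_neq0.
apply: lam_uniq; rewrite /ringT H compZr compm1 compZl -wlc dmP bmapZr wl1 scalerA.
by [].
Qed.

Lemma chi_cen g l : inv_irr g -> cen (irr C g) (irr C l) (chi g l).
Proof.
move=> h; have sgl : simple (irr C g ⊗ irr C l).
  exact: simple_iso (isomorphic_sym (act_iso l h)) (irr_simple _).
have H : cen (irr C g) (irr C l) (sc (braid (irr C l) (irr C g) ∘ braid (irr C g) (irr C l))).
  move=> T; rewrite b2T_opT {1}(scE (_ ∘ _) sgl) opTE bmapZl bmap1 compZr compm1 compZl invK.
  by [].
by rewrite -(cen_chi H).
Qed.

Lemma sub_cen W X Y p c : (0 < hdim (irr C p) (X ⊗ Y))%N -> cen W (X ⊗ Y) c -> cen W (irr C p) c.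
Proof.
move=> n0; pose a : 'I_(hdim (irr C p) (X ⊗ Y)) := Ordinal n0.
by apply: (cen_retract (i := iinj a) (p := iprj a)); rewrite iprj_inj eqxx scale1r.
Qed.

Lemma chi_tens g l m p : inv_irr g -> (0 < N l m p)%N -> chi g p = chi g l * chi g m.
Proof.
move=> h n0; apply/esym/cen_chi; apply: sub_cen n0 _.
by apply: cen_tens; exact: chi_cen.
Qed.

Lemma chi_sym g h : inv_irr g -> chi g h = chi h g.
Proof. by move=> ig; apply: cen_chi; apply: cen_sym; exact: chi_cen. Qed.

Lemma chi_act g h l : inv_irr g -> inv_irr h -> chi (actI g h) l = chi g l * chi h l.
Proof.
move=> ig ih; rewrite chi_sym ?act_inv //; apply/esym/cen_chi.
apply: (sub_cen (X := irr C g) (Y := irr C h)).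
  by have := actP h (actI g h) ig; rewrite eqxx /fus => ->.
by apply: cen_tens; apply: cen_sym; exact: chi_cen.
Qed.

Lemma chi_r1 g : inv_irr g -> chi g i0 = 1.
Proof.
by move=> ig; apply/esym/cen_chi; apply: cen_iso (unit_irrP C) (cen_one _).
Qed.
Lemma chi_l1 l : chi i0 l = 1.
Proof. by apply/esym/cen_chi/cen_sym; apply: cen_iso (unit_irrP C) (cen_one _). Qed.

Lemma chi_star g l : inv_irr g -> chi g l * chi g (st l) = 1.
Proof.
move=> ig; rewrite -(chi_r1 ig); apply/esym/chi_tens => //.
by rewrite (N_unit (fus1 (C:=C)) (@fusC k C) ND) eqxx.
Qed.

Lemma chi_nd g : inv_irr g -> (forall l, chi g l = 1) -> g = i0.
Proof.
move=> ig H; apply: (mueger_unit nd); apply: cen_full => y T.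
by rewrite (chi_cen y ig) H scale1r.
Qed.

Lemma chi_kill g : inv_irr g -> g != i0 -> \sum_l (sqdim l)%:R * chi g l = 0.
Proof.
move=> ig gn.
transitivity (\sum_l d l * lm g l).
  apply: eq_bigr => l _; rewrite -d_sq /chi expr2 -mulrA; congr (_ * _).
  by rewrite mulrCA mulfV ?mulr1 // d_neq0.
rewrite (killing (fus1 (C:=C)) (@fusC k C) ND stK fp_gt0 fp_char k0 (lam := lm) (d := d)).
- by rewrite (negPf gn) mul0r.
- exact: lam_char sj.
- exact: lam_unit_l j.
- by move=> a; apply: dm_neq0; exact: irr_simple.
- exact: d_star sj.
- by move=> a; exact: (lam_trivial sj nd).
Qed.

Definition same l m := [forall g, inv_irr g ==> (chi g l == chi g m)].
Lemma sameP l m : reflect (forall g, inv_irr g -> chi g l = chi g m) (same l m).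
Proof.
by apply: (iffP forallP) => H g; [move=> ig; have := H g; rewrite ig => /eqP|apply/implyP => ig; rewrite H].
Qed.

(* The characters chi g grade C by the dual of the group of invertible objects. *)
Lemma coset_dim x : (#|[pred g | inv_irr g]| * \sum_(l | same l x) sqdim l = Dn)%N.
Proof.
apply: (natF_inj k0); rewrite natrM natr_sum.
(* As a function of the invertible [g], [psi l] is a group character comparing the degrees of [l]
   and [x], trivial exactly when [same l x]. The double sum is evaluated by [chi_kill] in one order
   and by orthogonality of characters in the other. *)
pose psi l g := chi g l * chi g (st x).
have psi1 g : inv_irr g -> psi x g = 1 by move=> ig; rewrite /psi chi_star.
transitivity (\sum_(g | inv_irr g) \sum_l (sqdim l)%:R * psi l g); last first.
  rewrite (bigD1 i0) ?inv_unit //= [X in _ + X]big1 ?addr0 => [|g /andP [ig gn]].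
    rewrite -sqdim_sum natr_sum; apply: eq_bigr => l _.
    by rewrite /psi !chi_l1 !mulr1.
  rewrite /psi (eq_bigr (fun l => (sqdim l)%:R * chi g l * chi g (st x))) => [|l _]; last first.
    by rewrite mulrA.
  by rewrite -mulr_suml chi_kill // mul0r.
rewrite exchange_big /= [RHS](bigID (fun l => same l x)) /= [X in _ = _ + X]big1 ?addr0.
  rewrite mulr_sumr; apply: eq_bigr => l /sameP sl.
  rewrite -mulr_sumr (eq_bigr (fun=> 1)) => [|g ig]; last by rewrite /psi sl // chi_star.
  by rewrite sumr_const mulrC; congr (_ * _%:R); apply: eq_card.
move=> l /forallPn [h]; rewrite negb_imply => /andP [ih ne].
rewrite -mulr_sumr; suff -> : \sum_(g | inv_irr g) psi l g = 0 by rewrite mulr0.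
have p1 : psi l h - 1 != 0.
  rewrite subr_eq0; apply: contra ne => /eqP E.
  by rewrite -[chi h l]mulr1 -(chi_star x ih) mulrCA [chi h l * _]E mulr1.
apply: (mulfI p1); rewrite mulr0 mulrBl mul1r mulr_sumr; apply/eqP; rewrite subr_eq0; apply/eqP.
rewrite [RHS](reindex_inj (actI_inj ih)) /=; apply: eq_big => [g|g ig]; first by rewrite act_inv.
by rewrite /psi !chi_act //; ring.
Qed.

Lemma fus_inv g l m : inv_irr g -> N l (st m) g = (l == actI g m).
Proof.
move=> ig; rewrite -actP // [RHS]ND -[RHS](N_conj (@fusC k C) ND) stK.
by rewrite ND fusC.
Qed.

Lemma same_unit l p : (0 < N l (st l) p)%N -> same p i0.
Proof.
move=> n0; apply/sameP => g ig.
by rewrite (chi_tens ig n0) chi_star // chi_r1.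
Qed.

Section PrimeCube.
Variable q : nat.
Hypotheses (pq : prime q) (Dq : Dn = (q ^ 3)%N).
Let w : algC := sqrtC q%:R.
Let w2 : w ^+ 2 = q%:R. Proof. exact: sqrtCK. Qed.

Lemma sqdim_cases i : [\/ sqdim i = 1, sqdim i = q | sqdim i = q ^ 2]%N.
Proof.
have := sqdim_dvd i; rewrite Dq => /(dvdn_pfactor _ _ pq) [[|[|[|[|m]]]] // _ E].
- by constructor 1.
- by constructor 2; rewrite E expn1.
- by constructor 3.
(* What remains is [sqdim i = q ^ 3], which would exhaust the total and leave no room for the
   unit. *)
case: (eqVneq i i0) => [->|ni]; first by rewrite sqdim_unit; constructor 1.
have := sqdim_sum; rewrite (bigD1 i) //= (bigD1 i0) 1?eq_sym //= sqdim_unit E Dq.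
by move=> /eqP; rewrite -{2}[(q ^ 3)%N]addn0 eqn_add2l.
Qed.

Lemma fp_cases i : sqdim i = q -> fp i = w.
Proof.
move=> E; apply/eqP; rewrite -(@eqrXn2 _ 2%N) ?sqrtC_ge0 ?ler0n // ?ltW ?fp_gt0 //.
by rewrite fp_sq w2 E.
Qed.

Lemma fp_cases2 i : sqdim i = (q ^ 2)%N -> fp i = q%:R.
Proof.
move=> E; apply/eqP; rewrite -(@eqrXn2 _ 2%N) ?ler0n // ?ltW ?fp_gt0 //.
by rewrite fp_sq E natrX.
Qed.

(** Sorting constituents by dimension 1, [w] or [q] puts the product in the form integer plus
    integer times [w], ready for [sqrt_prime_irrational]. *)
Lemma fp_split l m : fp l * fp m = (\sum_(p | inv_irr p) N l m p
   + q * \sum_(p | sqdim p == (q ^ 2)%N) N l m p)%N%:R + (\sum_(p | sqdim p == q) N l m p)%:R * w.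
Proof.
have q1 := prime_gt1 pq.
have qq : (q == 1)%N = false by rewrite gtn_eqF.
have qq2 : ((q ^ 2)%N == 1)%N = false by rewrite gtn_eqF // (ltn_trans q1) // -{1}[q]expn1 ltn_exp2l.
have qq3 : ((q ^ 2)%N == q)%N = false by rewrite gtn_eqF // -{1}[q]expn1 ltn_exp2l.
rewrite -fp_char.2 natrD natrM !natr_sum mulr_suml mulr_sumr.
rewrite (big_mkcond inv_irr) (big_mkcond (fun p => sqdim p == _)) [X in _ = _ + X]big_mkcond.
rewrite -!big_split; apply: eq_bigr => p _ /=; rewrite /inv_irr.
case: (sqdim_cases p) => E; rewrite E ?eqxx ?qq ?qq2 ?qq3 ?[_ == (q ^ 2)%N]eq_sym ?qq2 ?qq3 ?[1%N == q]eq_sym ?qq ?[q == _]eq_sym ?qq3.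
- have := inv_fp p; rewrite /inv_irr E eqxx => /esym/eqP ->; ring.
- by rewrite fp_cases //; ring.
- by rewrite fp_cases2 //; ring.
Qed.

Lemma sqdim_neq_sq x : sqdim x <> (q ^ 2)%N.
Proof.
move=> E; have q1 := prime_gt1 pq.
have := fp_split x (st x); rewrite fp_star (fp_cases2 E) -natrM => /esym H.
have b0 := sqrt_prime_irrational pq w2 H; move: H; rewrite b0 mul0r addr0 => /eqP.
rewrite eqr_nat; set s := (\sum_(p | inv_irr p) _)%N; set m := (\sum_(p | _) _)%N => /eqP H.
have sG : (s <= #|[pred g | inv_irr g]|)%N.
  rewrite -sum1_card; apply: leq_sum => g ig; rewrite fus_inv //; exact: leq_b1.
have s1 : (0 < s)%N by rewrite /s (bigD1 i0) ?inv_unit //= fus_inv ?inv_unit // act1 eqxx.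
(* [s] counts the invertible constituents of [x ⊗ st x] and [m] those of dimension [q]. If [m = 0],
   there are at least [q ^ 2] invertible objects and the component of [x] has dimension at least
   [q ^ 2], for a total of at least [q ^ 4]. *)
have [m0|m0] := posnP m.
  have := coset_dim x; rewrite (bigD1 x) /=; last by apply/sameP.
  rewrite E Dq => D; move: H; rewrite m0 muln0 addn0 => H.
  suff : (q ^ 2 * q ^ 2 <= q ^ 3)%N by rewrite -expnD leq_exp2l.
  rewrite -{1}mulnn -{1}H -D; apply: leq_mul => //; exact: leq_addr.
have [p /andP [/eqP pE pn]] : exists p, (sqdim p == (q ^ 2)%N) && (0 < N x (st x) p)%N.
  apply/existsP; apply: contraLR m0; rewrite negb_exists => /forallP F.
  rewrite -leqNgt leqn0 /m big1 // => p pp; have := F p; rewrite pp /= -leqNgt leqn0 => /eqP //.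
(* Now [q] divides the positive number [s], so there are at least [q] invertible objects, while the
   component of the unit contains both the unit and [p], of total dimension at least [1 + q ^ 2]. *)
have qs : (q %| s)%N by rewrite -(dvdn_addl s (dvdn_mulr m (dvdnn q))) H dvdn_mulr.
have := coset_dim i0; rewrite (bigD1 i0) /=; last by apply/sameP.
have pi : p != i0.
  by apply/eqP => pi; move: pE; rewrite pi sqdim_unit => /eqP; rewrite ltn_eqF // (ltn_trans q1) // -{1}[q]expn1 ltn_exp2l.
rewrite (bigD1 p) /= ?(same_unit pn) // sqdim_unit pE Dq => D.
suff : (q * (1 + q ^ 2) <= q ^ 3)%N by rewrite mulnDr muln1 -expnS -{2}[(q ^ 3)%N]add0n leq_add2r leqNgt prime_gt0.
rewrite -D; apply: leq_mul; first exact: leq_trans (dvdn_leq s1 qs) sG.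
by rewrite leq_add2l leq_addr.
Qed.

Lemma sqdim_noninv i : ~~ inv_irr i -> sqdim i = q.
Proof. by case: (sqdim_cases i) => // E; [rewrite /inv_irr E|case: (sqdim_neq_sq E)]. Qed.

Lemma fus_noninv l m : ~~ inv_irr l -> ~~ inv_irr m ->
  (\sum_(p | inv_irr p) N l m p = q)%N /\ forall p, ~~ inv_irr p -> N l m p = 0%N.
Proof.
move=> /sqdim_noninv El /sqdim_noninv Em.
have := fp_split l m; rewrite !fp_cases // -expr2 w2 => /esym H.
have b0 := sqrt_prime_irrational pq w2 H; move: H; rewrite b0 mul0r addr0 => /eqP.
rewrite eqr_nat [X in (q * X)%N]big1 => [|p /eqP /sqdim_neq_sq //]; rewrite muln0 addn0 => /eqP ->.
split=> // p /sqdim_noninv Ep; apply/eqP; move: b0 => /eqP.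
by rewrite sum_nat_eq0 => /forallP/(_ p); rewrite Ep eqxx.
Qed.

Lemma pointed_or_two : (forall i, inv_irr i) \/
  [/\ q = 2%N, #|[pred g | inv_irr g]| = 4%N & #|[pred l | ~~ inv_irr l]| = 2%N].
Proof.
have [H|/existsNP [x /negP nx]] := pselect (forall i, inv_irr i); [by left|right].
set G := #|_|; set M := #|_|.
(* Double counting with [x] fixed: each noninvertible [y] gives [q] invertible constituents of
   [x ⊗ st y], and each invertible [g] occurs for exactly one [y]. *)
have E1 : (M * q = G)%N.
  transitivity (\sum_(y | ~~ inv_irr y) \sum_(g | inv_irr g) N x (st y) g)%N.
    rewrite /M -sum_nat_const; apply: eq_bigr => y ny.
    by rewrite (fus_noninv nx _).1 // inv_star.
  rewrite exchange_big /= /G -sum1_card; apply: eq_bigr => g ig.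
  rewrite (bigD1 (actI (st g) x)) ?act_inv ?inv_star //= big1 => [|y /andP [ny ne]].
    by rewrite fus_inv // actKV // eqxx.
  rewrite fus_inv //; case: eqP => // E; move: ne; rewrite E actK // eqxx //.
have E2 : (G + M * q = q ^ 3)%N.
  rewrite -Dq -sqdim_sum (bigID inv_irr) /=; congr (_ + _)%N.
    by rewrite /G -sum1_card; apply: eq_bigr => i /eqP.
  by rewrite /M -sum_nat_const; apply: eq_bigr => i /sqdim_noninv.
have q2 : q = 2%N.
  have : (2 %| q ^ 3)%N by rewrite -E2 E1 addnn -mul2n dvdn_mulr.
  by rewrite Euclid_dvdX // => /andP [d2 _]; apply/esym/eqP; rewrite -dvdn_prime2.
by move: E1 E2; rewrite q2 -[(2 ^ 3)%N]/8%N => E1 E2; split; clearbody G M; lia.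
Qed.
End PrimeCube.

(** * The case of dimension 8 *)

Section Eight.
Hypotheses (D8 : Dn = (2 ^ 3)%N) (G4 : #|[pred g | inv_irr g]| = 4%N).
Hypothesis (M2 : #|[pred l | ~~ inv_irr l]| = 2%N).
Variable x : 'I_r.
Hypothesis nx : ~~ inv_irr x.
Let p2 : prime 2 := isT.
Let neg1 : (-1 : k) != 1.
Proof.
rewrite eq_sym -addr_eq0 -mulr2n; apply/negP => /eqP E; have := k0 2%N.
by rewrite inE /= E eqxx.
Qed.

(** The component of the unit has dimension 8 / 4 = 2, and the two invertible constituents of
    [x ⊗ st x] already fill it. *)
Lemma same_unit_two : exists g, [/\ inv_irr g, g != i0 & forall p, same p i0 = (p == i0) || (p == g)].
Proof.
have [S2 _] := fus_noninv p2 D8 nx (etrans (congr1 _ (inv_star x)) nx).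
have [g /and3P [ig gi gN]] : exists g, [&& inv_irr g, g != i0 & (0 < N x (st x) g)%N].
  apply/existsP; apply: contra_eqT S2; rewrite negb_exists => /forallP F.
  rewrite (bigD1 i0) ?inv_unit //= fus_inv ?inv_unit // act1 eqxx big1 // => g /andP [ig gi].
  by have := F g; rewrite ig gi /= -leqNgt leqn0 => /eqP.
exists g; split=> // p; have sg := same_unit gN.
have si : same i0 i0 by apply/sameP.
have := coset_dim i0; rewrite G4 D8 (bigD1 i0) //= (bigD1 g) ?sg ?gi //= sqdim_unit.
move: (ig) => /eqP -> E.
case: (eqVneq p i0) => [->//|pi]; case: (eqVneq p g) => [->//|pg] /=.
apply/negP => sp; move: E; rewrite (bigD1 p) /= ?sp ?pi ?pg //.
have := sqdim_gt0 p; rewrite -[(2 ^ 3)%N]/8%N; lia.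
Qed.

Let g := projT1 (cid same_unit_two).
Let ig : inv_irr g. Proof. by rewrite /g; case: cid => ? []. Qed.
Let gi : g != i0. Proof. by rewrite /g; case: cid => ? []. Qed.
Let sameg p : same p i0 = (p == i0) || (p == g). Proof. by rewrite /g; case: cid => ? []. Qed.
Let chig h : inv_irr h -> chi h g = 1.
Proof. by move=> ih; have /sameP -> // : same g i0; rewrite ?chi_r1 // sameg eqxx orbT. Qed.

Let fus_g X p : ~~ inv_irr X -> N X (st X) p = ((p == i0) || (p == g)).
Proof.
move=> nX; have nX' : ~~ inv_irr (st X) by rewrite inv_star.
have [S2 S0] := fus_noninv p2 D8 nX nX'.
have N0 : N X (st X) i0 = 1%N by rewrite fus_inv ?inv_unit // act1 eqxx.
have Np q : q != i0 -> q != g -> N X (st X) q = 0%N.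
  move=> qi qg; case: (posnP (N X (st X) q)) => // /same_unit.
  by rewrite sameg (negPf qi) (negPf qg).
have Ng : N X (st X) g = 1%N.
  move: S2; rewrite (bigD1 i0) ?inv_unit //= (bigD1 g) ?ig ?gi //= N0 big1; first by lia.
  by move=> q /andP [/andP [_ qi] qg]; exact: Np.
case: eqVneq => [->|pi]; first by rewrite N0.
by case: eqVneq => [->|pg]; rewrite ?Ng ?Np.
Qed.

Let fix_g X : ~~ inv_irr X -> actI g X = X.
Proof.
by move=> nX; have := fus_g g nX; rewrite fus_inv // eqxx orbT; case: eqP.
Qed.

Let trans X Y : ~~ inv_irr X -> ~~ inv_irr Y -> exists h, inv_irr h /\ Y = actI h X.
Proof.
move=> nX nY; have nX' : ~~ inv_irr (st X) by rewrite inv_star.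
have [S2 _] := fus_noninv p2 D8 nY nX'.
have [h /andP [ih hN]] : exists h, inv_irr h && (0 < N Y (st X) h)%N.
  apply/existsP; apply: contra_eqT S2; rewrite negb_exists => /forallP F.
  rewrite big1 // => h ih; by have := F h; rewrite ih /= -leqNgt leqn0 => /eqP.
by exists h; split=> //; move: hN; rewrite fus_inv //; case: eqP.
Qed.

Let chi_actr h l m : inv_irr h -> inv_irr l -> chi h (actI l m) = chi h l * chi h m.
Proof. by move=> ih il; apply: chi_tens => //; rewrite actP // eqxx. Qed.

Let chigX X : ~~ inv_irr X -> chi g X != 1.
Proof.
move=> nX; apply: contraNneq gi => E; apply/eqP/chi_nd => // l.
have Gi h : inv_irr h -> chi g h = 1 by move=> ih; rewrite chi_sym // chig.
case: (boolP (inv_irr l)) => [|nl]; first exact: Gi.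
by have [h [ih ->]] := trans nX nl; rewrite chi_actr // Gi // E mulr1.
Qed.

Let b_ex : exists b, [&& inv_irr b, b != i0 & b != g].
Proof.
apply/existsP; apply: contra_eqT G4; rewrite negb_exists => /forallP F.
suff : (#|[pred h | inv_irr h]| <= 2)%N by case: #|_| => [|[|[|[]]]].
have S : [pred h | inv_irr h] \subset pred2 i0 g.
  by apply/subsetP => h; rewrite !inE => ih; have := F h; rewrite ih /= negb_and !negbK.
by apply: leq_trans (subset_leq_card S) _; rewrite card2; case: eqP.
Qed.
Let b := projT1 (cid b_ex).
Let ib : inv_irr b. Proof. by case/and3P: (projT2 (cid b_ex)). Qed.
Let bi : b != i0. Proof. by case/and3P: (projT2 (cid b_ex)). Qed.
Let bg : b != g. Proof. by case/and3P: (projT2 (cid b_ex)). Qed.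

Let actb0 : actI b i0 = b. Proof. by rewrite actC ?inv_unit // act1. Qed.

Let actg0 : actI g i0 = g. Proof. by rewrite actC ?inv_unit // act1. Qed.

Let inv4 h : inv_irr h -> h \in [:: i0; g; b; actI b g].
Proof.
move=> ih; pose s := [:: i0; g; b; actI b g].
have us : uniq s.
  have n1 : actI b g != b by rewrite -{2}actb0 (inj_eq (actI_inj ib)).
  have n2 : actI b g != g by rewrite actC // -{2}actg0 (inj_eq (actI_inj ig)).
  have n3 : actI b g != i0.
    apply/eqP => E; have : same b i0.
      by apply/sameP => l il; rewrite -E chi_actr // chig // mulr1.
    by rewrite sameg (negPf bi) (negPf bg).
  by rewrite /s /= !inE !negb_or [i0 == g]eq_sym [i0 == b]eq_sym [i0 == actI b g]eq_sym [g == b]eq_sym [g == actI b g]eq_sym [b == actI b g]eq_sym gi bi bg n1 n2 n3.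
have sub : {subset s <= enum [pred h | inv_irr h]}.
  by move=> y; rewrite mem_enum !inE => /or4P [] /eqP ->; rewrite ?inv_unit ?act_inv.
have [|_ E] := uniq_min_size us sub; first by rewrite -cardE G4.
by rewrite -[h \in _]/(h \in s) E mem_enum.
Qed.

(** [b] centralizes [g]. If it centralized itself too, it would centralize all four invertible
    objects and lie in the component of the unit, which is only [i0] and [g]. *)
Let chi_bb_neq1 : chi b b != 1.
Proof.
apply/eqP => E; have : same b i0.
  apply/sameP => h ih; rewrite chi_r1 //; have := inv4 ih; rewrite !inE.
  have gb : chi g b = 1 by rewrite chi_sym // chig.
  by case/or4P=> /eqP ->; rewrite ?chi_l1 ?chi_act // ?E ?gb ?mulr1.
by rewrite sameg (negPf bi) (negPf bg).
Qed.

Let bb : actI b b = i0 \/ actI b b = g.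
Proof.
have : actI b b \in [:: i0; g; b; actI b g] by apply: inv4; rewrite act_inv.
have n1 : (actI b b == b) = false by rewrite -{3}actb0 (inj_eq (actI_inj ib)) (negPf bi).
rewrite !inE (inj_eq (actI_inj ib)) (negPf bg) n1 !orbF.
by case/orP=> /eqP ->; [left|right].
Qed.

Let chi_bb : chi b b = -1.
Proof.
have : chi b b * chi b b = 1 by rewrite -chi_actr //; case: bb => ->; rewrite ?chi_r1 ?chig.
rewrite -expr2 => /eqP; rewrite sqrf_eq1 (negPf chi_bb_neq1) => /eqP.
by [].
Qed.

Let b_sq : actI b b = i0.
Proof.
case: bb => // E; case/negP: gi; apply/eqP.
have sbb : simple (irr C b ⊗ irr C b) by exact: simple_iso (isomorphic_sym (act_iso b ib)) (irr_simple _).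
(* [e] is the self-braiding of [b], so [e ^+ 2] is [chi b b = -1]. Four crossings give [e ^+ 4 = 1]
   as the self-braiding of [b ⊗ b], which is [g] by [E]; now [fixed_by_boson] applies. *)
pose e := sc (braid (irr C b) (irr C b)).
have He T : brT (irr C b) (irr C b) T = e *: idm _.
  by rewrite brTE [X in opT X T](scE _ sbb) opTE bmapZl bmap1 compZr compZl compm1 invK.
have e2 : e ^+ 2 = -1.
  rewrite -chi_bb; apply: cen_chi => T; rewrite b2TE !He compZl compZr comp1m scalerA.
  by [].
have [s] : isomorphic (irr C b ⊗ irr C b) (irr C g) by rewrite -E; exact: act_iso.
have Hg T : brT (irr C g) (irr C g) T = idm _.
  rewrite (brT_isom s (brT_square He)) -[4%N]/(2 * 2)%N exprM e2 sqrrN expr1n.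
  exact: scale1r.
have [f] : isomorphic (irr C g ⊗ irr C x) (irr C x) by rewrite -{2}(fix_g nx); exact: act_iso.
apply: irr_inj; apply: isomorphic_trans _ (unit_irrP C).
apply: (fixed_by_boson j f (irr_simple x) (irr_simple g) Hg) => p.
rewrite (hdim_iso (isomorphic_refl _) (tens_iso (starP x) (isomorphic_refl _))).
rewrite -/(N (st x) x p) fusC fus_g // lt0b => /orP [] /eqP ->; last by right; exact: isomorphic_refl.
by left; exact/isomorphic_sym/unit_irrP.
Qed.

Let chi_b_sq l : chi b l * chi b l = 1.
Proof. by rewrite -chi_act // b_sq chi_l1. Qed.

Let chi_b_pm l : chi b l = 1 \/ chi b l = -1.
Proof.
have /eqP := chi_b_sq l; rewrite -expr2 sqrf_eq1 => /orP [] /eqP ->; by [left|right].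
Qed.

Lemma eight_structure : exists g b X,
  [/\ [/\ inv_irr g, inv_irr b, ~~ inv_irr X & g != i0],
      [/\ b != i0, actI b b = i0, chi b b = -1 & chi b g = 1 /\ chi b X = 1],
      forall p, N X (st X) p = ((p == i0) || (p == g)),
      forall l, chi b l = -1 \/ chi b l = 1 /\ l \in [:: i0; g; X]
    & forall l, cen (irr C X) (irr C l) 1 <-> l \in [:: i0; b]].
Proof.
have [X [nX bX]] : exists X, ~~ inv_irr X /\ chi b X = 1.
  case: (chi_b_pm x) => E; first by exists x.
  exists (actI b x); rewrite act_inv //; split=> //.
  have xb : (0 < N b x (actI b x))%N by rewrite actP // eqxx.
  by rewrite (chi_tens ib xb) chi_bb E mulrN1 opprK.
have bXE : chi b (actI b X) = -1.
  have xb : (0 < N b X (actI b X))%N by rewrite actP // eqxx.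
  by rewrite (chi_tens ib xb) bX chi_bb mulr1.
have non2 l : ~~ inv_irr l -> l \in [:: X; actI b X].
  move=> nl; have us : uniq [:: X; actI b X].
    by rewrite /= inE andbT; apply: contraNneq neg1 => E; rewrite -bXE -E bX.
  have sub : {subset [:: X; actI b X] <= enum [pred l | ~~ inv_irr l]}.
    by move=> y; rewrite mem_enum !inE => /orP [] /eqP ->; rewrite ?act_inv.
  by have [|_ E] := uniq_min_size us sub; rewrite -?cardE ?M2 // E mem_enum.
have bgE : chi b (actI b g) = -1 by rewrite chi_actr // chi_bb chig // mulr1.
exists g, b, X; split=> //.
- by split=> //; split=> //; exact: chig.
- by move=> p; exact: fus_g.
- move=> l; case: (boolP (inv_irr l)) => [/inv4|/non2]; rewrite !inE.
    by case/or4P=> /eqP ->; rewrite ?bgE ?chi_bb; first [by left|by right; rewrite ?chi_r1 ?chig ?eqxx ?orbT].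
  by case/orP=> /eqP ->; [right; rewrite eqxx !orbT|left].
move=> l; split; last first.
  rewrite !inE => /orP [] /eqP ->; first exact: cen_iso (unit_irrP C) (cen_one _).
  by apply: cen_sym; rewrite -bX; exact: chi_cen.
move=> H; case: (boolP (inv_irr l)) => [il|nl].
  have E : chi l X = 1 by apply/esym/cen_chi/cen_sym.
  have := inv4 il; rewrite !inE => /or4P [] /eqP lE; move: E; rewrite lE ?eqxx ?orbT //.
    by move/eqP; rewrite (negPf (chigX nX)).
  by rewrite chi_act // bX mul1r => /eqP; rewrite (negPf (chigX nX)).
(* A noninvertible [l] centralizing the chosen [X] would force [X] to centralize [g], a constituent
   of [l ⊗ st l], against [chigX]. *)
have Hs : cen (irr C X) (irr C (st l)) 1 by apply: cen_iso (starP l) _; exact: cen_dual.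
have n0 : (0 < N l (st l) g)%N by rewrite fus_g // eqxx orbT.
have := sub_cen n0 (cen_tens H Hs); rewrite mulr1 => /cen_sym/cen_chi/esym/eqP.
by rewrite (negPf (chigX nX)).
Qed.
End Eight.
End Combi.

(** * Full fusion subcategories *)

Section Split.
Variables (k : fieldType) (C : lin_cat k).
Implicit Types X Y Z : C.

Lemma mono_split X Y (f : hom X Y) (r : hom Y X) : mono f -> f ∘ r ∘ f = f -> r ∘ f = idm X.
Proof. by move=> mf E; apply: mf; rewrite compA compm1. Qed.
Lemma epi_split X Y (f : hom X Y) (r : hom Y X) : epi f -> f ∘ r ∘ f = f -> f ∘ r = idm Y.
Proof. by move=> mf E; apply: mf; rewrite comp1m. Qed.
Lemma split_mono X Y (f : hom X Y) (r : hom Y X) : r ∘ f = idm X -> mono f.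
Proof. by move=> E Z u v H; rewrite -[u]comp1m -[v]comp1m -E -!compA H. Qed.
Lemma split_mono_kernel X Y (f : hom X Y) (r : hom Y X) :
  r ∘ f = idm X -> is_kernel (idm Y - f ∘ r) f.
Proof.
move=> E; split=> [|Z h]; first by rewrite compBl comp1m -compA E compm1 subrr.
rewrite compBl comp1m => /eqP; rewrite subr_eq0 => /eqP H.
exists (r ∘ h); split=> [|v vE]; first by rewrite compA -H.
by rewrite -vE compA E comp1m.
Qed.

Lemma split_epi_cokernel X Y (f : hom X Y) (r : hom Y X) :
  f ∘ r = idm Y -> is_cokernel (idm X - r ∘ f) f.
Proof.
move=> E; split=> [|Z h]; first by rewrite compBr compm1 compA E comp1m subrr.
rewrite compBr compm1 => /eqP; rewrite subr_eq0 => /eqP H.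
exists (h ∘ r); split=> [|v vE]; first by rewrite -compA -H.
by rewrite -vE -compA E compm1.
Qed.
End Split.

Lemma left_dual_iso (k : fieldType) (C : mon_cat k) (X X' X'' : C) (s : iso X'' X')
    (e : hom (X' ⊗ X) one) (c : hom one (X ⊗ X')) :
  left_dual e c -> left_dual (e ∘ (s ▷ X)) ((X ◁ inv s) ∘ c).
Proof.
case=> H1 H2; split.
  rewrite wlc wrc !compA (rw1 (an2 _ _ _)) !compA (rw0 (_ : (X ◁ (s ▷ X)) ∘ (X ◁ (inv s ▷ X)) = idm _)) //.
  by rewrite -wlc -wrc invK bmap1 wl1.
apply: (iso_can_l (f := s)); rewrite -(runit_nat s) -H2 !wrc !wlc !compA -lunit_nat.
rewrite (rw1 (wex _ _)) !compA (rw1 (wex _ _)) !compA.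
rewrite (rw1 (ian3 _ _ _)) !compA (rw0 (_ : ((X'' ⊗ X) ◁ s) ∘ ((X'' ⊗ X) ◁ inv s) = idm _)); last first.
  by rewrite -wlc invK wl1.
by rewrite -(rw2 (ian1 _ _ _)) -!compA wex.
Qed.

(** Closure under retracts includes closure under isomorphism and, since kernels and cokernels
    split, keeps the full subcategory abelian. *)
Record fusion_closed (k : closedFieldType) (C : fusion_cat k) (P : C -> Prop) : Prop := FusionClosed {
  fc_one : P one;
  fc_tens : forall X Y, P X -> P Y -> P (X ⊗ Y);
  fc_dual : forall X, P X -> P (dual X);
  fc_sum : forall (n : nat) (s : 'I_n -> C) S, direct_sum s S -> (forall i, P (s i)) -> P S;
  fc_retract : forall X Y (i : hom Y X) (p : hom X Y), p ∘ i = idm Y -> P X -> P Y }.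

Section Sub.
Variables (k : closedFieldType) (C : fusion_cat k) (P : C -> Prop).
Hypothesis fc : fusion_closed P.
Variable j : forall X : C, iso X (dual (dual X)).
Implicit Types X Y Z : {X : C | P X}.

Definition sub_lin : lin_cat k := @LinCat k {X : C | P X} (fun X Y => hom (sval X) (sval Y))
  (fun X => idm (sval X)) (fun X Y Z g f => g ∘ f) (fun _ _ _ _ h g f => compA h g f)
  (fun _ _ f => comp1m f) (fun _ _ f => compm1 f)
  (fun _ _ _ g => comp_linearr g) (fun _ _ _ f => comp_linearl f).

Definition sub_iso X Y (f : iso (sval X) (sval Y)) : iso (X : sub_lin) Y :=
  @Iso k sub_lin X Y (fwd f) (inv f) (fwdK f) (invK f).
Definition unsub_iso X Y (f : iso (X : sub_lin) Y) : iso (sval X) (sval Y) :=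
  @Iso k C (sval X) (sval Y) (fwd f) (inv f) (fwdK f) (invK f).

Definition sub_obj (X : C) (p : P X) : sub_lin := exist P X p.

Lemma fc_iso (X Y : C) : isomorphic X Y -> P X -> P Y.
Proof. by case=> f; apply: (fc_retract fc (i := inv f) (p := f)); exact: invK. Qed.

Lemma sub_mono (X Y : sub_lin) (f : hom X Y) : mono f -> exists r : hom Y X, r ∘ f = idm X.
Proof.
by move=> mf; have [r rP] := @regular _ C _ _ f; exists r; exact: (@mono_split _ sub_lin).
Qed.
Lemma sub_epi (X Y : sub_lin) (f : hom X Y) : epi f -> exists r : hom Y X, f ∘ r = idm Y.
Proof.
by move=> mf; have [r rP] := @regular _ C _ _ f; exists r; exact: (@epi_split _ sub_lin).
Qed.

Lemma sub_abelian : abelian_cat sub_lin.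
Proof.
have [AS AK AC _ _] := fus_abelian C; split.
- move=> n s; have [S dS] := AS n (fun i => sval (s i)).
  by exists (sub_obj (fc_sum fc dS (fun i => svalP (s i)))).
- move=> X Y f; have [K [i [fi iP]]] := AK _ _ f.
  have mi : mono i.
    apply: mono_kernel0 => Z g ig; have [|u [uE uU]] := iP Z (i ∘ g); first by rewrite compA fi comp0l.
    by rewrite -(uU g) // (uU 0) // comp0r ig.
  have [r rP] := regular i; have ri := mono_split mi rP.
  by exists (sub_obj (fc_retract fc ri (svalP X))), i; split=> // Z g; exact: iP.
- move=> X Y f; have [Q [p [pf pP]]] := AC _ _ f.
  have ep : epi p.
    move=> Z g h E; have [|u [uE uU]] := pP Z (g ∘ p); first by rewrite -compA pf comp0r.
    by rewrite -(uU g) // -(uU h).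
  have [r rP] := regular p; have pr := epi_split ep rP.
  by exists (sub_obj (fc_retract fc pr (svalP Y))), p; split=> // Z g; exact: pP.
- move=> X Y f /sub_mono [r rf]; exists Y, (idm Y - f ∘ r); exact: (@split_mono_kernel _ sub_lin).
- move=> X Y f /sub_epi [r rf]; exists X, (idm X - r ∘ f); exact: (@split_epi_cokernel _ sub_lin).
Qed.

Lemma sub_is_iso X Y (f : hom (sval X) (sval Y)) :
  is_iso f <-> is_iso (f : @hom k sub_lin X Y).
Proof.
split=> [[i ->]|[i E]]; first by exists (sub_iso i).
by exists (unsub_iso i); rewrite E.
Qed.

Lemma sub_simple X : simple (X : sub_lin) <-> simple (sval X).
Proof.
split=> [[nz sX]|[nz sX]]; split=> // Y f mf.
  have [r rP] := regular f; have rf := mono_split mf rP.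
  have pY := fc_retract fc rf (svalP X).
  have [|zY|iY] := sX (sub_obj pY) f; [|by left|by right; apply/(sub_is_iso (X := sub_obj pY))].
  exact: (@split_mono _ sub_lin (sub_obj pY) X f r rf).
have [r rf] := sub_mono mf.
have [|zY|iY] := sX (sval Y) f; [exact: (@split_mono _ C _ _ f r rf)|by left|by right; apply/sub_is_iso].
Qed.

Lemma sub_isomorphic X Y : isomorphic (X : sub_lin) Y <-> isomorphic (sval X) (sval Y).
Proof. by split=> -[f]; split; [exact: unsub_iso|exact: sub_iso]. Qed.

Lemma sub_semisimple : semisimple sub_lin.
Proof.
move=> X; have [n [s [ss dS]]] := fus_semisimple (sval X).
have Ps i : P (s i).
  have [inj [prj [H _ _]]] := dS; exact: fc_retract fc _ _ _ _ (H i) (svalP X).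
exists n, (fun i => sub_obj (Ps i)); split=> [i|]; [apply/sub_simple; exact: ss|exact: dS].
Qed.

Definition sub_tens : bifunctor sub_lin sub_lin sub_lin :=
  @Bifunctor k sub_lin sub_lin sub_lin
   (fun X Y => sub_obj (fc_tens fc (svalP X) (svalP Y))) (fun _ _ _ _ f g => bmap (tens C) f g)
   (fun _ _ => bmap1 (tens C) _ _) (fun _ _ _ _ _ _ f' f g' g => bmap_comp (tens C) f' f g' g)
   (fun _ _ _ _ f => bmap_linearr (tens C) f) (fun _ _ _ _ g => bmap_linearl (tens C) g).

Definition sub_mon : mon_cat k :=
  @MonCat k sub_lin sub_tens (sub_obj (fc_one fc))
    (fun X Y Z => @sub_iso (sub_tens (sub_tens X Y) Z) (sub_tens X (sub_tens Y Z)) (assoc _ _ _))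
    (fun X => @sub_iso (sub_tens (sub_obj (fc_one fc)) X) X (lunit _))
    (fun X => @sub_iso (sub_tens X (sub_obj (fc_one fc))) X (runit _))
    (fun _ _ _ _ _ _ f g h => assoc_nat f g h)
    (fun _ _ f => lunit_nat f) (fun _ _ f => runit_nat f)
    (fun _ _ _ _ => pentagon _ _ _ _) (fun _ _ => triangle _ _).

Lemma sub_dualP (X : sub_mon) :
  @left_dual k sub_mon X (sub_obj (fc_dual fc (svalP X))) (ev (sval X)) (coev (sval X)).
Proof. exact: (dualP (sval X)). Qed.

(** The isomorphism of [X] with its double dual makes [dual X] a right dual as well, which lies in
    the subcategory by [fc_dual]. *)
Lemma sub_right_dual_ex (X : sub_mon) :
  exists (Y : sub_mon) (e : hom (X ⊗ Y) one) (c : hom one (Y ⊗ X)), left_dual e c.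
Proof.
exists (sub_obj (fc_dual fc (svalP X))), (ev (dual (sval X)) ∘ (j (sval X) ▷ dual (sval X))),
  ((dual (sval X) ◁ inv (j (sval X))) ∘ coev (dual (sval X))).
exact: (left_dual_iso (j (sval X)) (dualP (dual (sval X)))).
Qed.

Definition sub_pred : pred 'I_(rank C) := [pred i | `[< P (irr C i) >]].
Lemma sub_irrP (a : 'I_#|sub_pred|) : P (irr C (enum_val a)).
Proof. by apply/asboolP; exact: (enum_valP a). Qed.
Definition sub_irr (a : 'I_#|sub_pred|) : sub_mon := sub_obj (sub_irrP a).

Lemma sub_irr_simple a : simple (sub_irr a).
Proof. by apply/sub_simple; exact: irr_simple. Qed.
Lemma sub_irr_inj a b : isomorphic (sub_irr a) (sub_irr b) -> a = b.
Proof. by move=> /sub_isomorphic /irr_inj /enum_val_inj. Qed.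
Lemma sub_irr_full (X : sub_mon) : simple X -> exists a, isomorphic X (sub_irr a).
Proof.
move=> /sub_simple /irr_full [i Xi].
have pi : i \in sub_pred by apply/asboolP; exact: fc_iso Xi (svalP X).
exists (enum_rank_in pi i); apply/sub_isomorphic; rewrite /= enum_rankK_in //.
Qed.

Definition sub_fusion : fusion_cat k :=
  @FusionCat k sub_mon sub_abelian sub_semisimple (fun X => sub_obj (fc_dual fc (svalP X)))
    (fun X => ev (sval X)) (fun X => coev (sval X)) sub_dualP sub_right_dual_ex
    (proj2 (sub_simple (sub_obj (fc_one fc))) (@one_simple k C))
    #|sub_pred| sub_irr sub_irr_simple sub_irr_inj sub_irr_full
    (fun X Y => hdim (sval X) (sval Y)) (fun X Y => hdimP (sval X) (sval Y)).
End Sub.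

Definition sub_braided (k : closedFieldType) (C : braided_fusion_cat k) (P : C -> Prop)
    (fc : fusion_closed P) (j : forall X : C, iso X (dual (dual X))) : braided_fusion_cat k :=
  @BraidedFusionCat k (sub_fusion fc j)
    (fun X Y => @sub_iso k C P (sub_obj (fc_tens fc (svalP X) (svalP Y)))
       (sub_obj (fc_tens fc (svalP Y) (svalP X))) (braid (sval X) (sval Y)))
    (fun _ _ _ _ f g => braid_nat f g) (fun _ _ _ => hexagon1 _ _ _) (fun _ _ _ => hexagon2 _ _ _).

Section SubBraided.
Variables (k : closedFieldType) (C : braided_fusion_cat k) (P : C -> Prop).
Variables (fc : fusion_closed P) (j : forall X : C, iso X (dual (dual X))).
Local Notation S := (sub_braided fc j).

Lemma sub_invertible (X : S) : invertible X <-> invertible (sval X).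
Proof.
split=> -[e c]; split.
- exact: (proj2 (@sub_is_iso k C P _ _ _) e).
- exact: (proj2 (@sub_is_iso k C P _ _ _) c).
- exact: (proj1 (@sub_is_iso k C P (dual X ⊗ X : S) (one : S) (ev (sval X))) e).
- exact: (proj1 (@sub_is_iso k C P (one : S) (X ⊗ dual X : S) (coev (sval X))) c).
Qed.

Lemma sub_spherical : spherical j ->
  spherical (C := S) (fun X => @sub_iso k C P X (dual (dual X) : S) (j (sval X))).
Proof.
case=> -[jn jt] js; split; first by split=> [X Y f|X Y]; [exact: jn|exact: jt].
by move=> X; exact: js.
Qed.
End SubBraided.

(** * Deligne products *)

Section FunctorLemmas.
Variables (k : fieldType) (C D : lin_cat k) (F : functor C D).
Lemma fmapB X Y (f g : hom X Y) : fmap F (f - g) = fmap F f - fmap F g.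
Proof. exact: (linB (@fmap_linear _ _ _ F X Y)). Qed.
Lemma fmap0 X Y : fmap F (0 : hom X Y) = 0.
Proof. exact: (lin0 (@fmap_linear _ _ _ F X Y)). Qed.
Lemma fmap_sum X Y I (r : seq I) P (G : I -> hom X Y) :
  fmap F (\sum_(i <- r | P i) G i) = \sum_(i <- r | P i) fmap F (G i).
Proof. exact: (lin_sum (@fmap_linear _ _ _ F X Y)). Qed.
End FunctorLemmas.

Section RightExact.
Variables (k : closedFieldType) (C : fusion_cat k) (D : lin_cat k).

(** By [regular] every cokernel in a semisimple category is split, and any linear functor preserves
    the equations of a splitting. So right exactness is automatic. *)
Lemma fmap_cokernel (F : functor C D) (X Y Q : C) (f : hom X Y) (p : hom Y Q) :
  is_cokernel f p -> is_cokernel (fmap F f) (fmap F p).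
Proof.
move=> [pf pP]; have [r rP] := regular f.
have ep : epi p.
  move=> Z g h E; have [|u [uE uU]] := pP Z (g ∘ p); first by rewrite -compA pf comp0r.
  by rewrite -(uU g) // -(uU h).
have [|s [sp _]] := pP Y (idm Y - f ∘ r); first by rewrite compBl comp1m rP subrr.
have ps : p ∘ s = idm Q.
  by apply: ep; rewrite -compA sp compBr compm1 compA pf comp0l subr0 comp1m.
split=> [|Z g gf]; first by rewrite -fmap_comp pf fmap0.
exists (g ∘ fmap F s); split=> [|u uE].
  by rewrite -compA -fmap_comp sp fmapB compBr fmap1 compm1 fmap_comp compA gf comp0l subr0.
by rewrite -uE -compA -fmap_comp ps fmap1 compm1.
Qed.

Lemma linear_right_exact (F : functor C D) : right_exact F.
Proof. by move=> X Y Z f p; exact: fmap_cokernel. Qed.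
End RightExact.

Section RightExact2.
Variables (k : closedFieldType) (B C : fusion_cat k) (D : lin_cat k) (T : bifunctor B C D).
Definition bif_r (X : B) : functor C D :=
  @Functor k C D (T X) (fun _ _ g => bmap T (idm X) g) (fun Y => bmap1 T X Y)
   (fun _ _ _ g f => bmap_compr T X g f) (fun Y Z => bmap_linearr T (idm X)).
Definition bif_l (Y : C) : functor B D :=
  @Functor k B D (fun X => T X Y) (fun _ _ f => bmap T f (idm Y)) (fun X => bmap1 T X Y)
   (fun _ _ _ g f => bmap_compl T Y g f) (fun X Z => bmap_linearl T (idm Y)).
Lemma bilinear_right_exact : right_exact2 T.
Proof.
split=> [X Y Y' Q f p|Y X X' Q f p]; first exact: (fmap_cokernel (bif_r X)).
exact: (fmap_cokernel (bif_l Y)).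
Qed.
End RightExact2.

(** Decompositions are kept as data rather than as an existence statement, since the functors and
    transformations below are built from chosen ones. *)
Record dec (k : fieldType) (C : lin_cat k) (J : Type) (e : J -> C) (X : C) := Dec {
  dn : nat; dl : 'I_dn -> J;
  di : forall a, hom (e (dl a)) X; dp : forall a, hom X (e (dl a));
  dpi : forall a, dp a ∘ di a = idm _;
  dpi0 : forall a c, a != c -> dp a ∘ di c = 0;
  dip : \sum_a (di a ∘ dp a) = idm X }.
Arguments dn {k C J e X}. Arguments dl {k C J e X}. Arguments di {k C J e X}. Arguments dp {k C J e X}.
Arguments dpi {k C J e X}. Arguments dpi0 {k C J e X} _ [a c]. Arguments dip {k C J e X}.

Lemma dec_ex (k : closedFieldType) (C : fusion_cat k) (J : finType) (e : J -> C) (X : C) :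
  complete e -> dec e X.
Proof.
move=> [se ei ef]; have /cid [n /cid [s /cid2 [ss _ /cid [inj /cid [prj [H1 H2 H3]]]]]] :
    exists n (s : 'I_n -> C), exists2 ss : forall i, simple (s i), True & direct_sum s X.
  by have [n [s [ss H]]] := fus_semisimple X; exists n, s; exists ss.
have L i : {l : J & iso (s i) (e l)}.
  have [l sl] := cid (ef _ (ss i)); exists l.
  have [w _] : {w : iso (s i) (e l) | True} by apply: cid; case: sl => w; exists w.
  exact: w.
exists n (fun i => tag (L i)) (fun i => inj i ∘ inv (tagged (L i))) (fun i => tagged (L i) ∘ prj i).
- by move=> i; rewrite !compA (rw0 (H1 i)) invK.
- by move=> i i' ii; rewrite !compA (rw1 (H2 _ _ ii)) comp0r comp0l.
by rewrite -H3; apply: eq_bigr => i _; rewrite !compA (rw0 (fwdK _)).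
Qed.

Section Deligne.
Variables (k : closedFieldType) (B I D : fusion_cat k) (T : bifunctor B I D).
Variables (J1 J2 : finType) (b : J1 -> B) (y : J2 -> I).
Hypotheses (cb : complete b) (cy : complete y).
Local Notation J := (J1 * J2)%type.
Local Notation e := (fun p : J => T (b p.1) (y p.2)).
Hypothesis ce : complete e.

Lemma box_hom (p p' : J) (h : hom (e p) (e p')) :
  exists (f : hom (b p.1) (b p'.1)) (g : hom (y p.2) (y p'.2)), h = bmap T f g.
Proof.
have [se ei _] := ce; case: (eqVneq p p') h => [<-|ne] h.
  have [c ->] := schur_end h (se p); exists (c *: idm _), (idm _).
  by rewrite bmapZl bmap1.
exists 0, 0; rewrite bmap0l; apply: schur0 => // H.
by move/eqP: ne; apply; exact: ei.
Qed.

Section DecBox.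
Variables (A : lin_cat k) (G : bifunctor B I A) (X : B) (Y : I) (dX : dec b X) (dY : dec y Y).
Local Notation inj := (fun a : 'I_(dn dX) * 'I_(dn dY) => bmap G (di dX a.1) (di dY a.2)).
Local Notation prj := (fun a : 'I_(dn dX) * 'I_(dn dY) => bmap G (dp dX a.1) (dp dY a.2)).
Lemma box_pi a : prj a ∘ inj a = idm _.
Proof. by rewrite -bmap_comp !dpi bmap1. Qed.
Lemma box_pi0 a c : a != c -> prj a ∘ inj c = 0.
Proof.
case: a c => [a a'] [c c']; rewrite xpair_eqE negb_and -bmap_comp /=.
by case/orP=> ne; [rewrite (dpi0 dX ne) bmap0l|rewrite (dpi0 dY ne) bmap0r].
Qed.
Lemma box_ip : \sum_a (inj a ∘ prj a) = idm (G X Y).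
Proof.
transitivity (\sum_a \sum_c bmap G (di dX a ∘ dp dX a) (di dY c ∘ dp dY c)).
  by rewrite pair_bigA; apply: eq_bigr => -[a c] _; rewrite bmap_comp.
rewrite -(bmap1 G) -(dip dX) -(dip dY) bmap_suml; apply: eq_bigr => a _.
by rewrite bmap_sumr.
Qed.
End DecBox.

Section Extension.
Variables (A : lin_cat k) (G : bifunctor B I A).
Local Notation GG := (fun p : J => G (b p.1) (y p.2)).

(** Between products of simple objects every morphism is zero or a scalar, and the scalar is
    determined by its value under [T]. So [boxG] may transport a morphism of [D] to [A] through any
    representative. *)
Lemma box_wd (p p' : J) (f f' : hom (b p.1) (b p'.1)) (g g' : hom (y p.2) (y p'.2)) :
  bmap T f g = bmap T f' g' -> bmap G f g = bmap G f' g'.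
Proof.
have [se ei _] := ce; have [sb bi _] := cb; have [sy yi _] := cy.
case: p p' f f' g g' => [i l] [i' l'] /= f f' g g'.
case: (eqVneq i i') f f' => [<-|ne] f f'; last first.
  by rewrite (schur0 f) ?(schur0 f') ?bmap0l // => H; move/eqP: ne; apply; exact: bi.
case: (eqVneq l l') g g' => [<-|ne] g g'; last first.
  by rewrite (schur0 g) ?(schur0 g') ?bmap0r // => H; move/eqP: ne; apply; exact: yi.
have [c ->] := schur_end f (sb i); have [c' ->] := schur_end f' (sb i).
have [d ->] := schur_end g (sy l); have [d' ->] := schur_end g' (sy l).
rewrite !bmapZl !bmapZr !bmap1 !scalerA => E.
by rewrite (sc_uniq (se (i, l)) E).
Qed.

Definition boxG (p p' : J) (h : hom (e p) (e p')) : hom (GG p) (GG p') :=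
  let w := cid (box_hom h) in bmap G (projT1 w) (projT1 (cid (projT2 w))).
Lemma boxGE (p p' : J) (f : hom (b p.1) (b p'.1)) (g : hom (y p.2) (y p'.2)) :
  boxG (bmap T f g) = bmap G f g.
Proof.
rewrite /boxG; case: cid => f' /= h; case: cid => g' /= E.
by apply: box_wd; rewrite -E.
Qed.
Lemma boxG_comp p p' p'' (h' : hom (e p') (e p'')) (h : hom (e p) (e p')) :
  boxG (h' ∘ h) = boxG h' ∘ boxG h.
Proof.
have [f [g ->]] := box_hom h; have [f' [g' ->]] := box_hom h'.
by rewrite -bmap_comp !boxGE -bmap_comp.
Qed.
Lemma boxG1 p : boxG (idm (e p)) = idm (GG p).
Proof. by rewrite -bmap1 boxGE bmap1. Qed.
Lemma boxG_linear p p' : linear (@boxG p p').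
Proof.
have [se ei _] := ce.
move=> a h h'; case: (eqVneq p p') h h' => [<-|ne] h h'.
  have S c : boxG (c *: idm (e p)) = c *: idm (GG p).
    by rewrite -bmap1 -bmapZl boxGE bmapZl bmap1.
  have [c ->] := schur_end h (se p); have [c' ->] := schur_end h' (se p).
  by rewrite scalerA -scalerDl !S scalerDl scalerA.
have Z h0 : boxG h0 = 0 :> hom (GG p) (GG p').
  rewrite (_ : h0 = bmap T 0 0); first by rewrite boxGE bmap0l.
  by rewrite bmap0l; apply: schur0 => // H; move/eqP: ne; apply; exact: ei.
by rewrite !Z scaler0 addr0.
Qed.

(* Simultaneous decompositions of an object Z of D and of an object V of A, the
   intended image of Z. *)
Record pres (pZ : D) (pV : A) := Pres {
  pK : finType; pl : pK -> J;
  zi : forall a, hom (e (pl a)) pZ; zp : forall a, hom pZ (e (pl a));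
  vi : forall a, hom (GG (pl a)) pV; vp : forall a, hom pV (GG (pl a));
  zpi : forall a, zp a ∘ zi a = idm _;
  zpi0 : forall a c, a != c -> zp a ∘ zi c = 0;
  zsum : \sum_a (zi a ∘ zp a) = idm pZ;
  vpi : forall a, vp a ∘ vi a = idm _;
  vpi0 : forall a c, a != c -> vp a ∘ vi c = 0;
  vsum : \sum_a (vi a ∘ vp a) = idm pV }.

Arguments pK {pZ pV}. Arguments pl {pZ pV}. Arguments zi {pZ pV}. Arguments zp {pZ pV}.
Arguments vi {pZ pV}. Arguments vp {pZ pV}. Arguments zpi {pZ pV}. Arguments zpi0 {pZ pV} _ [a c].
Arguments zsum {pZ pV}. Arguments vpi {pZ pV}. Arguments vpi0 {pZ pV} _ [a c]. Arguments vsum {pZ pV}.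

(** The matrix entries of [h] with respect to [Q] and [Q'] are transported by [boxG] and reassembled
    in [A]. Applied to the identity, this compares the images obtained from two presentations. *)
Definition ext Z Z' V V' (Q : pres Z V) (Q' : pres Z' V') (h : hom Z Z') : hom V V' :=
  \sum_a \sum_c vi Q' c ∘ boxG (zp Q' c ∘ h ∘ zi Q a) ∘ vp Q a.

Lemma ext_linear Z Z' V V' (Q : pres Z V) (Q' : pres Z' V') : linear (ext Q Q').
Proof.
move=> x h h'; rewrite /ext scaler_sumr -big_split; apply: eq_bigr => a _.
rewrite scaler_sumr -big_split; apply: eq_bigr => c _ /=.
rewrite (comp_linearr (zp Q' c)) (comp_linearl (zi Q a)) boxG_linear.
by rewrite (comp_linearr (vi Q' c)) (comp_linearl (vp Q a)).
Qed.

Lemma ext_comp Z Z' Z'' V V' V'' (Q : pres Z V) (Q' : pres Z' V') (Q'' : pres Z'' V'')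
    (h' : hom Z' Z'') (h : hom Z Z') : ext Q Q'' (h' ∘ h) = ext Q' Q'' h' ∘ ext Q Q' h.
Proof.
rewrite /ext comp_sumr; apply: eq_bigr => a _; rewrite comp_sumr.
have E d : boxG (zp Q'' d ∘ (h' ∘ h) ∘ zi Q a)
      = \sum_c boxG (zp Q'' d ∘ h' ∘ zi Q' c) ∘ boxG (zp Q' c ∘ h ∘ zi Q a).
  under eq_bigr do rewrite -boxG_comp.
  rewrite -(lin_sum (@boxG_linear _ _)); congr boxG.
  rewrite -[in LHS](comp1m h) -(zsum Q') comp_suml !comp_sumr comp_suml.
  by apply: eq_bigr => c _; rewrite !compA.
under eq_bigr do rewrite E comp_sumr comp_suml.
rewrite exchange_big; apply: eq_bigr => c _ /=.
rewrite comp_suml (bigD1 c) //= [X in _ = _ + X]big1 ?addr0 => [|a' ne].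
  by rewrite comp_suml; apply: eq_bigr => d _; rewrite !compA (rw0 (vpi Q' c)).
rewrite comp_suml big1 // => d _.
by rewrite !compA (rw1 (vpi0 Q' ne)) comp0r !comp0l.
Qed.

Lemma ext1 Z V (Q : pres Z V) : ext Q Q (idm Z) = idm V.
Proof.
rewrite /ext -(vsum Q); apply: eq_bigr => a _; rewrite (bigD1 a) //= big1 ?addr0 => [|c ne].
  by rewrite compm1 zpi boxG1 compm1.
by rewrite compm1 zpi0 // (lin0 (@boxG_linear _ _)) comp0r comp0l.
Qed.

Lemma ext_iso_K Z Z' V V' (Q : pres Z V) (Q' : pres Z' V') (s : iso Z Z') :
  ext Q' Q (inv s) ∘ ext Q Q' s = idm V.
Proof. by rewrite -ext_comp fwdK ext1. Qed.
Lemma ext_iso_invK Z Z' V V' (Q : pres Z V) (Q' : pres Z' V') (s : iso Z Z') :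
  ext Q Q' s ∘ ext Q' Q (inv s) = idm V'.
Proof. by rewrite -ext_comp invK ext1. Qed.
Definition ext_iso Z Z' V V' (Q : pres Z V) (Q' : pres Z' V') (s : iso Z Z') : iso V V' :=
  Iso (ext_iso_K Q Q' s) (ext_iso_invK Q Q' s).

(** Decomposing the two factors separately presents [T X Y] and [G X Y] by the same indices; in
    these presentations [ext] turns [bmap T] into [bmap G]. *)
Definition box_pres X Y : pres (T X Y) (G X Y) :=
  let dX := dec_ex X cb in let dY := dec_ex Y cy in
  @Pres _ _ _ (fun a => (dl dX a.1, dl dY a.2)) _ _ _ _
    (box_pi T (dX := dX) (dY := dY)) (box_pi0 T (dX := dX) (dY := dY)) (box_ip T dX dY)
    (box_pi G (dX := dX) (dY := dY)) (box_pi0 G (dX := dX) (dY := dY)) (box_ip G dX dY).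

Lemma ext_box X Y X' Y' (f : hom X X') (g : hom Y Y') :
  ext (box_pres X Y) (box_pres X' Y') (bmap T f g) = bmap G f g.
Proof.
rewrite -[RHS]compm1 -(vsum (box_pres X Y)) comp_sumr; apply: eq_bigr => a _.
rewrite -[bmap G f g]comp1m -(vsum (box_pres X' Y')) !comp_suml; apply: eq_bigr => c _ /=.
have E : boxG (zp (box_pres X' Y') c ∘ bmap T f g ∘ zi (box_pres X Y) a)
    = bmap G (dp (dec_ex X' cb) c.1 ∘ f ∘ di (dec_ex X cb) a.1) (dp (dec_ex Y' cy) c.2 ∘ g ∘ di (dec_ex Y cy) a.2).
  by apply: etrans (boxGE _ _); rewrite !bmap_comp.
by rewrite [X in _ ∘ X ∘ _]E -!bmap_comp !compA.
Qed.

Lemma extension : abelian_cat A ->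
  exists (F : functor D A) (u : forall X Y, iso (F (T X Y)) (G X Y)),
    forall X X' Y Y' (f : hom X X') (g : hom Y Y'),
      u X' Y' ∘ fmap F (bmap T f g) = bmap G f g ∘ u X Y.
Proof.
case=> AS _ _ _ _.
have P Z : {V : A & pres Z V}.
  have dZ := dec_ex Z ce.
  have [V /cid [vi /cid [vp [H1 H2 H3]]]] := cid (AS _ (fun a => GG (dl dZ a))).
  exists V; exact: (Pres (dpi dZ) (dpi0 dZ) (dip dZ) H1 H2 H3).
pose F := @Functor k D A (fun Z => tag (P Z)) (fun Z Z' h => ext (tagged (P Z)) (tagged (P Z')) h)
  (fun Z => ext1 _) (fun _ _ _ _ _ => ext_comp _ _ _ _ _) (fun _ _ => ext_linear _ _).
exists F, (fun X Y => ext_iso (tagged (P (T X Y))) (box_pres X Y) (iso_refl _)).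
move=> X X' Y Y' f g; rewrite /= -ext_comp -ext_box -ext_comp comp1m compm1.
by [].
Qed.
End Extension.

Section Transformation.
Variables (A : lin_cat k) (F F' : functor D A).
Variable theta : forall X Y, hom (F (T X Y)) (F' (T X Y)).
Hypothesis nt : forall X X' Y Y' (f : hom X X') (g : hom Y Y'),
  theta X' Y' ∘ fmap F (bmap T f g) = fmap F' (bmap T f g) ∘ theta X Y.

(** Naturality is assumed only for morphisms of the form [bmap T f g]. Cutting [h] along
    decompositions of the factors leaves pieces between products of simple objects, which have this
    form by [box_hom]. *)
Lemma theta_nat X Y X' Y' (h : hom (T X Y) (T X' Y')) :
  theta X' Y' ∘ fmap F h = fmap F' h ∘ theta X Y.
Proof.
pose dX := dec_ex X cb; pose dY := dec_ex Y cy; pose dX' := dec_ex X' cb; pose dY' := dec_ex Y' cy.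
rewrite -[h]comp1m -[h]compm1 -(box_ip T dX dY) -(box_ip T dX' dY').
rewrite !(comp_suml, comp_sumr) !fmap_sum comp_suml comp_sumr; apply: eq_bigr => c _.
rewrite !comp_sumr !fmap_sum comp_suml comp_sumr; apply: eq_bigr => a _.
have [f [g E]] := @box_hom (dl dX a.1, dl dY a.2) (dl dX' c.1, dl dY' c.2)
  (bmap T (dp dX' c.1) (dp dY' c.2) ∘ h ∘ bmap T (di dX a.1) (di dY a.2)).
have E' : bmap T (di dX' c.1) (di dY' c.2) ∘ bmap T (dp dX' c.1) (dp dY' c.2)
    ∘ (h ∘ (bmap T (di dX a.1) (di dY a.2) ∘ bmap T (dp dX a.1) (dp dY a.2)))
  = bmap T (di dX' c.1) (di dY' c.2) ∘ bmap T f g ∘ bmap T (dp dX a.1) (dp dY a.2).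
  by rewrite -E !compA.
rewrite E' !fmap_comp !compA nt (rw1 (nt _ _)) !compA (rw1 (nt _ _)) !compA.
by [].
Qed.

Lemma transformation : exists eta : forall Z, hom (F Z) (F' Z),
  [/\ natural eta, forall X Y, eta (T X Y) = theta X Y
    & forall eta' : (forall Z, hom (F Z) (F' Z)), natural eta' ->
        (forall X Y, eta' (T X Y) = theta X Y) -> forall Z, eta' Z = eta Z].
Proof.
pose d Z := dec_ex Z ce.
pose eta Z := \sum_a fmap F' (di (d Z) a) ∘ theta (b (dl (d Z) a).1) (y (dl (d Z) a).2) ∘ fmap F (dp (d Z) a).
have U (eta' : forall Z, hom (F Z) (F' Z)) : natural eta' ->
        (forall X Y, eta' (T X Y) = theta X Y) -> forall Z, eta' Z = eta Z.
  move=> n' e' Z; rewrite -[LHS]compm1 -fmap1 -(dip (d Z)) fmap_sum comp_sumr.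
  by apply: eq_bigr => a _; rewrite fmap_comp compA n' e'.
exists eta; split=> // [Z Z' h|X Y].
  transitivity (\sum_a \sum_c fmap F' (di (d Z') c) ∘ fmap F' (dp (d Z') c ∘ h ∘ di (d Z) a)
      ∘ theta (b (dl (d Z) a).1) (y (dl (d Z) a).2) ∘ fmap F (dp (d Z) a)).
    rewrite exchange_big comp_suml; apply: eq_bigr => c _.
    rewrite -[LHS]compA -fmap_comp -[dp _ c ∘ h]compm1 -{1}(dip (d Z)) comp_sumr fmap_sum comp_sumr.
    by apply: eq_bigr => a _; rewrite !compA (fmap_comp F) !compA (rw1 (theta_nat _)) !compA compm1.
  rewrite comp_sumr; apply: eq_bigr => a _.
  rewrite -!comp_suml -[RHS]comp1m -fmap1 -(dip (d Z')) fmap_sum !compA !comp_suml.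
  by apply: eq_bigr => c _; rewrite !fmap_comp !compA.
rewrite /eta -[RHS]compm1 -fmap1 -(dip (d (T X Y))) fmap_sum comp_sumr.
by apply: eq_bigr => a _; rewrite fmap_comp compA theta_nat.
Qed.
End Transformation.

Lemma deligne_of_complete : is_deligne T.
Proof.
split=> [||A abA]; [exact: fus_abelian|exact: bilinear_right_exact|split=> [G _|F F' _ _ theta nt]].
  have [F [u uP]] := extension G abA.
  by exists F, u; split=> //; exact: linear_right_exact.
exact: transformation.
Qed.
End Deligne.

(** * The middle interchange in a braided category *)

Section Shuffle.
Variables (k : fieldType) (C : braided_fusion_cat k).
Implicit Types X Y Z S T : C.

Lemma brT_mod X Y T S :
  (Y ◁ assoc X T S) ∘ assoc Y (X ⊗ T) S ∘ (brT X Y T ▷ S)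
  = brT X Y (T ⊗ S) ∘ (X ◁ assoc Y T S) ∘ assoc X (Y ⊗ T) S.
Proof.
have := mop_mod (braid X Y) [::] T S; rewrite /= !bmap1 !comp1m !brTE => E.
by rewrite -[RHS]compA E.
Qed.

Lemma brT_nat3 X X' Y Y' T T' (f : hom X X') (g : hom Y Y') (h : hom T T') :
  brT X' Y' T' ∘ (f ⊗m (g ⊗m h)) = (g ⊗m (f ⊗m h)) ∘ brT X Y T.
Proof.
rewrite (bmapE (tens C) f) (bmapE (tens C) g h) wlc !compA brT_nat (rw2 (brT_r _ _ _)) (rw2 (brT_l _ _ _)).
by rewrite (bmapE (tens C) g (f ⊗m h)) (bmapE (tens C) f h) wlc (rw2 (wex _ _)).
Qed.

Definition shuffle_iso X X' Y Y' : iso ((X ⊗ Y) ⊗ (X' ⊗ Y')) ((X ⊗ X') ⊗ (Y ⊗ Y')) :=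
  iso_trans (iso_sym (assoc X X' (Y ⊗ Y'))) (iso_trans (wli X (brTi Y X' Y')) (assoc X Y (X' ⊗ Y'))).
Definition shuffle X X' Y Y' : hom ((X ⊗ Y) ⊗ (X' ⊗ Y')) ((X ⊗ X') ⊗ (Y ⊗ Y')) :=
  locked_with nested_key (fwd (shuffle_iso X X' Y Y')).
Lemma shuffleE X X' Y Y' :
  shuffle X X' Y Y' = inv (assoc X X' (Y ⊗ Y')) ∘ (X ◁ brT Y X' Y') ∘ assoc X Y (X' ⊗ Y').
Proof. by rewrite /shuffle unlock /= compA. Qed.
Lemma shuffle_fwd X X' Y Y' : fwd (shuffle_iso X X' Y Y') = shuffle X X' Y Y'.
Proof. by rewrite /shuffle unlock. Qed.
Lemma assoc_shuffle X X' Y Y' :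
  assoc X X' (Y ⊗ Y') ∘ shuffle X X' Y Y' = (X ◁ brT Y X' Y') ∘ assoc X Y (X' ⊗ Y').
Proof. by rewrite shuffleE !compA invK comp1m. Qed.

Lemma shuffle_nat X1 X1' X2 X2' Y1 Y1' Y2 Y2'
    (f1 : hom X1 X1') (f2 : hom X2 X2') (g1 : hom Y1 Y1') (g2 : hom Y2 Y2') :
  shuffle X1' X2' Y1' Y2' ∘ ((f1 ⊗m g1) ⊗m (f2 ⊗m g2))
  = ((f1 ⊗m f2) ⊗m (g1 ⊗m g2)) ∘ shuffle X1 X2 Y1 Y2.
Proof.
apply: (iso_can_l (f := assoc X1' X2' (Y1' ⊗ Y2'))).
rewrite !compA assoc_shuffle assoc_nat -!compA assoc_shuffle assoc_nat !compA.
by rewrite -!bmap_comp !comp1m !compm1 brT_nat3.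
Qed.

Lemma shuffle_assoc X1 X2 X3 Y1 Y2 Y3 :
  (assoc X1 X2 X3 ⊗m assoc Y1 Y2 Y3) ∘ shuffle (X1 ⊗ X2) X3 (Y1 ⊗ Y2) Y3
    ∘ (shuffle X1 X2 Y1 Y2 ▷ (X3 ⊗ Y3))
  = shuffle X1 (X2 ⊗ X3) Y1 (Y2 ⊗ Y3) ∘ ((X1 ⊗ Y1) ◁ shuffle X2 X3 Y2 Y3)
    ∘ assoc (X1 ⊗ Y1) (X2 ⊗ Y2) (X3 ⊗ Y3).
Proof.
set R := Y1 ⊗ (Y2 ⊗ Y3); set S := X3 ⊗ Y3; set W := X2 ⊗ Y2.
apply: (iso_can_l (f := assoc X1 (X2 ⊗ X3) R)); apply: (iso_can_l (f := wli X1 (assoc X2 X3 R))) => /=.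
pose M := (X1 ◁ X2 ◁ brT Y1 X3 (Y2 ⊗ Y3)) ∘ (X1 ◁ X2 ◁ Y1 ◁ brT Y2 X3 Y3) ∘ (X1 ◁ brT Y1 X2 (Y2 ⊗ S))
  ∘ (X1 ◁ Y1 ◁ assoc X2 Y2 S) ∘ assoc X1 Y1 (W ⊗ S) ∘ assoc (X1 ⊗ Y1) W S.
transitivity M; last first.
  rewrite ?compA (rw2 (assoc_shuffle _ _ _ _)) ?compA -wlc hexr !wlc ?compA.
  rewrite (rw1 (an3 _ _ _)) ?compA.
  have E : (X1 ◁ Y1 ◁ assoc X2 X3 (Y2 ⊗ Y3)) ∘ (X1 ◁ Y1 ◁ shuffle X2 X3 Y2 Y3)
    = (X1 ◁ Y1 ◁ X2 ◁ brT Y2 X3 Y3) ∘ (X1 ◁ Y1 ◁ assoc X2 Y2 S) by rewrite -!wlc assoc_shuffle.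
  rewrite (rw1 E) ?compA /M; do 3! congr (_ ∘ _).
  by rewrite -?compA -!wlc brT_nat.
rewrite (bmapE (tens C) (assoc X1 X2 X3)) wex ?compA.
have E1 : (X1 ◁ assoc X2 X3 R) ∘ assoc X1 (X2 ⊗ X3) R ∘ (assoc X1 X2 X3 ▷ R)
   = assoc X1 X2 (X3 ⊗ R) ∘ assoc (X1 ⊗ X2) X3 R by rewrite pentagon.
rewrite E1 (rw1 (an3 _ _ _)) ?compA (rw2 (assoc_shuffle _ _ _ _)) ?compA.
rewrite (rw1 (esym (wlc _ _ _))) hexl an3 !wlc.
rewrite /M (rw1 (pentagon _ _ _ _)) ?compA (rw1 (esym (wrc _ _ _))) assoc_shuffle wrc ?compA (rw2 (an2 _ _ _)).
have E2 : (X1 ◁ X2 ◁ assoc Y1 Y2 S) ∘ (X1 ◁ assoc X2 (Y1 ⊗ Y2) S) ∘ (X1 ◁ (brT Y1 X2 Y2 ▷ S))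
   = (X1 ◁ brT Y1 X2 (Y2 ⊗ S)) ∘ (X1 ◁ Y1 ◁ assoc X2 Y2 S) ∘ (X1 ◁ assoc Y1 W S).
  by rewrite -!wlc brT_mod.
by rewrite (rw3 E2) ?compA (rw3 (esym (pentagon _ _ _ _))) ?compA.
Qed.

Lemma lunit_runit_one : fwd (lunit (one : C)) = fwd (runit (one : C)).
Proof.
apply: wr_inj; rewrite -triangle -lunit_tens; congr (_ ∘ _).
by apply: (iso_can_l (f := lunit one)); rewrite lunit_nat.
Qed.

Lemma shuffle_lunit X Y :
  (lunit X ⊗m lunit Y) ∘ shuffle one X one Y ∘ (inv (lunit one) ▷ (X ⊗ Y)) = lunit (X ⊗ Y).
Proof.
rewrite bmapE wex shuffleE ?compA -(rw2 (ian3 _ _ _)) -lunit_tens ?compA (rw0 (invK _)).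
rewrite (rw1 (esym (wlc _ _ _))) br_lunit (rw1 (triangle _ _)).
by rewrite -lunit_runit_one -compA -wrc invK bmap1 compm1.
Qed.

Lemma shuffle_runit X Y :
  (runit X ⊗m runit Y) ∘ shuffle X one Y one ∘ ((X ⊗ Y) ◁ inv (lunit one)) = runit (X ⊗ Y).
Proof.
rewrite bmapE wex shuffleE ?compA -(rw2 (ian3 _ _ _)) -triangle ?compA (rw0 (invK _)).
have E : (X ◁ lunit Y) ∘ (X ◁ one ◁ runit Y) ∘ (X ◁ brT Y one one) = (X ◁ runit Y) ∘ (X ◁ Y ◁ lunit one).
  by rewrite -!wlc lunit_nat -compA lunit_br.
rewrite E -(rw2 (an3 _ _ _)) (rw0 (_ : ((X ⊗ Y) ◁ lunit one) ∘ ((X ⊗ Y) ◁ inv (lunit one)) = idm _)).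
  exact: runit_tens.
by rewrite -wlc invK wl1.
Qed.

(** The braiding on the right crosses [X] with [Y'], and the interchange that follows crosses them
    back; by hypothesis these two crossings cancel, leaving those on the left. *)
Lemma shuffle_braid X X' Y Y' : braid Y' X ∘ braid X Y' = idm (X ⊗ Y') ->
  (braid X X' ⊗m braid Y Y') ∘ shuffle X X' Y Y' = shuffle X' X Y' Y ∘ braid (X ⊗ Y) (X' ⊗ Y').
Proof.
move=> H; apply: (iso_can_l (f := assoc X' X (Y' ⊗ Y))).
have E1 : assoc X' Y' (X ⊗ Y) ∘ braid (X ⊗ Y) (X' ⊗ Y') = (X' ◁ braid (X ⊗ Y) Y') ∘ brT (X ⊗ Y) X' Y'.
  rewrite brTE opTE ?compA -hexagon1 (rw0 (invK _)) //.
have E2 : brT Y' X Y ∘ braid (X ⊗ Y) Y' ∘ inv (assoc X Y Y') = X ◁ braid Y Y'.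
  rewrite brTE opTE ?compA (rw3 (hexagon2 _ _ _)) ?compA (rw1 (esym (wrc _ _ _))) H bmap1 compm1 invK comp1m //.
rewrite [RHS]compA assoc_shuffle -[RHS]compA E1.
have E3 : assoc X' X (Y' ⊗ Y) ∘ (braid X X' ▷ (Y' ⊗ Y)) = brT X X' (Y' ⊗ Y) ∘ assoc X X' (Y' ⊗ Y).
  by rewrite brTE opTE (rw0 (fwdK _)).
rewrite (bmapE (tens C) (braid X X')) wex ?compA E3 (rw2 (an3 _ _ _)) (rw2 (assoc_shuffle _ _ _ _)) brT_nat.
rewrite -E2 !wlc (rw3 (esym (hexl _ _ _ _))) ?compA (rw0 (_ : (X' ◁ inv (assoc X Y Y')) ∘ (X' ◁ assoc X Y Y') = idm _)) //.
by rewrite -wlc fwdK wl1.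
Qed.
End Shuffle.

(** * The two factors *)

Section InvertibleObjects.
Variables (k : closedFieldType) (C : fusion_cat k).
Implicit Types X Y : C.

Lemma simple_invertible X : ~ is_zero X -> simple (dual X ⊗ X) -> simple (X ⊗ dual X) -> invertible X.
Proof.
move=> nz s1 s2; split.
  case: (schur (ev X) s1 (@one_simple k C)) => // e0; case: nz.
  apply: (wr_inj (X := X)); rewrite bmap1 -zig1 evTE /pairT e0 bmap0l.
  by rewrite comp0r comp0l bmap0r comp0l bmap0l.
case: (schur (coev X) (@one_simple k C) s2) => // e0; case: nz.
apply: (wr_inj (X := X)); rewrite bmap1 -zig1 coTE e0 bmap0l.
by rewrite comp0r comp0l comp0r bmap0l.
Qed.

Lemma invertible_tens X : invertible X -> isomorphic (dual X ⊗ X) one /\ isomorphic (X ⊗ dual X) one.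
Proof.
by case=> -[i _] [c _]; split; split; [exact: i|exact: iso_sym c].
Qed.

(** Each row of the matrix has a single entry 1, so the constant vector 1 is a positive eigenvector
    with eigenvalue 1. *)
Lemma FPdim_irr_simple i : (forall l, simple (irr C i ⊗ irr C l)) -> FPdim_irr i = 1.
Proof.
move=> H; apply: (max_eigenvalue_perron (v := fun=> 1)) => //.
- exact: leq_ltn_trans (ltn_ord i).
- by move=> a l; rewrite mxE ler0n.
move=> a; rewrite mul1r; have [m mP] := irr_full (H a).
rewrite (bigD1 m) //= mxE (hdim_iso (isomorphic_refl _) mP) hdim_simple eqxx mulr1 big1 ?addr0 // => l lm.
by rewrite mxE (hdim_iso (isomorphic_refl _) mP) hdim_simple (negPf lm) mul0r.
Qed.

Lemma sum_of_ones X i0 : isomorphic one (irr C i0) -> (forall p, p != i0 -> hdim (irr C p) X = 0%N) ->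
  exists n : nat, direct_sum (fun _ : 'I_n => one) X.
Proof.
case=> u H; exists (hdim (irr C i0) X), (fun a => iinj a ∘ u), (fun a => inv u ∘ iprj a); split=> [a|a c ac|].
- by rewrite !compA (rw1 (iprj_inj _ _)) eqxx scale1r compm1 fwdK.
- by rewrite !compA (rw1 (iprj_inj _ _)) (negPf ac) scale0r comp0r comp0l.
rewrite -[RHS]isum (bigD1 i0) //= [X in _ = _ + X]big1 ?addr0 => [|p /H h0].
  by apply: eq_bigr => a _; rewrite !compA (rw0 (invK _)).
by apply: big1 => a; exfalso; have := ltn_ord a; move: (nat_of_ord a) => c; rewrite h0.
Qed.

Lemma sum_of_two X (i0 g : 'I_(rank C)) : isomorphic one (irr C i0) -> g != i0 ->
  (forall p, hdim (irr C p) X = ((p == i0) || (p == g))) ->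
  direct_sum (fun b : bool => if b then irr C g else one) X.
Proof.
case=> u gi H.
have h0 : (0 < hdim (irr C i0) X)%N by rewrite H eqxx.
have h1 : (0 < hdim (irr C g) X)%N by rewrite H eqxx orbT.
pose a0 := Ordinal h0; pose a1 := Ordinal h1.
exists (fun b : bool => match b return hom (if b then irr C g else one) X with
   true => iinj a1 | false => iinj a0 ∘ u end).
exists (fun b : bool => match b return hom X (if b then irr C g else one) with
   true => iprj a1 | false => inv u ∘ iprj a0 end).
split=> [[]|[] []|] //=.
- by rewrite iprj_inj eqxx scale1r.
- by rewrite !compA (rw1 (iprj_inj _ _)) eqxx scale1r compm1 fwdK.
- by move=> _; rewrite compA iprj_inj0 // comp0l.
- by move=> _; rewrite -compA iprj_inj0 1?eq_sym // comp0r.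
have one_ord m (x y : 'I_m) : (m <= 1)%N -> x = y.
  by move=> m1; apply: ord_inj; have := ltn_ord x; have := ltn_ord y; lia.
rewrite big_bool -[RHS]isum (bigD1 i0) //= (bigD1 g) //= addrCA; congr (_ + _).
  rewrite (bigD1 a1) //= big1 ?addr0 // => a; rewrite (one_ord _ a a1) ?eqxx // H; exact: leq_b1.
rewrite [X in _ = _ + X]big1 ?addr0 => [|p /andP [pi pg]].
  rewrite (bigD1 a0) //= big1 ?addr0 => [|a]; first by rewrite !compA (rw0 (invK _)).
  rewrite (one_ord _ a a0) ?eqxx // H; exact: leq_b1.
apply: big1 => a; exfalso; have := ltn_ord a; move: (nat_of_ord a) => c.
by rewrite H (negPf pi) (negPf pg).
Qed.
End InvertibleObjects.

Section InvertibleSimple.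
Variables (k : closedFieldType) (C : braided_fusion_cat k).
Lemma invertible_simple (Y : C) : invertible Y -> simple Y.
Proof.
move=> iY; have [[e] _] := invertible_tens iY; have [_ /is_isoP [c' [cc _]]] := iY.
have cT T (h : hom T T) : coT Y T ∘ h = 0 -> h = 0.
  move=> E; have L : lunit T ∘ (c' ▷ T) ∘ inv (assoc Y (dual Y) T) ∘ coT Y T = idm T.
    by rewrite coTE !compA (rw0 (fwdK _)) (rw1 (esym (wrc _ _ _))) cc bmap1 compm1 invK.
  by rewrite -[h]comp1m -L -compA E comp0r.
have sd : simple (dual Y ⊗ Y) := simple_iso (isomorphic_sym (inhabits e)) (@one_simple _ C).
apply: simple_end => [z|f].
  case: sd => + _; apply; rewrite /is_zero -bmap1 z bmap0r //.
have [a aE] := schur_end (dual Y ◁ f) sd; exists a.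
apply/eqP; rewrite -subr_eq0; apply/eqP/cT; rewrite coT_nat.
have -> : dual Y ◁ (f - a *: idm Y) = 0.
  by rewrite (linB (bmap_linearr (tens C) _)) bmapZr bmap1 aE subrr.
by rewrite bmap0r comp0l.
Qed.

Lemma centralizer_closed (W : C) : fusion_closed (fun Z => cen W Z 1).
Proof.
split.
- exact: cen_one.
- by move=> X Y HX HY; rewrite -[1]mulr1; exact: cen_tens.
- by move=> X; exact: cen_dual.
- by move=> n s S dS H; exact: cen_sum dS H.
- by move=> X Y i p; exact: cen_retract.
Qed.
End InvertibleSimple.

Section Decomposition.
Variables (k : closedFieldType) (C : braided_fusion_cat k).
Hypotheses (k0 : [pchar k] =i pred0) (nd : non_degenerate C).
Variable j : forall X : C, iso X (dual (dual X)).
Hypothesis sj : spherical j.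
Variable Dn : nat.
Hypothesis HD : FPdim C = Dn%:R.
Local Notation N := (@fus k C).
Local Notation st := (@star k C).
Local Notation i0 := (unit_irr C).
Local Notation inv_irr := (inv_irr k0 nd sj HD).
Local Notation actI := (actI k0 nd sj HD).
Local Notation chi := (chi j).

Lemma inv_irr_invertible (Y : C) p : isomorphic Y (irr C p) -> inv_irr p -> invertible Y.
Proof.
move=> Yp ip; have nz : ~ is_zero Y by have [] := simple_iso (isomorphic_sym Yp) (irr_simple p).
have dY : isomorphic (dual Y) (irr C (st p)) := isomorphic_trans (dual_isom Yp) (starP p).
have isp : inv_irr (st p) by rewrite inv_star.
apply: simple_invertible => //.
  apply: simple_iso (irr_simple (actI (st p) p)); apply: isomorphic_sym.
  exact: isomorphic_trans (tens_iso dY Yp) (act_iso _ isp).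
apply: simple_iso (irr_simple (actI p (st p))); apply: isomorphic_sym.
exact: isomorphic_trans (tens_iso Yp dY) (act_iso _ ip).
Qed.

Lemma invertible_inv_irr (Y : C) p : isomorphic Y (irr C p) -> invertible Y -> inv_irr p.
Proof.
move=> Yp /invertible_tens [_ E].
have dY : isomorphic (dual Y) (irr C (st p)) := isomorphic_trans (dual_isom Yp) (starP p).
have {}E : isomorphic (irr C p ⊗ irr C (st p)) (irr C i0).
  apply: isomorphic_trans (isomorphic_sym (tens_iso Yp dY)) _.
  exact: isomorphic_trans E (unit_irrP C).
have := (fp_char j HD).2 p (st p); rewrite (bigD1 i0) //= big1 ?addr0 => [|m mi].
  rewrite /fus (hdim_iso (isomorphic_refl _) E) hdim_simple eqxx mul1r (fp_char j HD).1.
  rewrite fp_star -expr2 (fp_sq k0 nd sj HD) => /eqP.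
  by rewrite eq_sym -[1]/(1%:R) eqr_nat.
by rewrite /fus (hdim_iso (isomorphic_refl _) E) hdim_simple (negPf mi) mul0r.
Qed.

Lemma all_inv_pointed : (forall i, inv_irr i) -> pointed C.
Proof. by move=> H X /irr_full [i Xi]; exact: inv_irr_invertible Xi (H i). Qed.

Variables g b x : 'I_(rank C).
Hypotheses (ig : inv_irr g) (ib : inv_irr b) (nx : ~~ inv_irr x) (gi : g != i0).
Hypotheses (bi : b != i0) (bb : actI b b = i0) (cbb : chi b b = -1) (cbg : chi b g = 1) (cbx : chi b x = 1).
Hypothesis Nx : forall p, N x (st x) p = ((p == i0) || (p == g)).
Hypothesis Cb : forall l, chi b l = -1 \/ chi b l = 1 /\ l \in [:: i0; g; x].
Hypothesis Cx : forall l, cen (irr C x) (irr C l) 1 <-> l \in [:: i0; b].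

Let neg1 : (-1 : k) <> 1.
Proof.
move=> /eqP; rewrite eq_sym -addr_eq0 -mulr2n => /eqP E; have := k0 2%N.
by rewrite inE /= E eqxx.
Qed.

Local Notation B := (sub_braided (centralizer_closed (irr C x)) j).
Local Notation I := (sub_braided (centralizer_closed (irr C b)) j).

Lemma cen_b l : cen (irr C b) (irr C l) 1 <-> l \in [:: i0; g; x].
Proof.
split=> [/(cen_chi j) E|H]; first by case: (Cb l) => [F|[_ ->]] //; case: neg1; rewrite -F -E.
suff <- : chi b l = 1 by exact: chi_cen ib.
move: H; rewrite !inE => /or3P [] /eqP -> //; exact: (chi_r1 ib).
Qed.



Lemma B_nondegenerate : non_degenerate B.
Proof.
move=> [Z PZ] H; pose Bb : B := exist _ (irr C b) (proj2 (Cx b) (mem_last i0 [:: b])).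
have cbZ : cen (irr C b) Z 1.
  by apply/cen_sym/cenP; exact: (H Bb).
suff [n dn] : exists n : nat, direct_sum (fun _ : 'I_n => one) Z by exists n.
apply: (sum_of_ones (unit_irrP C)) => p pi.
case: (posnP (hdim (irr C p) Z)) => // n0.
pose a : 'I_(hdim (irr C p) Z) := Ordinal n0.
have R : iprj a ∘ iinj a = idm (irr C p) by rewrite iprj_inj eqxx scale1r.
have := cen_retract R PZ; rewrite Cx !inE (negPf pi) => /eqP pb.
have := cen_retract R cbZ; rewrite pb => /(cen_chi j); rewrite cbb => /esym /neg1.
by [].
Qed.

Lemma B_simple (Y : B) : simple Y -> exists2 l, isomorphic (sval Y) (irr C l) & l \in [:: i0; b].
Proof.
move=> /(sub_simple (centralizer_closed _)) /irr_full [l Yl]; exists l => //; apply/Cx.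
exact: cen_iso Yl (svalP Y).
Qed.

Lemma B_inv l : l \in [:: i0; b] -> inv_irr l.
Proof. by rewrite !inE => /orP [] /eqP -> //; exact: inv_unit. Qed.

Lemma B_pointed : pointed B.
Proof.
move=> Y /B_simple [l Yl lB]; apply/sub_invertible.
exact: inv_irr_invertible Yl (B_inv lB).
Qed.

Lemma B_FPdim : FPdim B = 2%:R.
Proof.
have E1 i : FPdim_irr (C := B) i = 1.
  apply: FPdim_irr_simple => l; apply/(sub_simple (centralizer_closed _)) => /=.
  have iv : inv_irr (enum_val i) by apply: B_inv; apply/Cx; exact: (sub_irrP i).
  exact: simple_iso (isomorphic_sym (act_iso (enum_val l) iv)) (irr_simple _).
rewrite /FPdim (eq_bigr (fun=> 1)) => [|i _]; last by rewrite E1 expr1n.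
have E2 : sub_pred (fun Z => cen (irr C x) Z 1) =i pred2 i0 b.
  by move=> l; rewrite -[RHS](mem_seq2 l i0 b); apply/asboolP/idP => /Cx.
have E3 : rank B = 2%N by apply: etrans (eq_card E2) _; rewrite card2 eq_sym bi.
by rewrite sumr_const card_ord E3.
Qed.

(** The dual of [x] centralizes [b] as well and is noninvertible, and [x] is the only such object.
    This turns [x ⊗ st x] into the square demanded of an Ising category. *)
Lemma st_x : st x = x.
Proof.
have nsx : ~~ inv_irr (st x) by rewrite inv_star.
have : cen (irr C b) (irr C (st x)) 1.
  apply: cen_iso (starP x) _; apply: cen_dual; apply/cen_b; rewrite !inE eqxx !orbT //.
move=> /cen_b; rewrite !inE => /or3P [] /eqP E //; move: nsx; rewrite E ?ig //.
by rewrite inv_unit.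
Qed.

Lemma I_ising : is_ising I.
Proof.
have Pg : cen (irr C b) (irr C g) 1 by apply/cen_b; rewrite !inE eqxx !orbT.
have Px : cen (irr C b) (irr C x) 1 by apply/cen_b; rewrite !inE eqxx !orbT.
pose Ig : I := exist _ (irr C g) Pg; pose Ix : I := exist _ (irr C x) Px.
have Ix_simple : simple Ix by apply/(sub_simple (centralizer_closed _)); exact: irr_simple.
have Ix_ninv : ~ invertible Ix.
  move=> /sub_invertible /(invertible_inv_irr (isomorphic_refl _)).
  by rewrite (negPf nx).
have Iirr (Y : I) : simple (sval Y) -> exists2 l, isomorphic (sval Y) (irr C l) & l \in [:: i0; g; x].
  by move=> /irr_full [l Yl]; exists l => //; apply/cen_b; exact: cen_iso Yl (svalP Y).
split; first by move=> /(_ Ix Ix_simple).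
exists Ig, Ix; split=> //.
- split; first by apply/sub_invertible; exact: inv_irr_invertible (isomorphic_refl _) ig.
  move=> /sub_isomorphic H; case/eqP: gi; apply: irr_inj.
  exact: isomorphic_trans H (unit_irrP C).
- move=> Y /sub_invertible iY; have [l Yl] := Iirr Y (invertible_simple iY).
  have il := invertible_inv_irr Yl iY.
  rewrite !inE => /or3P [] /eqP E.
  + by left; apply/sub_isomorphic; apply: isomorphic_trans Yl _; rewrite E; exact/isomorphic_sym/unit_irrP.
  + by right; apply/sub_isomorphic; rewrite E in Yl.
  + by move: il; rewrite E (negPf nx).
- move=> Y /(sub_simple (centralizer_closed _)) sY niY; have [l Yl] := Iirr Y sY.
  rewrite !inE => /or3P [] /eqP E; last by apply/sub_isomorphic; rewrite E in Yl.
    by case: niY; apply/sub_invertible; apply: inv_irr_invertible Yl _; rewrite E inv_unit.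
  by case: niY; apply/sub_invertible; apply: inv_irr_invertible Yl _; rewrite E.
have dsx : direct_sum (fun c : bool => if c then irr C g else one) (irr C x ⊗ irr C x).
  by apply: (sum_of_two (unit_irrP C) gi) => p; rewrite -Nx st_x.
have [inj [prj [H1 H2 H3]]] := dsx.
exists (fun c => match c return @hom k I (if c then Ig else one) (Ix ⊗ Ix) with true => inj true | false => inj false end).
exists (fun c => match c return @hom k I (Ix ⊗ Ix) (if c then Ig else one) with true => prj true | false => prj false end).
split=> [[]|[] []|]; [exact: H1 true|exact: H1 false|by []|exact: H2 true false|exact: H2 false true|by []|].
by move: H3; rewrite !big_bool.
Qed.

Definition box : bifunctor B I C :=
  @Bifunctor k B I C (fun Y Z => sval Y ⊗ sval Z) (fun _ _ _ _ f h => bmap (tens C) f h)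
   (fun _ _ => bmap1 (tens C) _ _) (fun _ _ _ _ _ _ f' f h' h => bmap_comp (tens C) f' f h' h)
   (fun _ _ _ _ f => bmap_linearr (tens C) f) (fun _ _ _ _ h => bmap_linearl (tens C) h).

Lemma chi_act_in p l : p \in [:: i0; b] -> l \in [:: i0; g; x] -> chi b (actI p l) = chi b p.
Proof.
move=> pB lI; have E : chi b l = 1 by apply/esym/(cen_chi j)/cen_b.
have n0 : (0 < N p l (actI p l))%N by rewrite (actP l _ (B_inv pB)) eqxx.
by rewrite (chi_tens ib n0) E mulr1.
Qed.

(** The sign [chi b] of a product reveals its first factor, since it is 1 on the second, and the
    action of an invertible object is injective. Conversely an object of sign -1 is [b] times one of
    sign 1. *)
Lemma box_complete :
  complete (fun p : 'I_(rank B) * 'I_(rank I) => box (irr B p.1) (irr I p.2)).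
Proof.
have inB (a : 'I_(rank B)) : enum_val a \in [:: i0; b] by apply/Cx; exact: (sub_irrP a).
have inI (a : 'I_(rank I)) : enum_val a \in [:: i0; g; x] by apply/cen_b; exact: (sub_irrP a).
have E p : isomorphic (box (irr B p.1) (irr I p.2)) (irr C (actI (enum_val p.1) (enum_val p.2))).
  exact: act_iso (B_inv (inB _)).
split=> [p|[a c] [a' c'] /= H|Y /irr_full [m Ym]].
- exact: simple_iso (isomorphic_sym (E p)) (irr_simple _).
- have {}H := irr_inj (isomorphic_trans (isomorphic_sym (E (a, c))) (isomorphic_trans H (E (a', c')))).
  have aa : enum_val a = enum_val a'.
    have := congr1 (chi b) H; rewrite !chi_act_in //=.
    have := inB a; have := inB a'; rewrite !inE => /orP [] /eqP -> /orP [] /eqP -> //;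
    by rewrite cbb (chi_r1 ib) => F; case: neg1.
  move: H; rewrite /= aa => /(actI_inj (B_inv (inB a'))) /enum_val_inj ->.
  by rewrite (enum_val_inj aa).
have [p [l [pB lI plm]]] : exists p l, [/\ p \in [:: i0; b], l \in [:: i0; g; x] & actI p l = m].
  case: (Cb m) => [Em|[Em lI]]; last first.
    by exists i0, m; rewrite mem_head act1.
  exists b, (actI b m); split; first exact: mem_last i0 [:: b].
    apply/cen_b; suff <- : chi b (actI b m) = 1 by exact: chi_cen ib.
    have n0 : (0 < N b m (actI b m))%N by rewrite (actP m _ ib) eqxx.
    by rewrite (chi_tens ib n0) cbb Em mulrNN mulr1.
  have sb : st b = b.
    have := actP b i0 ib; rewrite bb eqxx (N_unit (@fus1 k C) (@fusC k C) (@fusD k C)).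
    by case: eqP.
  by rewrite -{1}sb actK.
have pB' : p \in sub_pred (fun Z => cen (irr C x) Z 1) by apply/asboolP/Cx.
have lI' : l \in sub_pred (fun Z => cen (irr C b) Z 1) by apply/asboolP/cen_b.
exists (enum_rank_in pB' p, enum_rank_in lI' l).
apply: isomorphic_trans Ym _; apply: isomorphic_sym; apply: isomorphic_trans (E _) _ => /=.
by rewrite !enum_rankK_in // plm; exact: isomorphic_refl.
Qed.

Lemma B_cen_I (Y : B) (Z : I) : cen (sval Y) (sval Z) 1.
Proof.
apply: cen_sym; have [n [s [ss dS]]] := fus_semisimple (sval Y).
have [inj [prj [pij _ _]]] := dS; apply: cen_sum dS _ => a.
have [l sl] := irr_full (ss a); apply: cen_iso (isomorphic_sym sl) _.
have := cen_iso sl (cen_retract (pij a) (svalP Y)); rewrite Cx !inE => /orP [] /eqP ->.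
  exact: cen_iso (unit_irrP C) (cen_one _).
by apply: cen_sym; exact: (svalP Z).
Qed.

Lemma box_braided : braided_deligne_product B I C.
Proof.
exists box; split; first exact: deligne_of_complete (irr_complete B) (irr_complete I) box_complete.
exists (fun Y Y' Z Z' => shuffle_iso (sval Y) (sval Y') (sval Z) (sval Z')), (iso_sym (lunit one)).
split.
- move=> Y1 Y1' Y2 Y2' Z1 Z1' Z2 Z2' f1 f2 g1 g2.
  by have H := @shuffle_nat k C (sval Y1) (sval Y1') (sval Y2) (sval Y2') (sval Z1) (sval Z1') (sval Z2) (sval Z2') f1 f2 g1 g2; rewrite -!shuffle_fwd in H; exact: H.
- move=> Y1 Y2 Y3 Z1 Z2 Z3.
  have H := shuffle_assoc (sval Y1) (sval Y2) (sval Y3) (sval Z1) (sval Z2) (sval Z3).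
  by rewrite -!shuffle_fwd in H; exact: H.
- by move=> Y Z; have H := shuffle_lunit (sval Y) (sval Z); rewrite -!shuffle_fwd in H; exact: H.
- by move=> Y Z; have H := shuffle_runit (sval Y) (sval Z); rewrite -!shuffle_fwd in H; exact: H.
move=> Y Y' Z Z'; have c := (cenP _ _).1 (B_cen_I Y Z').
by have H := shuffle_braid (sval Y') (sval Z) c; rewrite -!shuffle_fwd in H; exact: H.
Qed.

Lemma B_modular : modular B.
Proof. by split; [exact: B_nondegenerate|eexists; exact: sub_spherical sj]. Qed.
End Decomposition.

Lemma braided_equivalent_refl (k : fieldType) (C : braided_fusion_cat k) : braided_equivalent C C.
Proof.
pose F : functor C C := @Functor k C C id (fun _ _ => id) (fun _ => erefl) (fun _ _ _ _ _ => erefl) (fun _ _ _ _ _ => erefl).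
exists F; split.
  exists F, (fun X => iso_refl X), (fun X => iso_refl X).
  by split=> X Y f /=; rewrite comp1m compm1.
exists (fun X Y => iso_refl (X ⊗ Y)), (iso_refl one).
by split=> *; rewrite /= ?bmap1 ?compm1 ?comp1m.
Qed.

Theorem corollary3p5 (k : closedFieldType) (hk : [pchar k] =i pred0)
    (q : nat) (hq : prime q)
    (C : braided_fusion_cat k) (hC : modular C)
    (hFP : FPdim C = (q ^ 3)%N%:R) :
  pointed C \/
  exists B I D : braided_fusion_cat k,
    [/\ [/\ pointed B, modular B & FPdim B = 2%:R],
        is_ising I,
        braided_deligne_product B I D
      & braided_equivalent C D].
Proof.
have [nd [j sj]] := hC.
have [H|[q2 G4 M2]] := pointed_or_two hk nd sj hFP hq erefl; first by left; exact: all_inv_pointed H.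
right; have [x nx] : exists x, ~~ inv_irr hk nd sj hFP x.
  by apply/existsP; apply: contra_eqT M2 => /existsPn H; rewrite eq_card0 // => l; exact/negbTE/H.
have D8 : (q ^ 3 = 2 ^ 3)%N by rewrite q2.
have [g [b [y [[ig ib ny gi] [bi bb cbb [cbg cby]] Ny Cb Cy]]]] := eight_structure D8 G4 M2 nx.
(* [D] is [C] itself with the tensor product as box functor, so the required braided equivalence is
   the identity. *)
exists (sub_braided (centralizer_closed (irr C y)) j), (sub_braided (centralizer_closed (irr C b)) j), C.
split; [split| | |exact: braided_equivalent_refl].
- exact: B_pointed ib Cy.
- by have := B_modular hk sj cbb; move=> /(_ y Cy).
- exact: B_FPdim ib bi Cy.
- exact: I_ising ig ib ny gi cbg cby Ny Cb.
exact: box_braided ib bb cbb cbg cby Cb Cy.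
Qed.
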